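(* Let $0<\alpha<1$, $T>0$ and $x_0\in(0,1)$ be arbitrary. Let $p\in L^\infty(0,1)$, $f\in L^2(0,1)$, and let $\rho\in H^1(0,T)$ satisfy $\rho(0)\neq 0$. Assume that $y\in H_\alpha(0,T;H^1(0,1))$ satisfies $$\partial_t^\alpha y(x,t)-y_{xx}(x,t)+p(x)y(x,t)=\rho(t)f(x)\quad\text{in }(0,1)\times(0,T).$$ If $J^\alpha y(x_0,\cdot)=(J^\alpha y)_x(x_0,\cdot)=0$ in $(0,T)$, then $f\equiv 0$ in $(0,1)$.
   Context: For $\beta>0$, the Riemann-Liouville integral operator is $J^\beta w(t):=\frac1{\Gamma(\beta)}\int_0^t(t-\tau)^{\beta-1}w(\tau)\,d\tau$, acting in the time variable. For $0<\alpha<1$, $H^\alpha(0,T)$ is the Sobolev-Slobodecki space with norm $\left(\|w\|_{L^2(0,T)}^2+\int_0^T\int_0^T\frac{|w(t)-w(\tau)|^2}{|t-\tau|^{1+2\alpha}}\,dt\,d\tau\right)^{1/2}$, and $H_\alpha(0,T)$ is the closure of $\{w\in C^1[0,T];\,w(0)=0\}$ in $H^\alpha(0,T)$. It is known that $H_\alpha(0,T)=J^\alpha L^2(0,T)$. The operator $\partial_t^\alpha:=(J^\alpha)^{-1}$ with domain $H_\alpha(0,T)$ is the minimum closed extension in $L^2(0,T)$ of the Caputo derivative $w\mapsto\frac1{\Gamma(1-\alpha)}\int_0^t(t-\tau)^{-\alpha}w'(\tau)\,d\tau$ defined on $\{w\in C^1[0,T];\,w(0)=0\}$. For a Hilbert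 space $X$, $H_\alpha(0,T;X)$ and $\partial_t^\alpha$ on it are the $X$-valued analogues, i.e. $H_\alpha(0,T;X)=J^\alpha L^2(0,T;X)$ and $\partial_t^\alpha=(J^\alpha)^{-1}$. The equation is understood in $L^2(0,T;H^{-1}(0,1))$, where $H^{-1}(0,1)=(H^1_0(0,1))'$ and $y_{xx}$ is taken in the distribution sense. No boundary conditions are imposed at $x=0,1$. For such $y$ one has $J^\alpha y\in L^2(0,T;H^2(I))$ for every nonempty open interval $I$ with $\overline I\subset(0,1)$, so the traces $J^\alpha y(x_0,\cdot)$ and $(J^\alpha y)_x(x_0,\cdot)$ are well defined in $L^2(0,T)$. *)

(* Defs.v *)
From HB Require Import structures.
From mathcomp Require Import all_boot all_order all_algebra.
From mathcomp Require Import all_classical all_reals all_analysis.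

Set Implicit Arguments.
Unset Strict Implicit.
Unset Printing Implicit Defensive.

Import Order.TTheory GRing.Theory Num.Theory.
Import numFieldNormedType.Exports.
Local Open Scope classical_set_scope.
Local Open Scope ring_scope.

(* Elements of L^2, H^1, ... are represented by functions defined on the whole
   line (or plane) of which only the almost everywhere class of the restriction
   to the relevant open interval (or rectangle) is used. *)

Section FunctionSpaces.
Context {R : realType}.
Local Notation mu := (@lebesgue_measure R).

Definition L2 (a b : R) (u : R -> R) : Prop :=
  u \_ `]a, b[ \in Lfun mu 2%:E.

Definition Linfty (a b : R) (u : R -> R) : Prop :=
  u \_ `]a, b[ \in Lfun mu +oo%E.

Definition ae_in (a b : R) (P : R -> Prop) : Prop :=
  {ae mu, forall t, t \in `]a, b[ -> P t}.

(* C_c^infty(a, b); the closed support is bounded, hence compact as soon as it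
   is included in the open interval. *)
Definition test_function (a b : R) (phi : R -> R) : Prop :=
  (forall n x, derivable (derive1n n phi) x 1) /\
  closure [set x | phi x != 0] `<=` `]a, b[.

Definition weak_deriv (a b : R) (u v : R -> R) : Prop :=
  forall phi, test_function a b phi ->
    \int[mu]_(x in `]a, b[) (u x * derive1 phi x) =
    - \int[mu]_(x in `]a, b[) (v x * phi x).

(* u belongs to H^1(a, b) and its weak derivative is v. *)
Definition H1_deriv (a b : R) (u v : R -> R) : Prop :=
  [/\ L2 a b u, L2 a b v & weak_deriv a b u v].

Definition H1 (a b : R) (u : R -> R) : Prop := exists v, H1_deriv a b u v.

(* The H^1(a, b)-norm of u, where v is the weak derivative of u. *)
Definition H1_norm (a b : R) (u v : R -> R) : R :=
  Num.sqrt (\int[mu]_(x in `]a, b[) (u x ^+ 2 + v x ^+ 2)).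

(* The closure of C_c^infty(a, b) in H^1(a, b). *)
Definition H10 (a b : R) (u : R -> R) : Prop :=
  exists2 v, H1_deriv a b u v &
    forall e, 0 < e -> exists2 phi, test_function a b phi &
      H1_norm a b (u \- phi) (v \- derive1 phi) < e.

(* The dual of H^1_0(a, b): boundedness implies that F only depends on the
   almost everywhere classes of its arguments. *)
Definition Hm1 (a b : R) (F : (R -> R) -> R) : Prop :=
  (forall (c : R) psi1 psi2, H10 a b psi1 -> H10 a b psi2 ->
     F (fun x => c * psi1 x + psi2 x) = c * F psi1 + F psi2) /\
  (exists C : R, forall psi psi', H10 a b psi -> H1_deriv a b psi psi' ->
     `|F psi| <= C * H1_norm a b psi psi').

(* The embedding of L^2(a, b) into H^{-1}(a, b). *)
Definition L2_Hm1 (a b : R) (g psi : R -> R) : R :=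
  \int[mu]_(x in `]a, b[) (g x * psi x).

(* F is the second derivative of u in the sense of distributions, as an element
   of H^{-1}(a, b). *)
Definition distr_deriv2 (a b : R) (u : R -> R) (F : (R -> R) -> R) : Prop :=
  Hm1 a b F /\
  forall phi, test_function a b phi ->
    F phi = \int[mu]_(x in `]a, b[) (u x * derive1n 2 phi x).

(* The continuous representative of u on D takes the value c at x0. *)
Definition continuous_value (D : set R) (u : R -> R) (x0 c : R) : Prop :=
  exists h : R -> R,
    [/\ {within D, continuous h},
        {ae mu, forall x, D x -> u x = h x} & h x0 = c].

End FunctionSpaces.

Section FractionalCalculus.
Context {R : realType}.
Local Notation mu := (@lebesgue_measure R).

Definition Gamma (beta : R) : R :=
  \int[mu]_(s in `]0, +oo[) (s `^ (beta - 1) * expR (- s)).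

Definition riemann_liouville (beta : R) (w : R -> R) (t : R) : R :=
  (Gamma beta)^-1 *
  \int[mu]_(tau in `]0, t[) ((t - tau) `^ (beta - 1) * w tau).

(* Functions of (x, t) on (0, 1) x (0, T) are functions of a pair whose first
   component is x; J^beta acts on the second component. *)

Definition Jop (beta : R) (y : R * R -> R) (z : R * R) : R :=
  riemann_liouville beta (fun tau => y (z.1, tau)) z.2.

Definition L2L2 (T : R) (u : R * R -> R) : Prop :=
  u \_ (`]0, 1[ `*` `]0, T[) \in Lfun (mu \x mu)%E 2%:E.

(* L^2(0, T; H^1(0, 1)), each element of which is identified with a jointly
   measurable function of (x, t). *)
Definition L2H1 (T : R) (u : R * R -> R) : Prop :=
  exists v : R * R -> R, [/\ L2L2 T u, L2L2 T v &
    ae_in 0 T (fun t =>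
      H1_deriv 0 1 (fun x => u (x, t)) (fun x => v (x, t)))].

(* y belongs to H_alpha(0, T; H^1(0, 1)) = J^alpha L^2(0, T; H^1(0, 1)) and
   (J^alpha)^{-1} y = w. *)
Definition frac_deriv (alpha T : R) (y w : R * R -> R) : Prop :=
  [/\ L2H1 T y, L2H1 T w &
    ae_in 0 T (fun t =>
      ae_in 0 1 (fun x => y (x, t) = Jop alpha w (x, t)))].

Definition HalphaH1 (alpha T : R) (y : R * R -> R) : Prop :=
  exists w, frac_deriv alpha T y w.

(* d_t^alpha y - y_xx + p y = rho f in L^2(0, T; H^{-1}(0, 1)), that is, as
   elements of H^{-1}(0, 1) for almost every t. *)
Definition equation (alpha T : R) (p f rho : R -> R) (y : R * R -> R) : Prop :=
  exists2 w, frac_deriv alpha T y w &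
    ae_in 0 T (fun t => exists2 yxx, distr_deriv2 0 1 (fun x => y (x, t)) yxx &
      forall psi, H10 0 1 psi ->
        L2_Hm1 0 1 (fun x => w (x, t)) psi - yxx psi
          + L2_Hm1 0 1 (fun x => p x * y (x, t)) psi =
        rho t * L2_Hm1 0 1 f psi).

(* The traces at x0 of u and of its weak derivative u_x are the values of the
   continuous representatives on (0, 1) of u(., t) and u_x(., t). *)
Definition trace (T : R) (u : R * R -> R) (x0 : R) (g : R -> R) : Prop :=
  ae_in 0 T (fun t => continuous_value `]0, 1[ (fun x => u (x, t)) x0 (g t)).

Definition trace_x (T : R) (u : R * R -> R) (x0 : R) (g : R -> R) : Prop :=
  ae_in 0 T (fun t => exists2 v, H1_deriv 0 1 (fun x => u (x, t)) v &
    continuous_value `]0, 1[ v x0 (g t)).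

End FractionalCalculus.

(* Main.v *)
From HB Require Import structures.
Require Import Defs.
From mathcomp Require Import all_boot all_order all_algebra.
From mathcomp Require Import all_classical all_reals all_analysis.
From mathcomp Require Import measurable_realfun ess_sup_inf.
From mathcomp Require Import lra ring zify.
Import Order.TTheory GRing.Theory Num.Theory.
Import numFieldNormedType.Exports.
Local Open Scope classical_set_scope.
Local Open Scope ring_scope.
Set Implicit Arguments.
Unset Strict Implicit.
Unset Printing Implicit Defensive.

(** Fix a time t and put Y = J^alpha y(., t). Applying J^alpha to the equation gives Y'' = Q := y +
    p Y - (J^alpha rho) f in (0,1), and the two traces say that Y has zero Cauchy data at x0. Hence
    on (x0,1) Y pairs without boundary terms with every X such that X'' = l^2 X + p X + chi and X(1)
    = X'(1) = 0: the integrals of Y (l^2 X + p X + chi) and of Q X agree ([trace_adjoint]). The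
    terms in p cancel. If a, b, c denote the integrals in x of X y, chi y and X f, what remains is a
    scalar fractional equation on (0,T), namely a - l^2 J^alpha a = J^alpha b + c J^alpha rho
    ([scalar_identity]).

    This equation controls c for large l. Choose s with s^alpha = l^2 and integrate against exp(- s
    t) over (0,T). The adjoint of s^alpha J^alpha sends exp(- s t) to a kernel that differs from it
    by at most exp(- s T) ([lap_k_bounds]), so the left side nearly cancels, while rho(0) <> 0 keeps
    the factor of c at least of order 1/s ([lap_source_lower]). The outcome is |c| <= C l^K (exp(- T
    l^2) sup|X| + sup|chi|) ([frequency_bound]), which is the property [source_bound].

    Now fix chi and let X_l be the solution for each l. Its size is at most of order exp(l L), with
    L the length of the interval, and exp(- T l^2) absorbs this: the integral of X_l f grows at most
    polynomially in l. On the other hand X_l depends on l only through cosh(l z), in the sense that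
    a linear combination of the X_l is bounded by the L^1 norm over [-L, L] of the same combination
    of the functions cosh(l z) ([dalembert_est]). As in Mikusinski's moment arguments, consider
    exp(- exp(A (z - tau))) + exp(- exp(A (- z - tau))) - 1, which is close to the indicator of (-
    tau, tau) when A is large. Expanded in series it is the combination of the cosh(j A z) with
    coefficients 1 for j = 0 and 2 (-1)^j exp(- j A tau) / j! for j > 0. As A grows, the terms j > 0
    lose against polynomial growth, the L^1 norm becomes of order tau, and the integral of X_0 f is
    found to be at most a constant times tau, for every tau > 0. It is therefore 0
    ([mikusinski_source]).

    Finally X_0 can be any double primitive of a bounded function from the end point 1, in
    particular any test function, so f = 0 almost everywhere in (x0,1) ([source_zero]). The
    reflection x -> - x carries (0,x0) to (- x0, 0) and the same argument applies there. *)

(** * Real-valued integrals, almost everywhere statements and Fubini's theorem *)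

Section IntegralToolkit.
Context d (T : measurableType d) (R : realType) (mu : {measure set T -> \bar R}).
Implicit Types (f g h : T -> R).

Definition itg f := mu.-integrable [set: T] (EFin \o f).

Lemma itg_measurable f : itg f -> measurable_fun setT f.
Proof. by move=> /measurable_int/measurable_EFinP. Qed.

Lemma itg_le f g : measurable_fun setT f -> (forall x, `|f x| <= g x) ->
  itg g -> itg f.
Proof.
move=> mf fg ig; apply: (le_integrable measurableT _ _ ig).
  exact/measurable_EFinP.
by move=> x _ /=; rewrite lee_fin (le_trans (fg x))// ler_norm.
Qed.

Lemma itgD f g : itg f -> itg g -> itg (fun x => f x + g x).
Proof. exact: integrableD. Qed.

Lemma itgB f g : itg f -> itg g -> itg (fun x => f x - g x).
Proof. exact: integrableB. Qed.

Lemma itgZ k f : itg f -> itg (fun x => k * f x).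
Proof. exact: integrableZl. Qed.

Lemma itgN f : itg f -> itg (fun x => - f x).
Proof. exact: integrableN. Qed.

Lemma itg_abs f : itg f -> itg (fun x => `|f x|).
Proof. exact: integrable_norm. Qed.

Lemma itg_mulb f h M : itg f -> measurable_fun setT h ->
  (forall x, `|h x| <= M) -> itg (fun x => h x * f x).
Proof.
move=> fi mh hM; apply: (itg_le (g := fun x => M * `|f x|)).
- exact: measurable_funM mh (itg_measurable fi).
- by move=> x; rewrite normrM ler_wpM2r.
- exact/itgZ/itg_abs.
Qed.

Lemma itg_mulbr f h M : itg f -> measurable_fun setT h ->
  (forall x, `|h x| <= M) -> itg (fun x => f x * h x).
Proof.
move=> fi mh hM; have := itg_mulb fi mh hM.
by congr itg; apply/funext => x; rewrite mulrC.
Qed.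

Lemma itg_sum (I : Type) (s : seq I) (F : I -> T -> R) :
  (forall i, itg (F i)) -> itg (fun x => \sum_(i <- s) F i x).
Proof.
move=> iF; elim: s => [|i s ih].
  by under eq_fun do rewrite big_nil; exact: integrable0.
by under eq_fun do rewrite big_cons; exact: itgD.
Qed.

Lemma Rint_sum (I : Type) (s : seq I) (F : I -> T -> R) :
  (forall i, itg (F i)) ->
  \int[mu]_x (\sum_(i <- s) F i x) = \sum_(i <- s) \int[mu]_x F i x.
Proof.
move=> iF; elim: s => [|i s ih].
  rewrite big_nil; under eq_Rintegral do rewrite big_nil.
  by rewrite /Rintegral integral0.
rewrite big_cons -ih -RintegralD//; [|exact: iF|exact: itg_sum].
by apply: eq_Rintegral => x _; rewrite big_cons.
Qed.

Lemma Rint_absle f g : measurable_fun setT f -> (forall x, `|f x| <= g x) ->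
  itg g -> `|\int[mu]_x f x| <= \int[mu]_x g x.
Proof.
move=> mf fg ig; have fi := itg_le mf fg ig.
apply: (le_trans (le_normr_Rintegral measurableT fi)).
by apply: le_Rintegral => //; exact: itg_abs.
Qed.

Lemma Rint_mulb_le f h M : itg f -> measurable_fun setT h ->
  (forall x, `|h x| <= M) ->
  `|\int[mu]_x (h x * f x)| <= M * \int[mu]_x `|f x|.
Proof.
move=> fi mh hM; rewrite -RintegralZl//; last exact: itg_abs.
apply: Rint_absle.
- exact: measurable_funM mh (itg_measurable fi).
- by move=> x; rewrite normrM ler_wpM2r.
- exact/itgZ/itg_abs.
Qed.

Lemma Rint_ae f g : measurable_fun setT f -> measurable_fun setT g ->
  {ae mu, forall x, f x = g x} -> \int[mu]_x f x = \int[mu]_x g x.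
Proof.
move=> mf mg fg; congr fine; apply: ae_eq_integral => //.
- exact/measurable_EFinP.
- exact/measurable_EFinP.
- by apply: filterS fg => x /= ->.
Qed.

Lemma itg_ae f g : measurable_fun setT f -> {ae mu, forall x, f x = g x} ->
  itg g -> itg f.
Proof.
move=> mf fg /integrableP[/measurable_EFinP mg gi]; apply/integrableP; split.
  exact/measurable_EFinP.
rewrite (@ae_eq_integral _ _ _ mu setT (fun x => `|(g x)%:E|%E))//.
- exact/measurable_EFinP/measurableT_comp.
- exact/measurable_EFinP/measurableT_comp.
- by apply: filterS fg => x /= ->.
Qed.

(* A nonnegative real function that vanishes in mean vanishes almost
   everywhere. *)
Lemma ge0_Rint0_ae f : (forall x, 0 <= f x) -> itg f ->
  \int[mu]_x f x = 0 -> {ae mu, forall x, f x = 0}.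
Proof.
move=> f0 fi If0.
have : (\int[mu]_x `|(EFin \o f) x| = 0)%E.
  rewrite (eq_integral (EFin \o f)); last first.
    by move=> x _ /=; rewrite ger0_norm.
  rewrite -[LHS]fineK; last exact: integrable_fin_num.
  by congr EFin.
move/(ae_eq_integral_abs mu measurableT (measurable_int mu fi)).
by apply: filterS => x /(_ I) [].
Qed.

End IntegralToolkit.

Section RintegralLeAe.
Context d (T : measurableType d) (R : realType) (mu : {measure set T -> \bar R}).

Lemma Rint_le_ae (f g : T -> R) : itg mu f -> itg mu g ->
  {ae mu, forall x, f x <= g x} -> \int[mu]_x f x <= \int[mu]_x g x.
Proof.
move=> fi gi fg.
have mm : measurable_fun setT (fun x => Num.max (f x) (g x)).
  by apply: measurable_maxr; [exact: itg_measurable fi|exact: itg_measurable gi].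
have E : {ae mu, forall x, Num.max (f x) (g x) = g x}.
  by apply: filterS fg => x /max_idPr.
rewrite -(Rint_ae mm (itg_measurable gi) E).
apply: le_Rintegral => //; first exact: itg_ae E gi.
by move=> x _; rewrite le_max lexx.
Qed.

End RintegralLeAe.

Section AlmostEverywhere.
Context d (T : measurableType d) (R : realType) (mu : {measure set T -> \bar R}).
Implicit Types P Q : T -> Prop.

Lemma ae_imp P Q : (forall x, P x -> Q x) ->
  {ae mu, forall x, P x} -> {ae mu, forall x, Q x}.
Proof. by move=> PQ; apply: filterS. Qed.

Lemma ae_imp2 P1 P2 Q : (forall x, P1 x -> P2 x -> Q x) ->
  {ae mu, forall x, P1 x} -> {ae mu, forall x, P2 x} -> {ae mu, forall x, Q x}.
Proof. by move=> PQ; apply: filterS2. Qed.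

Lemma ae_all P : (forall x, P x) -> {ae mu, forall x, P x}.
Proof. by move=> ?; apply: nearW. Qed.

End AlmostEverywhere.

Section FubiniReal.
Context d1 d2 (T1 : measurableType d1) (T2 : measurableType d2) (R : realType).
Variables (m1 : {sigma_finite_measure set T1 -> \bar R}).
Variables (m2 : {sigma_finite_measure set T2 -> \bar R}).
Implicit Types F : T1 * T2 -> R.

Lemma itg2_ae1 F : itg (m1 \x m2)%E F ->
  {ae m1, forall x, itg m2 (fun y => F (x, y))}.
Proof. exact: ae_integrable1. Qed.

Lemma itg2_ae2 F : itg (m1 \x m2)%E F ->
  {ae m2, forall y, itg m1 (fun x => F (x, y))}.
Proof. exact: ae_integrable2. Qed.

(** [Rintegral] gives an infinite inner integral the value 0, so the function may differ from
    [fubini_F] on a null set, but in absolute value it is dominated by [fubini_F] everywhere. *)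
Lemma itg2_int1 F : itg (m1 \x m2)%E F ->
  itg m1 (fun x => \int[m2]_y F (x, y)).
Proof.
move=> iF; have iG := integrable_fubini_F iF.
apply/integrableP; split.
  apply/measurable_EFinP; apply: measurableT_comp => //.
  exact: measurable_int iG.
move/integrableP : iG => [mG]; apply: le_lt_trans; apply: ge0_le_integral => //.
- apply: measurableT_comp => //; apply/measurable_EFinP.
  by apply: measurableT_comp.
- exact: measurableT_comp.
- move=> x _; rewrite /= /Rintegral /fubini_F /=.
  by case: (\int[m2]_y (F (x, y))%:E)%E => //=; rewrite ?normr0 ?leey.
Qed.

Lemma itg2_int2 F : itg (m1 \x m2)%E F ->
  itg m2 (fun y => \int[m1]_x F (x, y)).
Proof.
move=> iF; have mG := measurable_fubini_G iF.
have mF := measurable_int _ iF.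
have mFy y : measurable_fun setT (fun x => (F (x, y))%:E).
  exact: measurableT_comp mF (measurable_pair2 y).
apply/integrableP; split.
  by apply/measurable_EFinP; exact: measurableT_comp.
apply: le_lt_trans ((integrable21ltyP m1 m2 mF).1 iF).
apply: ge0_le_integral => //.
- by apply: measurableT_comp => //; apply/measurable_EFinP; exact: measurableT_comp.
- apply: (measurable_fun_fubini_tonelli_G (fun z => `|(F z)%:E|%E)) => //.
  exact: measurableT_comp.
- move=> y _; apply: (le_trans _ (le_abse_integral m1 measurableT (mFy y))).
  rewrite /= /Rintegral.
  by case: (\int[m1]_x0 (F (x0, y))%:E)%E => //=; rewrite ?normr0 ?leey.
Qed.

Lemma Rfubini1 F : itg (m1 \x m2)%E F ->
  \int[m1]_x \int[m2]_y F (x, y) = \int[(m1 \x m2)%E]_z F z.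
Proof.
move=> iF; rewrite /Rintegral; congr fine.
rewrite -(integral12_prod_meas1 iF); apply: ae_eq_integral => //.
- apply/measurable_EFinP; apply: measurableT_comp => //.
  exact: measurable_fubini_F iF.
- exact: measurable_fubini_F iF.
- apply: filterS (itg2_ae1 iF) => x iFx _ /=.
  by rewrite fineK//; exact: integrable_fin_num.
Qed.

Lemma Rfubini F : itg (m1 \x m2)%E F ->
  \int[m1]_x \int[m2]_y F (x, y) = \int[m2]_y \int[m1]_x F (x, y).
Proof.
move=> iF; rewrite Rfubini1 // /Rintegral; congr fine.
rewrite -(integral21_prod_meas1 iF); apply: ae_eq_integral => //.
- exact: measurable_fubini_G iF.
- apply/measurable_EFinP; apply: measurableT_comp => //.
  exact: measurable_fubini_G iF.
- apply: filterS (itg2_ae2 iF) => x iFx _ /=.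
  by rewrite fineK//; exact: integrable_fin_num.
Qed.

Lemma itg2_tensor (u : T1 -> R) (v : T2 -> R) : itg m1 u -> itg m2 v ->
  itg (m1 \x m2)%E (fun z => u z.1 * v z.2).
Proof.
move=> iu iv; apply/integrable12ltyP.
  apply/measurable_EFinP; apply: measurable_funM.
    exact: measurableT_comp (itg_measurable iu) measurable_fst.
  exact: measurableT_comp (itg_measurable iv) measurable_snd.
have mu' : measurable_fun setT (fun x => `|(u x)%:E|%E).
  by apply: measurableT_comp => //; exact/measurable_EFinP/itg_measurable/iu.
have mv' : measurable_fun setT (fun x => `|(v x)%:E|%E).
  by apply: measurableT_comp => //; exact/measurable_EFinP/itg_measurable/iv.
rewrite (eq_integral (fun x => `|(u x)%:E| * \int[m2]_y `|(v y)%:E|)%E); last first.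
  move=> x _; rewrite -ge0_integralZl//.
  by apply: eq_integral => y _; rewrite /= normrM EFinM.
rewrite ge0_integralZr//; last by apply: integral_ge0.
apply: lte_mul_pinfty.
- by apply: integral_ge0 => y _; rewrite lee_fin.
- rewrite ge0_fin_numE; first by move/integrableP : iu => [].
  by apply: integral_ge0 => y _; rewrite lee_fin.
- by move/integrableP : iv => [].
Qed.

End FubiniReal.

(** * Lebesgue measure under translation, reflection and scaling; the fundamental theorem of
    calculus *)

Section LineMeasure.
Context (R : realType).
Local Notation mu := (@lebesgue_measure R).
Implicit Types (f g : R -> R) (b : R).

Lemma measurable_ind (i : interval R) :
  measurable_fun [set: R] (\1_[set` i] : R -> R).
Proof. by apply: measurable_indic; exact: measurable_itv. Qed.

Lemma ind_bound (A : set R) (x : R) : `|\1_A x : R| <= 1.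
Proof. by rewrite indicE; case: (x \in A); rewrite ?normr1 ?normr0. Qed.

Lemma ind_in (i : interval R) (x : R) : x \in i -> \1_[set` i] x = 1 :> R.
Proof. by move=> xi; rewrite indicE mem_set. Qed.

Lemma ind_notin (i : interval R) (x : R) : x \notin i -> \1_[set` i] x = 0 :> R.
Proof. by move=> /negP xi; rewrite indicE memNset. Qed.

Lemma itg_ind (i : interval R) f : itg mu f ->
  itg mu (fun x => \1_[set` i] x * f x).
Proof. by move=> fi; apply: (itg_mulb fi (measurable_ind i) (ind_bound _)). Qed.

Lemma itg_ind1 (a b : bool) (u v : R) :
  itg mu (\1_[set` Interval (BSide a u) (BSide b v)] : R -> R).
Proof. exact: integrable_indic_itv. Qed.

Lemma ae_neq (a : R) : {ae mu, forall x, x != a}.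
Proof.
exists [set a]; split; [exact: measurable_set1|exact: lebesgue_measure_set1|].
by move=> x /=; case: (eqVneq x a).
Qed.

Lemma measurable_shift b : measurable_fun [set: R] (fun x : R => x + b).
Proof. exact: measurable_funD. Qed.

Lemma lebesgue_shift b (A : set R) : measurable A ->
  pushforward mu ((fun x => (x + b)%R) : _ -> measurableTypeR R) A = mu A.
Proof.
move=> mA; have mb := measurable_shift b.
apply/esym/lebesgue_measure_unique => //= _ [[u v] _ <-].
rewrite /pushforward.
have -> : (fun x => x + b) @^-1` `]u, v] = `]u - b, v - b]%classic.
  by apply/seteqP; split => x /=; rewrite !in_itv/= ltrBlDr lerBrDr.
rewrite !lebesgue_measure_itv/= !lte_fin ltrD2r; case: ifPn => // _.
by rewrite -!EFinB; congr EFin; ring.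
Qed.

Lemma ge0_integral_shift b (f : R -> \bar R) : measurable_fun setT f ->
  (forall x, 0 <= f x)%E ->
  (\int[mu]_x f (x + b)%R = \int[mu]_x f x)%E.
Proof.
move=> mf f0; have mb := measurable_shift b.
transitivity (\int[pushforward mu ((fun x => (x + b)%R) : _ -> measurableTypeR R)]_x f x)%E.
  by rewrite ge0_integral_pushforward.
by apply: eq_measure_integral => A mA _; exact: lebesgue_shift.
Qed.

Lemma itg_shift b f : itg mu f -> itg mu (fun x => f (x + b)).
Proof.
move=> /integrableP[mf fi]; have mb := measurable_shift b.
apply/integrableP; split; first exact: (measurableT_comp mf mb).
rewrite (ge0_integral_shift b (f := fun x => `|(f x)%:E|%E))//.
exact: measurableT_comp.
Qed.

Lemma Rint_shift b f : itg mu f -> \int[mu]_x f (x + b) = \int[mu]_x f x.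
Proof.
move=> fi; have mb := measurable_shift b; rewrite /Rintegral; congr fine.
transitivity (\int[pushforward mu ((fun x => (x + b)%R) : _ -> measurableTypeR R)]_x (f x)%:E)%E.
  by rewrite integral_pushforward//; [exact: measurable_int fi|exact: itg_shift].
by apply: eq_measure_integral => A mA _; exact: lebesgue_shift.
Qed.

Lemma itg_opp f : itg mu f -> itg mu (fun x => f (- x)).
Proof.
move=> /integrableP[mf fi].
apply/integrableP; split; first exact: (measurableT_comp mf (@oppr_measurable _ _)).
apply: le_lt_trans fi.
have mo : measurable_fun setT (-%R : measurableTypeR R -> measurableTypeR R) by exact: oppr_measurable.
have -> : (\int[mu]_x `|(f x)%:E| =
    \int[pushforward mu (-%R : _ -> measurableTypeR R)]_x `|(f x)%:E|)%E.
  by apply/esym/eq_measure_integral => A mA _; exact: lebesgue_measureN.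
rewrite ge0_integral_pushforward//.
exact: measurableT_comp.
Qed.

Lemma Rint_opp f : itg mu f -> \int[mu]_x f (- x) = \int[mu]_x f x.
Proof.
move=> fi; have mo : measurable_fun setT (-%R : _ -> measurableTypeR R) by exact: oppr_measurable.
rewrite /Rintegral; congr fine.
transitivity (\int[pushforward mu (-%R : _ -> measurableTypeR R)]_x (f x)%:E)%E.
  by rewrite integral_pushforward//; [exact: measurable_int fi|exact: itg_opp].
by apply: eq_measure_integral => A mA _; exact: lebesgue_measureN.
Qed.

Lemma ae_opp (P : R -> Prop) : {ae mu, forall x, P x} -> {ae mu, forall x, P (- x)}.
Proof.
move=> [N [mN N0 PN]]; exists (-%R @^-1` N); split.
- by rewrite -[X in measurable X]setTI; exact: oppr_measurable.
- rewrite -N0; exact: lebesgue_measureN.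
- by move=> x /= Px; exact: PN.
Qed.

(** The image of Lebesgue measure under x -> s x, multiplied by s, agrees with Lebesgue measure on
    half-open intervals, hence everywhere. *)
Lemma ge0_integral_scale (s : R) (f : R -> \bar R) : 0 < s ->
  measurable_fun setT f -> (forall x, 0 <= f x)%E ->
  (\int[mu]_x f x = s%:E * \int[mu]_x f (s * x)%R)%E.
Proof.
move=> s0 mf f0.
have ms : measurable_fun [set: R] ((fun x : R => s * x) : _ -> measurableTypeR R).
  exact: mulrl_measurable.
pose nu : {measure set (measurableTypeR R) -> \bar R} :=
  mscale (NngNum (ltW s0)) (pushforward mu ((fun x : R => (s * x)%R) : _ -> measurableTypeR R)).
have H (A : set R) : measurable A -> nu ms A = mu A.
  move=> mA; apply/esym/lebesgue_measure_unique => //= _ [[u v] _ <-].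
  rewrite /nu/= /mscale/= /pushforward.
  have -> : (fun x => s * x) @^-1` `]u, v] = `]u / s, v / s]%classic.
    by apply/seteqP; split => x /=; rewrite !in_itv/= ltr_pdivrMr// ler_pdivlMr// mulrC.
  rewrite !lebesgue_measure_itv/= !lte_fin ltr_pM2r ?invr_gt0//; case: ifPn => [_|_].
    by rewrite -!EFinB -EFinM; congr EFin; field; exact: lt0r_neq0.
  by rewrite mule0.
transitivity (\int[nu ms]_x f x)%E.
  by apply: eq_measure_integral => A mA _; exact/esym/H.
by rewrite /nu ge0_integral_mscale//= ge0_integral_pushforward.
Qed.

End LineMeasure.

Section FTCsimple.
Context (R : realType).
Local Notation mu := (@lebesgue_measure R).

Lemma integral_FTC (F f : R -> R) (a b : R) : a <= b ->
  (forall x, a <= x <= b -> is_derive x 1 F (f x)) ->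
  (forall x, a <= x <= b -> {for x, continuous f}) ->
  (\int[mu]_(x in `[a, b]) (f x)%:E = (F b - F a)%:E)%E.
Proof.
rewrite le_eqVlt => /predU1P[<-{b}|ab] dF cf.
  by rewrite set_itv1 integral_set1 subrr.
have dd x : a <= x <= b -> derivable F x 1 by move=> /dF [].
have cF x : a <= x <= b -> {for x, continuous F}.
  by move=> /dd/derivable1_diffP/differentiable_continuous.
rewrite (@continuous_FTC2 _ f F)//.
- apply: continuous_in_subspaceT => x; rewrite inE/= in_itv/=.
  exact: cf.
- split.
  + move=> x; rewrite in_itv/= => /andP[ax xb]; apply: dd.
    by rewrite !ltW.
  + by apply: cvg_at_right_filter; apply: cF; rewrite lexx ltW.
  + by apply: cvg_at_left_filter; apply: cF; rewrite lexx ltW.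
- move=> x; rewrite in_itv/= => /andP[ax xb]; rewrite derive1E.
  have h : a <= x <= b by rewrite !ltW.
  by have [_ ->] := dF x h.
Qed.

End FTCsimple.

(** * The Riemann-Liouville kernel and the Gamma function *)

Section PowerKernel.
Context (R : realType) (alpha : R).
Hypotheses (alpha_gt0 : 0 < alpha) (alpha_lt1 : alpha < 1).
Local Notation mu := (@lebesgue_measure R).

(** The kernel of Gamma(alpha) J^alpha, extended by 0 to r <= 0 so that fractional integration
    becomes a convolution over the whole line. *)
Definition rlk (r : R) : R := \1_`]0, +oo[ r * r `^ (alpha - 1).

Lemma rlkE r : 0 < r -> rlk r = r `^ (alpha - 1).
Proof. by move=> r0; rewrite /rlk indicE mem_set ?mul1r//= in_itv/= r0. Qed.

Lemma rlk_eq0 r : r <= 0 -> rlk r = 0.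
Proof. by move=> r0; rewrite /rlk indicE memNset ?mul0r//= in_itv/= andbT ltNge r0. Qed.

Lemma rlk_ge0 r : 0 <= rlk r.
Proof. by rewrite mulr_ge0// ?powR_ge0. Qed.

Lemma measurable_rlk : measurable_fun setT rlk.
Proof. by apply: measurable_funM; [exact: measurable_indic|exact: measurable_powR]. Qed.

Lemma rlk_noninc r r' : 0 < r -> r <= r' -> rlk r' <= rlk r.
Proof.
move=> r0 rr'; have r'0 := lt_le_trans r0 rr'; rewrite !rlkE//.
have -> : alpha - 1 = - (1 - alpha) by ring.
rewrite !powRN lef_pV2 ?posrE ?powR_gt0//.
by apply: ge0_ler_powR; rewrite ?nnegrE ?subr_ge0 // ltW.
Qed.

Lemma integral_powR_ge (a b : R) : 0 < a -> a <= b ->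
  (\int[mu]_(r in `[a, b]) (r `^ (alpha - 1))%:E <= (b `^ alpha / alpha)%:E)%E.
Proof.
move=> a0 ab.
have -> : (\int[mu]_(r in `[a, b]) (r `^ (alpha - 1))%:E =
    (b `^ alpha / alpha - a `^ alpha / alpha)%:E)%E.
  apply: (@integral_FTC _ (fun r => r `^ alpha / alpha)) => //.
  - move=> x /andP[ax xb]; have x0 : x \in `]0, +oo[.
      by rewrite in_itv/= (lt_le_trans a0 ax).
    have dp : is_derive x 1 ((@powR R)^~ alpha) (alpha * x `^ (alpha - 1)).
      by split; [exact: derivable_powR|rewrite -derive1E powR_derive1].
    have -> : x `^ (alpha - 1) = alpha^-1 *: (alpha * x `^ (alpha - 1)).
      by rewrite scalerA mulVf ?scale1r// lt0r_neq0.
    have -> : (fun r => r `^ alpha / alpha) = alpha^-1 *: ((@powR R)^~ alpha).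
      by apply/funext => r; rewrite mulrC.
    exact: is_deriveZ.
  - move=> x /andP[ax xb]; apply: differentiable_continuous.
    apply/derivable1_diffP/derivable_powR.
    by rewrite in_itv/= (lt_le_trans a0 ax).
by rewrite lee_fin lerBlDr lerDl divr_ge0 ?powR_ge0// ltW.
Qed.

(** The interval ]0, T[ is exhausted by the intervals [T/(n+2), T - T/(n+2)], nonempty from n = 0
    on. On each of them the primitive r^alpha / alpha bounds the integral by T^alpha / alpha, and
    monotone convergence concludes. *)
Lemma itg_rlk_trunc (T : R) : itg mu (fun r => \1_`]0, T[ r * rlk r).
Proof.
have [T0|T0] := leP T 0.
  rewrite (_ : (fun r => _) = cst 0); first exact: integrable0.
  by apply/funext => r; rewrite set_itv_ge ?bnd_simp -?leNgt// indic0 mul0r.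
have mrlk := measurable_rlk.
apply/integrableP; split.
  by apply/measurable_EFinP; apply: measurable_funM; first exact: measurable_indic.
have -> : (\int[mu]_r `|(EFin \o (fun r => \1_`]0, T[ r * rlk r)%R) r| =
    \int[mu]_(r in `]0%R, T[) (rlk r)%:E)%E.
  rewrite [RHS]integral_mkcond; apply: eq_integral => r _.
  rewrite /comp abse_EFin ger0_norm; last by rewrite mulr_ge0 ?rlk_ge0.
  rewrite /patch; case: ifPn => rT; first by rewrite indicE rT mul1r.
  by rewrite indicE (negbTE rT) mul0r.
pose F (n : nat) : set R := `[T / n.+2%:R, T - T / n.+2%:R]%classic.
have TF : `]0, T[%classic = \bigcup_n F n.
  apply/seteqP; split => [z /=|r [n _] /=]; rewrite /F/= !in_itv/=.
    move=> /andP[r0 rT].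
    have [n hn] : exists n : nat, T / n.+2%:R < Num.min z (T - z).
      set m := Num.min _ _; have m0 : 0 < m by rewrite /m lt_min r0 subr_gt0.
      exists (Num.truncn (T / m)).+1; rewrite ltr_pdivrMr// -ltr_pdivrMl// mulrC.
      apply: lt_trans (truncnS_gt _) _.
      by rewrite ltr_nat.
    exists n => //=; rewrite /F/= in_itv/=; move: hn; rewrite lt_min => /andP[/ltW -> /=].
    by move=> /ltW; rewrite !lerBrDr addrC.
  have Tn : 0 < T / n.+2%:R by rewrite divr_gt0.
  by move=> /andP[h1 h2]; rewrite (lt_le_trans Tn h1)/= (le_lt_trans h2)// ltrBlDr ltrDl.
rewrite TF; apply: (@le_lt_trans _ _ (T `^ alpha / alpha)%:E); last exact: ltry.
have ndF : {homo F : n m / (n <= m)%N >-> (n <= m)%O}.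
  move=> n m nm; apply/subsetPset => r; rewrite /F /= !in_itv/= => /andP[h1 h2].
  have h : T / m.+2%:R <= T / n.+2%:R.
    by rewrite ler_wpM2l// ?(ltW T0)// lef_pV2 ?posrE// ler_nat.
  by rewrite (le_trans h h1)/= (le_trans h2)// lerD2l lerN2.
have mF n : measurable (F n) by exact: measurable_itv.
have mfF n : measurable_fun (F n) (EFin \o rlk).
  exact/measurable_EFinP/measurable_funTS.
have F0 n r : F n r -> (0 <= (EFin \o rlk) r)%E by rewrite lee_fin rlk_ge0.
have cvgF := @ge0_nondecreasing_set_cvg_integral _ (measurableTypeR R) _ F (EFin \o rlk) mu ndF mF mfF F0.
rewrite -(cvg_lim _ cvgF)//; apply: lime_le; first by apply/cvg_ex; eexists; exact: cvgF.
apply: nearW => n.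
have Tn0 : 0 < T / n.+2%:R by rewrite divr_gt0.
have Tn : T / n.+2%:R <= T / 2.
  by rewrite ler_wpM2l// ?(ltW T0)// lef_pV2 ?posrE// ler_nat.
apply: (@le_trans _ _ (\int[mu]_(r in F n) (r `^ (alpha - 1))%:E)%E).
  rewrite le_eqVlt; apply/orP; left; apply/eqP; apply: eq_integral => r.
  by rewrite inE /F /= in_itv/= => /andP[h _]; rewrite rlkE// (lt_le_trans Tn0 h).
apply: le_trans (integral_powR_ge Tn0 _) _; first by move: (T / _) Tn => t; lra.
rewrite lee_fin ler_pM2r ?invr_gt0//.
by apply: ge0_ler_powR; rewrite ?nnegrE ?(ltW alpha_gt0)//; move: (T / _) Tn Tn0 => t; lra.
Qed.

End PowerKernel.

Section GammaFacts.
Context (R : realType) (alpha : R).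
Hypotheses (alpha_gt0 : 0 < alpha) (alpha_lt1 : alpha < 1).
Local Notation mu := (@lebesgue_measure R).
Local Notation rlk := (rlk alpha).

Lemma rlk_scale (s r : R) : 0 < s -> rlk (s * r) = s `^ (alpha - 1) * rlk r.
Proof.
move=> s0; have [r0|r0] := leP r 0.
  by rewrite !rlk_eq0 ?mulr0// pmulr_rle0.
by rewrite !rlkE ?mulr_gt0// powRM// ltW.
Qed.

Lemma rlk_exp_ge0 r x : 0 <= rlk r * expR x.
Proof. by apply: mulr_ge0; [exact: rlk_ge0|exact: expR_ge0]. Qed.

(** On ]0, 2[ the truncated kernel dominates; from 2 on the kernel is at most 1 and the exponential
    density dominates. *)
Lemma itg_rlk_exp1 : itg mu (fun r => rlk r * expR (- r)).
Proof.
have m1 : measurable_fun setT (fun r : R => rlk r * expR (- r)).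
  by apply: measurable_funM; [exact: measurable_rlk|exact: measurableT_comp].
have ig : itg mu (fun r => \1_`]0, 2[ r * rlk r + exponential_pdf 1 r).
  apply: itgD; first exact: itg_rlk_trunc.
  exact: integrable_exponential_pdf.
apply: itg_le ig => // r; rewrite ger0_norm ?rlk_exp_ge0//.
have e0 : 0 <= exponential_pdf 1 r by exact: exponential_pdf_ge0.
have [r0|r0] := leP r 0.
  by rewrite rlk_eq0// mul0r mulr0 add0r.
have [r2|r2] := ltP r 2.
  rewrite indicE mem_set/= ?in_itv/= ?r0// mul1r.
  apply: le_trans (_ : rlk r * 1 <= _); last by rewrite mulr1 lerDl.
  by rewrite ler_wpM2l ?rlk_ge0// expR_le1 oppr_le0 ltW.
rewrite (exponential_pdfE _ (ltW r0)) mul1r mulN1r.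
apply: (@le_trans _ _ (1 * expR (- r))).
  rewrite ler_wpM2r ?expR_ge0//.
  have : rlk r <= rlk 1 by apply: rlk_noninc => //; lra.
  by rewrite (rlkE alpha ltr01) powR1.
by rewrite mul1r lerDr; apply: mulr_ge0 => //; exact: rlk_ge0.
Qed.

Lemma GammaE : Gamma alpha = \int[mu]_r (rlk r * expR (- r)).
Proof.
rewrite /Gamma Rintegral_mkcond; apply: eq_Rintegral => r _.
by rewrite /patch /rlk indicE; case: ifPn => _; rewrite ?mul1r ?mul0r.
Qed.

Lemma Gamma_gt0 : 0 < Gamma alpha.
Proof.
rewrite GammaE lt0r; apply/andP; split; last first.
  by apply: Rintegral_ge0 => r _; rewrite rlk_exp_ge0.
apply/eqP => If0.
case: (ge0_Rint0_ae _ itg_rlk_exp1 If0) => [r|N [mN N0 HN]]; first exact: rlk_exp_ge0.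
have : (mu `]0%R, 1%R[%classic <= mu N)%E.
  apply: le_measure; rewrite ?inE; [exact: measurable_itv|exact: mN|].
  move=> r /=; rewrite in_itv/= => /andP[r0 r1]; apply: (HN r) => /= /eqP.
  by rewrite mulf_eq0 (gt_eqF (expR_gt0 _)) orbF rlkE// gt_eqF ?powR_gt0.
by rewrite N0 lebesgue_measure_itv/= lte_fin ltr01 oppr0 adde0 lee_fin ler10.
Qed.

Lemma itg_rlk_exp (s : R) : 0 < s -> itg mu (fun r => rlk r * expR (- (s * r))).
Proof.
move=> s0.
have ms : measurable_fun [set: R] (fun r : R => expR (- (s * r))).
  apply: measurableT_comp => //; apply: measurableT_comp => //.
have m1 : measurable_fun setT (fun r : R => rlk r * expR (- r)).
  by apply: measurable_funM; [exact: measurable_rlk|exact: measurableT_comp].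
have /integrableP[_ fi] := itg_rlk_exp1.
apply/integrableP; split.
  by apply/measurable_EFinP; apply: measurable_funM; first exact: measurable_rlk.
move: fi; rewrite (ge0_integral_scale (f := fun r => `|(rlk r * expR (- r))%:E|%E) s0)//; last first.
  by apply: measurableT_comp => //; exact/measurable_EFinP.
have -> : (\int[mu]_r `|(rlk (s * r)%R * expR (- (s * r)%R))%:E| =
    (s `^ (alpha - 1))%:E * \int[mu]_r `|(rlk r * expR (- (s * r)%R))%:E|)%E.
  rewrite -ge0_integralZl//; last 2 first.
  - apply: measurableT_comp => //; apply/measurable_EFinP.
    by apply: measurable_funM; first exact: measurable_rlk.
  - by rewrite lee_fin powR_ge0.
  apply: eq_integral => r _.
  by rewrite rlk_scale// -mulrA !abse_EFin normrM EFinM (ger0_norm (powR_ge0 _ _)).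
rewrite muleA -EFinM => H.
have c0 : 0 < s * s `^ (alpha - 1) by rewrite mulr_gt0// powR_gt0.
rewrite ltNge; apply/negP => h; move: H; rewrite ltNge => /negP; apply.
move: h; rewrite !leye_eq => /eqP ->.
by rewrite gt0_muley ?lte_fin.
Qed.

(** The Laplace transform of the power kernel, from the substitution r -> s r and the homogeneity
    [rlk_scale]. *)
Lemma Rint_rlk_exp (s : R) : 0 < s ->
  \int[mu]_r (rlk r * expR (- (s * r))) = Gamma alpha * s `^ (- alpha).
Proof.
move=> s0.
have i1 := itg_rlk_exp1; have is_ := itg_rlk_exp s0.
have m1 := itg_measurable i1.
rewrite GammaE.
have : (\int[mu]_r (rlk r * expR (- r))%:E =
   s%:E * \int[mu]_r (rlk (s * r)%R * expR (- (s * r)%R))%:E)%E.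
  rewrite (ge0_integral_scale (f := fun r => (rlk r * expR (- r))%:E) s0)//.
  - exact/measurable_EFinP.
  - by move=> r; rewrite lee_fin rlk_exp_ge0.
under [in RHS]eq_integral do rewrite /= rlk_scale// -mulrA EFinM.
rewrite integralZl// => /(congr1 fine).
rewrite fineM//; last first.
  by rewrite fin_numM//; exact: integrable_fin_num.
rewrite fineM//; last exact: integrable_fin_num.
rewrite /Rintegral => -> /=.
have E : s * s `^ (alpha - 1) * s `^ (- alpha) = 1.
  rewrite -{1}(powRr1 (ltW s0)) -!powRD ?(gt_eqF s0) ?implybT//.
  by rewrite (_ : _ + _ = 0) ?powRr0//; ring.
by rewrite mulrA mulrAC E mul1r.
Qed.

End GammaFacts.

(** * The truncated Laplace transform of a fractional equation in time *)

Section Shear.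
Context d (Z : measurableType d) (R : realType) (nu : {sigma_finite_measure set Z -> \bar R}).
Local Notation mu := (@lebesgue_measure R).

(** For fixed z the integral in the first variable does not see the translation by pi z, so the
    norms multiply. With pi the identity this is the integrability of a convolution; with pi the
    second projection it is a convolution in time of functions of space and time. *)
Lemma itg2_shear (k : R -> R) (u pi : Z -> R) : itg mu k -> itg nu u ->
  measurable_fun setT pi ->
  itg (mu \x nu)%E (fun z => k (z.1 - pi z.2) * u z.2).
Proof.
move=> ik iu mpi.
have mk := itg_measurable ik; have mu_ := itg_measurable iu.
apply/integrable21ltyP.
  apply/measurable_EFinP; apply: measurable_funM.
    apply: (measurableT_comp mk); apply: measurable_funB => //.
    exact: measurableT_comp.
  exact: measurableT_comp.
rewrite (eq_integral (fun z => (\int[mu]_t `|(k t)%:E|) * `|(u z)%:E|)%E); last first.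
  move=> z _ /=.
  under eq_integral do rewrite normrM EFinM.
  rewrite ge0_integralZr//; last first.
    apply/measurable_EFinP/measurableT_comp => //.
    exact: measurableT_comp mk (measurable_shift _).
  congr (_ * _)%E.
  apply: (ge0_integral_shift (- pi z) (f := fun t => `|k t|%:E)) => //.
  exact/measurable_EFinP/measurableT_comp.
rewrite ge0_integralZl//; last 2 first.
- by apply: measurableT_comp => //; exact/measurable_EFinP.
- by apply: integral_ge0.
apply: lte_mul_pinfty.
- exact: integral_ge0.
- rewrite ge0_fin_numE; first by move/integrableP : ik => [].
  exact: integral_ge0.
- by move/integrableP : iu => [].
Qed.

End Shear.

Section Laplace.
Context (R : realType) (alpha T : R).
Hypotheses (alpha_gt0 : 0 < alpha) (alpha_lt1 : alpha < 1) (T_gt0 : 0 < T).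
Local Notation mu := (@lebesgue_measure R).
Local Notation rlk := (rlk alpha).
Local Notation Gam := (Gamma alpha).

(** Gamma(alpha) J^alpha h, for h vanishing on the negative half-line. *)
Definition rl_int (h : R -> R) (t : R) : R := \int[mu]_tau (rlk (t - tau) * h tau).

Definition lap_e (s t : R) : R := \1_`]0, T[ t * expR (- (s * t)).

(* Up to the normalisation s^alpha / Gamma(alpha), the adjoint of the fractional
   integral on (0, T) applied to exp(- s t); it differs from exp(- s t) by at
   most exp(- s T). *)
Definition lap_k (s tau : R) : R :=
  s `^ alpha / Gam * \int[mu]_t (lap_e s t * rlk (t - tau)).

Lemma lap_e_bound s t : 0 < s -> `|lap_e s t| <= 1.
Proof.
move=> s0; rewrite /lap_e indicE; case: (boolP (t \in _)); last first.
  by rewrite mul0r normr0.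
rewrite inE/= in_itv/= => /andP[t0 tT]; rewrite mul1r ger0_norm ?expR_ge0//.
by rewrite expR_le1 oppr_le0 mulr_ge0// ltW.
Qed.

Lemma measurable_lap_e s : measurable_fun setT (lap_e s).
Proof.
apply: measurable_funM; first exact: measurable_indic.
by do 2 apply: measurableT_comp => //.
Qed.

Definition supp0T (h : R -> R) := forall t, ~ (0 < t < T) -> h t = 0.

(** The kernel is not integrable at infinity. For t < T and h supported in (0,T) only the arguments
    t - tau in (0,T) contribute, so the kernel may be cut off at T, which makes it integrable. *)
Lemma rl_trunc h t tau : supp0T h -> t < T ->
  rlk (t - tau) * h tau = (\1_`]0, T[ (t - tau) * rlk (t - tau)) * h tau.
Proof.
move=> hT tT; have [tau0|tau0] := leP tau 0.
  by rewrite hT ?mulr0// => /andP[]; rewrite ltNge tau0.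
have [tt|tt] := leP t tau; first by rewrite rlk_eq0 ?mulr0// subr_le0.
by rewrite indicE mem_set ?mul1r//= in_itv/= subr_gt0 tt/=; lra.
Qed.

Lemma itg2_rl (h : R -> R) : itg mu h ->
  itg (mu \x mu)%E (fun z => (\1_`]0, T[ (z.1 - z.2) * rlk (z.1 - z.2)) * h z.2).
Proof.
move=> ih.
exact: (itg2_shear (itg_rlk_trunc alpha_gt0 T) ih (@measurable_id _ _ _)).
Qed.

Lemma ae_itg_rl h : itg mu h -> supp0T h ->
  {ae mu, forall t, 0 < t < T -> itg mu (fun tau => rlk (t - tau) * h tau)}.
Proof.
move=> ih hT; apply: ae_imp (itg2_ae1 (itg2_rl ih)) => t /= + /andP[_ tT].
by congr itg; apply/funext => tau; rewrite (rl_trunc _ hT tT).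
Qed.

Lemma itg_rl_int h : itg mu h -> supp0T h ->
  itg mu (fun t => \1_`]0, T[ t * rl_int h t).
Proof.
move=> ih hT.
have := itg_ind `]0, T[ (itg2_int1 (itg2_rl ih)).
congr itg; apply/funext => t; have [|tT] := boolP (t \in `]0, T[); last first.
  by rewrite !ind_notin ?mul0r.
rewrite in_itv/= => /andP[_ tT]; congr (_ * _); apply: eq_Rintegral => tau _ /=.
by rewrite (rl_trunc _ hT tT).
Qed.

Lemma lap_trunc s h t tau : supp0T h ->
  lap_e s t * ((\1_`]0, T[ (t - tau) * rlk (t - tau)) * h tau) =
  (lap_e s t * rlk (t - tau)) * h tau.
Proof.
move=> hT; have [|tT] := boolP (t \in `]0, T[); last first.
  by rewrite /lap_e ind_notin ?mul0r.
by rewrite in_itv/= => /andP[_ tT]; rewrite -(rl_trunc _ hT tT) mulrA.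
Qed.

Lemma itg2_lap s h : 0 < s -> itg mu h -> supp0T h ->
  itg (mu \x mu)%E (fun z => (lap_e s z.1 * rlk (z.1 - z.2)) * h z.2).
Proof.
move=> s0 ih hT.
have m1 : measurable_fun setT (fun z : measurableTypeR R * measurableTypeR R => lap_e s z.1).
  exact: measurableT_comp (measurable_lap_e s) measurable_fst.
have := itg_mulb (itg2_rl ih) m1 (fun z => lap_e_bound z.1 s0).
by congr itg; apply/funext => z; rewrite lap_trunc.
Qed.

Lemma itg_lap_kernel s tau : 0 < s -> 0 < tau < T ->
  itg mu (fun t => lap_e s t * rlk (t - tau)).
Proof.
move=> s0 tau0; have := itg_shift (- tau) (itg_rlk_trunc alpha_gt0 T).
move=> /itg_mulb /(_ (measurable_lap_e s) (fun t => lap_e_bound t s0)).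
congr itg; apply/funext => t.
have [|tT] := boolP (t \in `]0, T[); last by rewrite /lap_e ind_notin ?mul0r.
rewrite in_itv/= => /andP[_ tT]; congr (_ * _).
have [tt|tt] := leP t tau; first by rewrite rlk_eq0 ?mulr0// subr_le0.
by rewrite ind_in ?mul1r// in_itv/= subr_gt0 tt/=; move: tau0; lra.
Qed.

Lemma lap_k_int s h tau : 0 < s -> supp0T h ->
  s `^ alpha / Gam * \int[mu]_t (lap_e s t * rlk (t - tau) * h tau) =
  lap_k s tau * h tau.
Proof.
move=> s0 hT; rewrite /lap_k -[RHS]mulrA; congr (_ * _) => /=.
have [h0|h0] := eqVneq (h tau) 0.
  by under eq_Rintegral do rewrite h0 mulr0; rewrite h0 mulr0 /Rintegral integral0.
rewrite RintegralZr//; apply: itg_lap_kernel => //.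
by apply: contraNT h0 => /negP /hT ->.
Qed.

Lemma itg_lap_k s h : 0 < s -> itg mu h -> supp0T h ->
  itg mu (fun tau => lap_k s tau * h tau).
Proof.
move=> s0 ih hT; have := itgZ (s `^ alpha / Gam) (itg2_int2 (itg2_lap s0 ih hT)).
by congr itg; apply/funext => tau; rewrite lap_k_int.
Qed.

Lemma itg_lap_rl s h : 0 < s -> itg mu h -> supp0T h ->
  itg mu (fun t => lap_e s t * rl_int h t).
Proof.
move=> s0 ih hT.
have := itg_mulb (itg_rl_int ih hT) (measurable_lap_e s) (fun t => lap_e_bound t s0).
congr itg; apply/funext => t.
have [tT|tT] := boolP (t \in `]0, T[); last by rewrite /lap_e ind_notin ?mul0r.
by rewrite ind_in// mul1r.
Qed.

(** Fubini's theorem moves the fractional integral from h to the exponential. *)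
Lemma lap_fubini s h : 0 < s -> itg mu h -> supp0T h ->
  \int[mu]_t (lap_e s t * (s `^ alpha / Gam * rl_int h t)) =
  \int[mu]_tau (lap_k s tau * h tau).
Proof.
move=> s0 ih hT.
have i2 := itg2_lap s0 ih hT.
transitivity (s `^ alpha / Gam * \int[mu]_t (lap_e s t * rl_int h t)).
  rewrite -RintegralZl//; last exact: itg_lap_rl.
  by apply: eq_Rintegral => t _; rewrite mulrCA.
rewrite (_ : \int[mu]_t (lap_e s t * rl_int h t) =
   \int[mu]_t \int[mu]_tau (lap_e s t * rlk (t - tau) * h tau)); last first.
  apply: Rint_ae.
  - exact: itg_measurable (itg_lap_rl s0 ih hT).
  - exact: itg_measurable (itg2_int1 i2).
  - apply: ae_imp (ae_itg_rl ih hT) => t it.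
    have [|tT] := boolP (t \in `]0, T[); last first.
      have e0 : lap_e s t = 0 by rewrite /lap_e ind_notin ?mul0r.
      under [RHS]eq_Rintegral do rewrite e0 !mul0r.
      by rewrite e0 mul0r /Rintegral integral0.
    rewrite in_itv/= => /it {}it; rewrite /rl_int -RintegralZl//.
    by apply: eq_Rintegral => tau _; rewrite mulrA.
rewrite (Rfubini i2) -RintegralZl//; last exact: itg2_int2 i2.
by apply: eq_Rintegral => tau _; exact: lap_k_int.
Qed.

Lemma lap_eE s t : 0 < t < T -> lap_e s t = expR (- (s * t)).
Proof. by move=> tT; rewrite /lap_e ind_in ?mul1r// in_itv. Qed.

(** If t ran over the whole line, the integral would give exactly exp(- s tau) by [Rint_rlk_exp].
    What the cut at T removes is an integral over t > T; since the kernel is nonincreasing,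
    replacing t - tau by the smaller t - T increases it to exp(- s T) Gamma(alpha) s^(- alpha). *)
Lemma lap_k_bounds s tau : 0 < s -> 0 < tau < T ->
  expR (- (s * tau)) - expR (- (s * T)) <= lap_k s tau <= expR (- (s * tau)).
Proof.
move=> s0 tauT.
have G0 := Gamma_gt0 alpha_gt0 alpha_lt1.
have sa0 : 0 < s `^ alpha by rewrite powR_gt0.
have iE0 := itg_rlk_exp alpha_gt0 alpha_lt1 s0.
have iEs u : itg mu (fun t => rlk (t - u) * expR (- (s * (t - u)))).
  exact: (itg_shift (- u) iE0).
have IEs u : \int[mu]_t (rlk (t - u) * expR (- (s * (t - u)))) = Gam * s `^ (- alpha).
  by rewrite (Rint_shift (- u) iE0) Rint_rlk_exp.
pose g t := expR (- (s * t)) * rlk (t - tau).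
have gE t : g t = expR (- (s * tau)) * (rlk (t - tau) * expR (- (s * (t - tau)))).
  rewrite /g (_ : - (s * t) = - (s * tau) + - (s * (t - tau))); last by ring.
  by rewrite expRD; ring.
have ig : itg mu g.
  have := itgZ (expR (- (s * tau))) (iEs tau).
  by congr itg; apply/funext => t; rewrite gE.
have Ig : \int[mu]_t g t = expR (- (s * tau)) * (Gam * s `^ (- alpha)).
  under eq_Rintegral do rewrite gE.
  by rewrite RintegralZl ?IEs//; exact: iEs.
have g0 t : 0 <= g t by rewrite mulr_ge0 ?expR_ge0 ?rlk_ge0.
have ie := itg_lap_kernel s0 tauT.
have Ie : \int[mu]_t (lap_e s t * rlk (t - tau)) <= \int[mu]_t g t.
  apply: le_Rintegral => // t _; rewrite ler_wpM2r ?rlk_ge0// /lap_e.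
  by rewrite ler_piMl ?expR_ge0// (le_trans (ler_norm _))// ind_bound.
have E : s `^ alpha / Gam * (Gam * s `^ (- alpha)) = 1.
  by rewrite mulrA divfK ?gt_eqF// powRN mulfV ?gt_eqF.
have sG0 : 0 < s `^ alpha / Gam by rewrite divr_gt0.
apply/andP; split; last first.
  rewrite /lap_k; apply: (@le_trans _ _ (s `^ alpha / Gam * \int[mu]_t g t)).
    by rewrite ler_pM2l.
  by rewrite Ig mulrCA E mulr1.
have ID : \int[mu]_t (g t - lap_e s t * rlk (t - tau)) <=
    expR (- (s * T)) * (Gam * s `^ (- alpha)).
  have ib : itg mu (fun t => expR (- (s * T)) * (rlk (t - T) * expR (- (s * (t - T))))).
    exact: (itgZ _ (iEs T)).
  rewrite -(IEs T) -RintegralZl//; last exact: iEs.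
  apply: Rint_le_ae => //; first exact: itgB.
  (* The point t = T has to be discarded: there the majorant is 0, because [rlk] vanishes at 0,
     while g is positive. *)
  apply: ae_imp (ae_neq T) => t tT.
  have b0 : 0 <= expR (- (s * T)) * (rlk (t - T) * expR (- (s * (t - T)))).
    by apply: mulr_ge0; [exact: expR_ge0|exact: rlk_exp_ge0].
  have [t0|t0] := leP t 0.
    rewrite /g rlk_eq0 ?mulr0 ?subrr//; move: tauT => /andP[tau0 _]; lra.
  have [tlT|Tt] := ltP t T.
    by rewrite lap_eE ?t0 ?tlT// /g subrr.
  have {tT}Tt : T < t by rewrite lt_neqAle eq_sym tT.
  rewrite /lap_e ind_notin ?mul0r ?subr0; last first.
    by rewrite in_itv/= t0/= -leNgt ltW.
  rewrite [leRHS](_ : _ = expR (- (s * t)) * rlk (t - T)); last first.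
    rewrite (_ : - (s * t) = - (s * T) + - (s * (t - T))); last by ring.
    by rewrite expRD; ring.
  rewrite ler_wpM2l ?expR_ge0//; apply: rlk_noninc => //; first by rewrite subr_gt0.
  by rewrite lerD2l lerN2; case/andP: tauT => _ /ltW.
rewrite lerBlDr /lap_k.
have -> : expR (- (s * tau)) = s `^ alpha / Gam * \int[mu]_t g t.
  by rewrite Ig mulrCA E mulr1.
rewrite -lerBlDl -mulrBr -RintegralB//.
apply: le_trans (_ : s `^ alpha / Gam * (expR (- (s * T)) * (Gam * s `^ (- alpha))) <= _).
  by rewrite ler_pM2l.
by rewrite mulrCA E mulr1.
Qed.

End Laplace.

Section LaplaceSource.
Context (R : realType) (alpha T : R).
Hypotheses (alpha_gt0 : 0 < alpha) (alpha_lt1 : alpha < 1) (T_gt0 : 0 < T).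
Local Notation mu := (@lebesgue_measure R).
Local Notation Gam := (Gamma alpha).
Local Notation lap_k := (lap_k alpha T).
Local Notation lap_e := (lap_e T).
Local Notation rl_int := (rl_int alpha).

Lemma expRN_le4 (x : R) : 0 < x -> expR (- x) <= 4 / x ^+ 2.
Proof.
move=> x0; rewrite expRN -[leRHS]invf_div lef_pV2 ?posrE ?expR_gt0//; last first.
  by rewrite divr_gt0// exprn_gt0.
rewrite (_ : x ^+ 2 / 4 = (x / 2) * (x / 2)); last by field.
rewrite [leRHS](_ : _ = expR (x / 2) * expR (x / 2)); last by rewrite -expRD; congr expR; field.
have h : x / 2 <= expR (x / 2) by have := expR_ge1Dx (x / 2); lra.
by apply: ler_pM => //; lra.
Qed.

(** On (0, 1/s) the kernel is at least exp(-1) - exp(-2) and rho at least r0, which contributes a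
    multiple of 1/s. Between 1/s and delta the integrand is nonnegative. Beyond delta the kernel is
    at most exp(- s delta), which is o(1/s). *)
Lemma lap_source_lower (rho : R -> R) (r0 delta : R) :
  itg mu rho -> supp0T T rho -> 0 < r0 -> 0 < delta ->
  {ae mu, forall t, 0 < t < delta -> r0 <= rho t} ->
  exists c0 s0, [/\ 0 < c0, 0 < s0 & forall s, s0 <= s ->
    c0 / s <= \int[mu]_tau (lap_k s tau * rho tau)].
Proof.
move=> irho rhoT r00 delta0 rho_ge.
pose c1 : R := expR (- 1) - expR (- 2).
have c10 : 0 < c1 by rewrite subr_gt0 ltr_expR; lra.
pose N := \int[mu]_t `|rho t|.
have N0 : 0 <= N by apply: Rintegral_ge0.
(* The summands ensure in turn s > 0, 1/s <= delta, s T >= 2, and that the contribution beyond delta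
   is at most half of the main one. *)
pose s0 : R := 1 + delta^-1 + 2 / T + 8 * N / (delta ^+ 2 * r0 * c1).
have d20 : 0 < delta ^+ 2 * r0 * c1 by rewrite !mulr_gt0.
have h1 : 0 < delta^-1 by rewrite invr_gt0.
have h2 : 0 < 2 / T by rewrite divr_gt0.
have h3 : 0 <= 8 * N / (delta ^+ 2 * r0 * c1) by rewrite divr_ge0 ?mulr_ge0// ltW.
have s00 : 0 < s0 by rewrite /s0; lra.
exists (r0 * c1 / 2), s0; split => // [|s ss].
  by rewrite divr_gt0// mulr_gt0.
have s_gt0 : 0 < s by exact: lt_le_trans ss.
have sT2 : 2 <= s * T.
  rewrite -ler_pdivrMr//; apply: le_trans ss; rewrite /s0.
  lra.
have sd : s^-1 <= delta.
  rewrite -[leRHS]invrK lef_pV2 ?posrE ?invr_gt0//; apply: le_trans ss; rewrite /s0.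
  lra.
have sN : expR (- (s * delta)) * N <= r0 * c1 / 2 / s.
  apply: (@le_trans _ _ (4 / (s * delta) ^+ 2 * N)).
    by rewrite ler_wpM2r// expRN_le4// mulr_gt0.
  have : 8 * N / (delta ^+ 2 * r0 * c1) <= s.
    apply: le_trans ss; rewrite /s0.
    lra.
  rewrite ler_pdivrMr// => h.
  rewrite -subr_ge0 (_ : _ - _ = (s * (delta ^+ 2 * r0 * c1) - 8 * N) / (2 * s ^+ 2 * delta ^+ 2)).
    rewrite divr_ge0 ?subr_ge0//.
    by rewrite !mulr_ge0 ?exprn_ge0// ltW.
  by field; rewrite !gt_eqF.
have Nd : itg mu (fun t => expR (- (s * delta)) * `|rho t|).
  exact/itgZ/itg_abs.
have I1 : itg mu (\1_`]0, s^-1[ : R -> R) by exact: itg_ind1.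
have I2 := itgB (itgZ (r0 * c1) I1) Nd.
apply: (@le_trans _ _ (\int[mu]_t (r0 * c1 * \1_`]0, s^-1[ t - expR (- (s * delta)) * `|rho t|))).
  rewrite RintegralB//; last exact: (itgZ _ I1).
  rewrite RintegralZl// RintegralZl//; last exact: itg_abs.
  have -> : \int[mu]_t (\1_`]0, s^-1[ t) = s^-1.
    rewrite /Rintegral integral_indic//= setIT lebesgue_measure_itv/= lte_fin.
    by rewrite invr_gt0 s_gt0 oppr0 adde0.
  rewrite -/N; apply: (@le_trans _ _ (r0 * c1 / s - r0 * c1 / 2 / s)); last first.
    by rewrite lerD2l lerN2.
  by rewrite le_eqVlt; apply/orP; left; apply/eqP; field; exact: lt0r_neq0.
apply: Rint_le_ae => //; first exact: itg_lap_k.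
apply: ae_imp rho_ge => t rho_ge.
have eR0 : 0 <= expR (- (s * delta)) * `|rho t| by rewrite mulr_ge0 ?expR_ge0.
have [/andP[t0 tT]|ntT] := boolP (0 < t < T); last first.
  rewrite rhoT; last exact/negP.
  rewrite normr0 !mulr0 subr0 ind_notin ?mulr0// in_itv/=.
  apply: contra ntT => /andP[-> ts]/=; apply: (lt_le_trans ts).
  rewrite -[leRHS]invrK lef_pV2 ?posrE ?invr_gt0//.
  by rewrite -[leLHS]mul1r ler_pdivrMr//; lra.
have /andP[k1 k2] := lap_k_bounds alpha_gt0 alpha_lt1 s_gt0 (introT andP (conj t0 tT)).
have k0 : 0 <= lap_k s t.
  apply: le_trans k1; rewrite subr_ge0 ler_expR lerN2.
  by rewrite ler_pM2l// ltW.
have [td|td] := ltP t delta; last first.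
  rewrite ind_notin; last first.
    by rewrite in_itv/= t0/= -leNgt (le_trans sd).
  rewrite mulr0 sub0r lerNl.
  apply: (@le_trans _ _ (lap_k s t * `|rho t|)).
    by rewrite -mulrN ler_wpM2l// -normrN ler_norm.
  rewrite ler_wpM2r// (le_trans k2)// ler_expR lerN2.
  by rewrite ler_pM2l.
have rt : r0 <= rho t by apply: rho_ge; rewrite t0.
have kr0 : 0 <= lap_k s t * rho t by rewrite mulr_ge0// (le_trans _ rt)// ltW.
have [ts|ts] := ltP t s^-1; last first.
  rewrite ind_notin; last by rewrite in_itv/= t0/= -leNgt.
  by rewrite mulr0 sub0r (le_trans _ kr0)// oppr_le0.
rewrite ind_in; last by rewrite in_itv/= t0.
rewrite mulr1; apply: (@le_trans _ _ (r0 * c1)); first by rewrite lerBlDr lerDl.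
rewrite mulrC; apply: ler_pM => //; [exact: ltW|exact: ltW|].
apply: le_trans k1; rewrite /c1 lerB// ler_expR lerN2//.
by rewrite -ler_pdivlMl// mulr1 ltW.
Qed.

Lemma lap_e_sub_k s (a : R -> R) : 0 < s -> itg mu a -> supp0T T a ->
  `|\int[mu]_t (lap_e s t * a t) - \int[mu]_t (lap_k s t * a t)| <=
  expR (- (s * T)) * \int[mu]_t `|a t|.
Proof.
move=> s0 ia aT.
have iea : itg mu (fun t => lap_e s t * a t).
  exact: (itg_mulb ia (measurable_lap_e _ s) (fun t => lap_e_bound _ t s0)).
have ika := itg_lap_k alpha_gt0 s0 ia aT.
rewrite -RintegralB// -RintegralZl//; last exact: itg_abs.
apply: Rint_absle; first exact: itg_measurable (itgB iea ika).
  move=> t; rewrite -mulrBl normrM.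
  have [tT|ntT] := boolP (0 < t < T); last first.
    by rewrite aT ?normr0 ?mulr0//; exact/negP.
  rewrite ler_wpM2r// lap_eE//.
  have /andP[k1 k2] := lap_k_bounds alpha_gt0 alpha_lt1 s0 tT.
  rewrite ger0_norm ?subr_ge0//; lra.
exact/itgZ/itg_abs.
Qed.

Lemma lap_k_abs s (b : R -> R) : 0 < s -> itg mu b -> supp0T T b ->
  `|\int[mu]_t (lap_k s t * b t)| <= \int[mu]_t `|b t|.
Proof.
move=> s0 ib bT; apply: Rint_absle.
- exact: itg_measurable (itg_lap_k alpha_gt0 s0 ib bT).
- move=> t; have [tT|ntT] := boolP (0 < t < T); last first.
    by rewrite bT ?normr0 ?mulr0 ?normr0//; exact/negP.
  have /andP[k1 k2] := lap_k_bounds alpha_gt0 alpha_lt1 s0 tT.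
  rewrite normrM ler_piMl// ger0_norm.
    rewrite (le_trans k2)// expR_le1 oppr_le0 mulr_ge0 ?(ltW s0)//.
    by case/andP: tT => /ltW.
  apply: le_trans k1; rewrite subr_ge0 ler_expR lerN2 ler_pM2l//.
  by case/andP: tT => _ /ltW.
- exact: itg_abs.
Qed.

(** The equation is integrated against s^alpha [lap_e], and [lap_fubini] replaces each fractional
    integral by a pairing with [lap_k]. *)
Lemma lap_scalar_identity s (a b rho : R -> R) (c : R) : 0 < s ->
  itg mu a -> itg mu b -> itg mu rho ->
  supp0T T a -> supp0T T b -> supp0T T rho ->
  {ae mu, forall t, 0 < t < T ->
    a t - s `^ alpha / Gam * rl_int a t = (rl_int b t + c * rl_int rho t) / Gam} ->
  s `^ alpha * (\int[mu]_t (lap_e s t * a t) - \int[mu]_t (lap_k s t * a t)) =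
  \int[mu]_t (lap_k s t * b t) + c * \int[mu]_t (lap_k s t * rho t).
Proof.
move=> s0 ia ib ir aT bT rT eqn.
have iea : itg mu (fun t => lap_e s t * a t).
  exact: (itg_mulb ia (measurable_lap_e _ s) (fun t => lap_e_bound _ t s0)).
have ir_ h : itg mu h -> supp0T T h ->
    itg mu (fun t => lap_e s t * (s `^ alpha / Gam * rl_int h t)).
  move=> ih hT; have := itgZ (s `^ alpha / Gam) (itg_lap_rl alpha_gt0 s0 ih hT).
  by congr itg; apply/funext => t; rewrite mulrCA.
rewrite -!(lap_fubini alpha_gt0 s0)//.
rewrite -RintegralB//; last exact: ir_.
rewrite -RintegralZl//; last exact: (itgB iea (ir_ _ ia aT)).
rewrite -[X in _ = _ + X]RintegralZl//; last exact: ir_.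
rewrite -RintegralD//; [|exact: ir_|exact: (itgZ _ (ir_ _ ir rT))].
apply: Rint_ae.
- exact: itg_measurable (itgZ _ (itgB iea (ir_ _ ia aT))).
- exact: itg_measurable (itgD (ir_ _ ib bT) (itgZ _ (ir_ _ ir rT))).
apply: ae_imp eqn => t eqn.
have [tT|tT] := boolP (t \in `]0, T[); last by rewrite /lap_e ind_notin// !mul0r; ring.
rewrite -mulrBr eqn; last by move: tT; rewrite in_itv.
by ring.
Qed.

(** In [lap_scalar_identity] the terms in a differ by at most exp(- s T) times the norm of a, the
    term in b has a kernel bounded by 1, and the factor of c is at least c0 / s. The constants
    depend on rho only, not on s, a, b, c. *)
Lemma lap_source_bound (rho : R -> R) (r0 delta : R) :
  itg mu rho -> supp0T T rho -> 0 < r0 -> 0 < delta ->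
  {ae mu, forall t, 0 < t < delta -> r0 <= rho t} ->
  exists C s0, [/\ 0 <= C, 0 < s0 & forall s a b c, s0 <= s ->
    itg mu a -> itg mu b -> supp0T T a -> supp0T T b ->
    {ae mu, forall t, 0 < t < T ->
      a t - s `^ alpha / Gam * rl_int a t = (rl_int b t + c * rl_int rho t) / Gam} ->
    `|c| <= C * s * (s `^ alpha * expR (- (s * T)) * \int[mu]_t `|a t| +
                     \int[mu]_t `|b t|)].
Proof.
move=> ir rT r00 d0 rge.
have [c0 [s0 [c00 s00 low]]] := lap_source_lower ir rT r00 d0 rge.
exists c0^-1, s0; split => // [|s a b c ss ia ib aT bT eqn].
  by rewrite invr_ge0 ltW.
have s_gt0 : 0 < s by exact: lt_le_trans ss.
have E := lap_scalar_identity s_gt0 ia ib ir aT bT rT eqn.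
have E1 := lap_e_sub_k s_gt0 ia aT.
have E2 := lap_k_abs s_gt0 ib bT.
set I := \int[mu]_t (lap_k s t * rho t) in E.
have lowI : c0 / s <= I by exact: low.
have : `|c| * I <= s `^ alpha * expR (- (s * T)) * \int[mu]_t `|a t| + \int[mu]_t `|b t|.
  have I0 : 0 <= I by apply: le_trans lowI; rewrite divr_ge0 ?ltW.
  rewrite -{1}(ger0_norm I0) -normrM.
  have -> : c * I = s `^ alpha * (\int[mu]_t (lap_e s t * a t) - \int[mu]_t (lap_k s t * a t)) -
      \int[mu]_t (lap_k s t * b t) by rewrite E; ring.
  apply: le_trans (ler_normB _ _) _; apply: lerD => //.
  by rewrite normrM (ger0_norm (powR_ge0 _ _)) -mulrA ler_wpM2l// powR_ge0.
move=> h; rewrite (_ : c0^-1 * s = (c0 / s)^-1); last by rewrite invf_div mulrC.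
rewrite mulrC ler_pdivlMr ?divr_gt0//.
by apply: le_trans h; rewrite ler_wpM2l.
Qed.

End LaplaceSource.

(** * Derivatives, hyperbolic functions and d'Alembert's formula *)

Section PointwiseDerivatives.
Context (R : realType).
Implicit Types (f g : R -> R) (x a b c : R).

Lemma is_derive1_eq f x a b : is_derive x 1 f a -> a = b -> is_derive x 1 f b.
Proof. by move=> ? <-. Qed.

Lemma is_derive1_add f g x a b : is_derive x 1 f a -> is_derive x 1 g b ->
  is_derive x 1 (fun y => f y + g y) (a + b).
Proof. by move=> ? ?; apply: is_deriveD. Qed.

Lemma is_derive1_opp f x a : is_derive x 1 f a -> is_derive x 1 (fun y => - f y) (- a).
Proof. by move=> ?; apply: is_deriveN. Qed.

Lemma is_derive1_sub f g x a b : is_derive x 1 f a -> is_derive x 1 g b ->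
  is_derive x 1 (fun y => f y - g y) (a - b).
Proof. by move=> ? ?; apply: is_derive1_add => //; exact: is_derive1_opp. Qed.

Lemma is_derive1_mul f g x a b : is_derive x 1 f a -> is_derive x 1 g b ->
  is_derive x 1 (fun y => f y * g y) (f x * b + g x * a).
Proof. by move=> ? ?; apply: is_deriveM. Qed.

Lemma is_derive1_scale c f x a : is_derive x 1 f a -> is_derive x 1 (fun y => c * f y) (c * a).
Proof. by move=> ?; apply: is_deriveZ. Qed.

Lemma is_derive1_const c x : is_derive x 1 (fun _ : R => c) 0.
Proof. exact: is_derive_cst. Qed.

Lemma is_derive1_id x : is_derive x 1 (fun y : R => y) 1.
Proof. exact: is_derive_id. Qed.

Lemma is_derive1_exp f x a : is_derive x 1 f a ->
  is_derive x 1 (fun y => expR (f y)) (expR (f x) * a).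
Proof. by move=> ?; apply: is_derive1_comp. Qed.

Lemma is_derive1_sum (I : Type) (s : seq I) (F : I -> R -> R) (d : I -> R) x :
  (forall i, is_derive x 1 (F i) (d i)) ->
  is_derive x 1 (fun y => \sum_(i <- s) F i y) (\sum_(i <- s) d i).
Proof.
move=> dF; elim: s => [|i s ih].
  rewrite big_nil; under eq_fun do rewrite big_nil; exact: is_derive1_const.
rewrite big_cons; under eq_fun do rewrite big_cons; exact: is_derive1_add.
Qed.

Lemma is_derive1_continuous f x a : is_derive x 1 f a -> {for x, continuous f}.
Proof. by case=> /derivable1_diffP/differentiable_continuous. Qed.

End PointwiseDerivatives.

Section Hyperbolic.
Context (R : realType).
Implicit Types (l r s x : R).

Definition chl l r : R := (expR (l * r) + expR (- (l * r))) / 2.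

(* sinh(l r) / l, extended by its limit r at l = 0. *)
Definition shl l r : R :=
  if l == 0 then r else (expR (l * r) - expR (- (l * r))) / (2 * l).

Lemma is_derive_chl l x : is_derive x 1 (chl l) (l ^+ 2 * shl l x).
Proof.
have d1 : is_derive x 1 (fun y => l * y) (l * 1).
  by apply: is_derive1_scale; exact: is_derive1_id.
apply: (is_derive1_eq (is_derive1_mul (is_derive1_add (is_derive1_exp d1)
  (is_derive1_exp (is_derive1_opp d1))) (is_derive1_const _ _))).
rewrite /shl; case: eqVneq => [->|l0]; first by ring.
by field.
Qed.

Lemma is_derive_shl l x : is_derive x 1 (shl l) (chl l x).
Proof.
have d1 : is_derive x 1 (fun y => l * y) (l * 1).
  by apply: is_derive1_scale; exact: is_derive1_id.
rewrite /shl /chl; case: eqVneq => [->|l0].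
  by rewrite !mul0r oppr0 expR0 (_ : (1 + 1) / 2 = 1); [exact: is_derive1_id|field].
apply: (is_derive1_eq (is_derive1_mul (is_derive1_sub (is_derive1_exp d1)
  (is_derive1_exp (is_derive1_opp d1))) (is_derive1_const _ _))).
by field.
Qed.

Lemma continuous_chl l : continuous (chl l).
Proof. by move=> x; exact: is_derive1_continuous (is_derive_chl l x). Qed.

Lemma continuous_shl l : continuous (shl l).
Proof. by move=> x; exact: is_derive1_continuous (is_derive_shl l x). Qed.

Lemma chl0 l : chl l 0 = 1.
Proof. by rewrite /chl mulr0 oppr0 expR0; field. Qed.

Lemma shl0 l : shl l 0 = 0.
Proof. by rewrite /shl mulr0 oppr0 expR0 subrr mul0r; case: ifP. Qed.

Lemma chl_ge0 l r : 0 <= chl l r.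
Proof. by rewrite divr_ge0// addr_ge0// expR_ge0. Qed.

Lemma chl_le l r : 0 <= l -> chl l r <= expR (l * `|r|).
Proof.
move=> l0; have h y : `|y| <= l * `|r| -> expR y <= expR (l * `|r|).
  by move=> hy; rewrite ler_expR (le_trans (ler_norm _)).
have h1 := h (l * r); have h2 := h (- (l * r)).
rewrite normrN normrM (ger0_norm l0) lexx in h2.
rewrite normrM (ger0_norm l0) lexx in h1.
by have := h1 isT; have := h2 isT; rewrite /chl; lra.
Qed.

Lemma shl_sub l s r : shl l (s + r) - shl l (s - r) = 2 * (chl l s * shl l r).
Proof.
rewrite /shl /chl; case: eqVneq => [->|l0].
  by rewrite !mul0r oppr0 expR0; field.
have -> : l * (s + r) = l * s + l * r by ring.
have -> : l * (s - r) = l * s - l * r by ring.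
by rewrite !opprD opprK !expRD; field.
Qed.

Lemma shl_ge0 l r : 0 <= l -> 0 <= r -> 0 <= shl l r.
Proof.
move=> l0 r0; rewrite /shl; case: eqVneq => // ln0.
rewrite divr_ge0 ?mulr_ge0// subr_ge0 ler_expR.
have : 0 <= l * r by rewrite mulr_ge0.
by lra.
Qed.

(* d'Alembert's formula turns a sum of cosh(l s) * (sinh(l r) / l) into a
   mean of the corresponding sum of cosh over (s - r, s + r). *)
Lemma dalembert_bound (I : Type) (js : seq I) (c l : I -> R) s r : 0 <= r ->
  `|\sum_(j <- js) c j * (chl (l j) s * shl (l j) r)| <=
  2^-1 * \int[lebesgue_measure]_(z in `[s - r, s + r])
    `|\sum_(j <- js) c j * chl (l j) z|.
Proof.
move=> r0; set th := fun z => \sum_(j <- js) c j * chl (l j) z.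
pose Th z := \sum_(j <- js) c j * shl (l j) z.
have dTh (z : R) : is_derive z 1 Th (th z).
  by apply: is_derive1_sum => j; apply: is_derive1_scale; exact: is_derive_shl.
have cth : continuous th.
  move=> z; apply: (@is_derive1_continuous _ _ _ (\sum_(j <- js) c j * (l j ^+ 2 * shl (l j) z))).
  by apply: is_derive1_sum => j; apply: is_derive1_scale; exact: is_derive_chl.
have ith : lebesgue_measure.-integrable `[s - r, s + r] (EFin \o th).
  apply: continuous_compact_integrable; first exact: segment_compact.
  exact: continuous_subspaceT.
have -> : \sum_(j <- js) c j * (chl (l j) s * shl (l j) r) =
    2^-1 * \int[lebesgue_measure]_(z in `[s - r, s + r]) th z.
  have sr : s - r <= s + r by lra.
  rewrite /Rintegral (integral_FTC sr (fun z _ => dTh z) (fun z _ => cth z)).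
  rewrite /= /Th -sumrB mulr_sumr; apply: eq_bigr => j _.
  by rewrite -mulrBr shl_sub; field.
rewrite normrM ger0_norm ?invr_ge0// ler_pM2l ?invr_gt0//.
by apply: le_normr_Rintegral => //; exact: measurable_itv.
Qed.

End Hyperbolic.

(** * Halving arguments and Volterra equations on an interval *)

Section Halving.
Context (R : realType).

Lemma exists_halfpow_lt (C e : R) : 0 < e -> exists n : nat, C / 2 ^+ n < e.
Proof.
move=> e0; exists (Num.truncn (C / e)).+1.
rewrite ltr_pdivrMr ?exprn_gt0// mulrC -ltr_pdivrMr//.
apply: lt_le_trans (truncnS_gt _) _.
by rewrite -natrX ler_nat ltnW// ltn_expl.
Qed.

Lemma le_halfpow (C x y : R) : (forall n : nat, x <= y + C / 2 ^+ n) -> x <= y.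
Proof.
move=> h; rewrite leNgt; apply/negP => yx.
have [n hn] := exists_halfpow_lt C (e := x - y) ltac:(by rewrite subr_gt0).
by have := h n; move: hn; lra.
Qed.

(** An iterated form of Gronwall's inequality: the map N -> A + N / 2 attracts every starting value
    to 2 A, so any a priori bound M will do and leaves no trace in the conclusion. *)
Lemma halving (Y : Type) (w d : Y -> R) (M A : R) :
  (forall y, 1 <= w y) -> 0 <= M -> 0 <= A ->
  (forall y, d y <= M * w y) ->
  (forall N, 0 <= N -> (forall y, d y <= N * w y) ->
    forall y, d y <= (A + N / 2) * w y) ->
  forall y, d y <= 2 * A * w y.
Proof.
move=> w1 M0 A0 dM step y.
have H (n : nat) z : d z <= (2 * A + M / 2 ^+ n) * w z.
  elim: n z => [|n ih] z.
    rewrite expr0 divr1; apply: le_trans (dM z) _.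
    by rewrite ler_wpM2r ?(le_trans ler01)//; lra.
  have Mn0 : 0 <= M / 2 ^+ n by rewrite divr_ge0// exprn_ge0.
  have := step (2 * A + M / 2 ^+ n) _ ih z.
  rewrite exprS invfM mulrA mulrAC => h; apply: le_trans (h _) _; first by lra.
  by rewrite ler_wpM2r ?(le_trans ler01)//; lra.
apply: (@le_halfpow (M * w y)) => n.
by rewrite (le_trans (H n y))// mulrDl lerD2l mulrAC.
Qed.

Lemma halving_cvg (u : nat -> R) (M : R) :
  (forall n, `|u n.+1 - u n| <= M / 2 ^+ n) ->
  exists2 l, u @ \oo --> l & forall n, `|l - u n| <= 2 * M / 2 ^+ n.
Proof.
move=> hu.
have M0 : 0 <= M by have := hu 0%N; rewrite expr0 divr1; exact: le_trans.
have H (n k : nat) : `|u (n + k)%N - u n| <= 2 * M / 2 ^+ n - 2 * M / 2 ^+ (n + k).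
  elim: k => [|k ih]; first by rewrite addn0 !subrr normr0.
  rewrite addnS (_ : _ - _ = (u (n + k).+1 - u (n + k)%N) + (u (n + k)%N - u n)); last by ring.
  apply: le_trans (ler_normD _ _) _.
  apply: le_trans (lerD (hu _) ih) _.
  rewrite le_eqVlt; apply/orP; left; apply/eqP.
  rewrite exprS; field.
  by rewrite expf_neq0// expf_neq0.
have H' (n m : nat) : (n <= m)%N -> `|u m - u n| <= 2 * M / 2 ^+ n.
  move=> nm; rewrite -(subnKC nm); apply: le_trans (H _ _) _.
  by rewrite gerBl divr_ge0 ?mulr_ge0// exprn_ge0.
have cu : cvg (u @ \oo).
  apply/cauchy_cvgP/cauchyP => e e0.
  have [n hn] := exists_halfpow_lt (2 * M) e0.
  exists (u n); exists n => // m /= nm.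
  by rewrite /ball/= distrC (le_lt_trans (H' _ _ nm)).
exists (lim (u @ \oo)) => // n.
have ch : (fun m => `|u m - u n|) @ \oo --> `|lim (u @ \oo) - u n|.
  by apply: cvg_norm; apply: cvgB => //; exact: cvg_cst.
rewrite -(cvg_lim _ ch)//; apply: limr_le; first by apply/cvg_ex; eexists; exact: ch.
by exists n => // m /= nm; exact: H'.
Qed.

End Halving.

Section IndicatorIntegrals.
Context (R : realType).
Local Notation mu := (@lebesgue_measure R).
Implicit Types (f g : R -> R) (u v : R).

Lemma Rint_ind (i : interval R) f :
  \int[mu]_x (\1_[set` i] x * f x) = \int[mu]_(x in [set` i]) f x.
Proof.
rewrite [RHS]Rintegral_mkcond; apply: eq_Rintegral => x _.
by rewrite /patch indicE; case: ifPn => _; rewrite ?mul1r ?mul0r.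
Qed.

Lemma itg_ind_itv (i : interval R) f :
  itg mu (fun x => \1_[set` i] x * f x) <-> mu.-integrable [set` i] (EFin \o f).
Proof.
have E : (EFin \o f) \_ [set` i] = EFin \o (fun x => \1_[set` i] x * f x).
  by apply/funext => x; rewrite /patch/= indicE; case: (x \in _); rewrite ?mul1r ?mul0r.
rewrite /itg -E; apply: iff_sym; apply: integrable_mkcond; exact: measurable_itv.
Qed.

Lemma itg_ind_continuous u v f : continuous f ->
  itg mu (fun x => \1_`]u, v[ x * f x).
Proof.
move=> cf; apply/itg_ind_itv.
have icc : mu.-integrable `[u, v] (EFin \o f).
  apply: continuous_compact_integrable; first exact: segment_compact.
  exact: continuous_subspaceT.
apply: integrableS icc; [exact: measurable_itv|exact: measurable_itv|].
exact: subset_itv_oo_cc.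
Qed.

Lemma Rint_oo_cc u v f : mu.-integrable `[u, v] (EFin \o f) ->
  \int[mu]_(x in `]u, v[) f x = \int[mu]_(x in `[u, v]) f x.
Proof.
move=> ifc; rewrite Rintegral_itv_bndo_bndc; last first.
  apply: integrableS ifc => //; exact: subset_itv_oo_cc.
rewrite Rintegral_itv_obnd_cbnd//.
by apply: integrableS ifc => //; apply: subset_itvr; rewrite bnd_simp.
Qed.

Lemma Rint_ind_FTC (F f : R -> R) u v : u <= v ->
  (forall x : R, is_derive x 1 F (f x)) -> continuous f ->
  \int[mu]_x (\1_`]u, v[ x * f x) = F v - F u.
Proof.
move=> uv dF cf; rewrite Rint_ind Rint_oo_cc; last first.
  apply: continuous_compact_integrable; first exact: segment_compact.
  exact: continuous_subspaceT.
by rewrite /Rintegral (integral_FTC uv (fun x _ => dF x) (fun x _ => cf x)).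
Qed.

Lemma Rint_weight_le (k x b : R) : 0 < k -> x <= b ->
  \int[mu]_xi (\1_`]x, b[ xi * expR (k * (b - xi))) <= expR (k * (b - x)) / k.
Proof.
move=> k0 xb.
have d1 (y : R) : is_derive y 1 (fun xi => k * (b - xi)) (k * (0 - 1)).
  exact: (is_derive1_scale k (is_derive1_sub (is_derive1_const b y) (is_derive1_id y))).
have dF (y : R) : is_derive y 1 (fun xi => - (expR (k * (b - xi)) / k)) (expR (k * (b - y))).
  have := is_derive1_opp (is_derive1_mul (is_derive1_exp (d1 y)) (is_derive1_const k^-1 y)).
  by move/is_derive1_eq; apply; field; exact: lt0r_neq0.
have cf : continuous (fun xi => expR (k * (b - xi))).
  by move=> y; exact: is_derive1_continuous (is_derive1_exp (d1 y)).
rewrite (Rint_ind_FTC xb dF cf).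
by rewrite subrr mulr0 expR0 opprK addrC lerBlDr lerDl divr_ge0// ltW.
Qed.

End IndicatorIntegrals.

Section Volterra.
Context (R : realType) (a b : R).
Hypothesis ab : a < b.
Local Notation mu := (@lebesgue_measure R).
Implicit Types (k g p X : R -> R).

Definition bddm g := measurable_fun setT g /\ exists M, forall x, `|g x| <= M.

Lemma bddm_ge0 g : bddm g -> exists2 M, 0 <= M & forall x, `|g x| <= M.
Proof. by move=> [_ [M gM]]; exists M => //; exact: le_trans (gM 0). Qed.

Lemma bddmD g h : bddm g -> bddm h -> bddm (fun x => g x + h x).
Proof.
move=> [mg [M gM]] [mh [N hN]]; split; first exact: measurable_funD.
by exists (M + N) => x; apply: le_trans (ler_normD _ _) _; exact: lerD.
Qed.

Lemma bddmM g h : bddm g -> bddm h -> bddm (fun x => g x * h x).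
Proof.
move=> [mg [M gM]] [mh [N hN]]; split; first exact: measurable_funM.
by exists (M * N) => x; rewrite normrM; exact: ler_pM.
Qed.

Lemma bddm_cst c : bddm (fun _ => c).
Proof. by split; [exact: measurable_cst|exists `|c|]. Qed.

Lemma bddmB g h : bddm g -> bddm h -> bddm (fun x => g x - h x).
Proof.
move=> bg bh; have := bddmD bg (bddmM (bddm_cst (-1)) bh).
by congr bddm; apply/funext => x; rewrite mulN1r.
Qed.

Lemma bddm_ind (i : interval R) : bddm (\1_[set` i] : R -> R).
Proof. by split; [exact: measurable_ind|exists 1 => x; exact: ind_bound]. Qed.

Lemma itg_bddm g f : bddm g -> itg mu f -> itg mu (fun x => g x * f x).
Proof. by move=> [mg [M gM]] fi; exact: (itg_mulb fi mg gM). Qed.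

Lemma itg_ind_bddm (u v : R) g : bddm g -> itg mu (fun x => \1_`]u, v[ x * g x).
Proof.
move=> bg; have := itg_bddm bg (itg_ind1 false true u v).
by congr itg; apply/funext => x; rewrite mulrC.
Qed.

(* Kernels only matter on (0, b - a). *)
Definition vkernel k := measurable_fun setT k /\
  exists K, forall r, 0 < r < b - a -> `|k r| <= K.

Lemma kernel_bound_ge0 k K : (forall r, 0 < r < b - a -> `|k r| <= K) -> 0 <= K.
Proof.
move=> kK; apply: le_trans (kK ((b - a) / 2) _) => //.
by apply/andP; split; move: ab; lra.
Qed.

Lemma vkernel_continuous k : continuous k -> vkernel k.
Proof.
move=> ck; split; first exact: continuous_measurable_fun.
have cc : {within `[0, b - a], continuous (fun r => `|k r|)}.
  by apply: continuous_subspaceT => r; apply: cvg_norm; exact: ck.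
have ab0 : 0 <= b - a by rewrite subr_ge0 ltW.
have [c _ cM] := EVT_max ab0 cc.
exists `|k c| => r /andP[r0 rb]; apply: cM.
by rewrite in_itv/= !ltW.
Qed.

(** The integrand of the Volterra operator sending g to the integral over (x, b) of k(xi - x) g(xi),
    and to 0 outside (a, b). Indicators replace the variable bounds so that Fubini applies on the
    whole plane. For k(r) = r the operator [volt] solves X'' = g with X(b) = X'(b) = 0. *)
Definition volt2 k g (z : R * R) : R :=
  \1_`]a, b[ z.1 * (\1_`]0, b - a[ (z.2 - z.1) * k (z.2 - z.1)) *
  (\1_`]a, b[ z.2 * g z.2).

Definition volt k g x : R := \int[mu]_xi volt2 k g (x, xi).

Lemma itg2_volt k g : vkernel k -> itg mu (fun x => \1_`]a, b[ x * g x) ->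
  itg (mu \x mu)%E (volt2 k g).
Proof.
move=> [mk [K kK]] ig.
have K0 := kernel_bound_ge0 kK.
have := itg2_tensor (itg_ind1 false true a b) ig.
pose kk r := \1_`]0, b - a[ r * k r.
have mkk : measurable_fun setT kk by apply: measurable_funM => //; exact: measurable_ind.
have kkK r : `|kk r| <= K.
  rewrite /kk; have [r0|r0] := boolP (r \in `]0, b - a[); last first.
    by rewrite ind_notin// mul0r normr0.
  by rewrite ind_in// mul1r; apply: kK; move: r0; rewrite in_itv.
have mh : measurable_fun setT (fun z : measurableTypeR R * measurableTypeR R => kk (z.2 - z.1)).
  by apply: (measurableT_comp mkk); exact: measurable_funB.
move=> /itg_mulb /(_ mh (fun z => kkK _)).
by congr itg; apply/funext => z; rewrite /volt2 /kk; ring.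
Qed.

Lemma volt_out k g x : x \notin `]a, b[ -> volt k g x = 0.
Proof.
move=> xI; rewrite /volt /volt2; under eq_Rintegral do rewrite /= ind_notin// !mul0r.
by rewrite /Rintegral integral0.
Qed.

Lemma volt_in k g x : x \in `]a, b[ ->
  volt k g x = \int[mu]_xi (\1_`]x, b[ xi * (k (xi - x) * g xi)).
Proof.
move=> xI; apply: eq_Rintegral => xi _; rewrite /volt2/= (ind_in xI) mul1r.
move: xI; rewrite in_itv/= => /andP[ax xb].
have [xxi|xxi] := boolP (xi \in `]x, b[).
  move: (xxi); rewrite in_itv/= => /andP[h1 h2].
  rewrite (@ind_in _ `]0, b - a[) ?(@ind_in _ `]a, b[ xi) ?(ind_in xxi) ?in_itv/=.
  - by ring.
  - by rewrite h2 (lt_trans ax h1).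
  - by apply/andP; split; lra.
rewrite [in RHS]ind_notin// mul0r.
have [h1|h1] := leP xi x.
  by rewrite (@ind_notin _ `]0, b - a[) ?mul0r// in_itv/= negb_and -leNgt subr_le0 h1.
rewrite (@ind_notin _ `]a, b[ xi) ?mul0r ?mulr0//.
by move: xxi; rewrite !in_itv/= h1/= => /negbTE ->; rewrite andbF.
Qed.

Lemma bddm_itg g : bddm g -> itg mu (fun x => \1_`]a, b[ x * g x).
Proof. exact: itg_ind_bddm. Qed.

Lemma measurable_volt k g : vkernel k -> bddm g -> measurable_fun setT (volt k g).
Proof.
move=> vk bg; have := itg2_int1 (itg2_volt vk (bddm_itg bg)).
exact: itg_measurable.
Qed.

Lemma itg_volt_in k g x : vkernel k -> bddm g -> x \in `]a, b[ ->
  itg mu (fun xi => \1_`]x, b[ xi * (k (xi - x) * g xi)).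
Proof.
move=> [mk [K kK]] bg xI; have [G G0 gG] := bddm_ge0 bg.
apply: (itg_le _ _ (itgZ (K * G) (itg_ind1 false true x b))).
  apply: measurable_funM; first exact: measurable_ind.
  apply: measurable_funM; last by case: bg.
  by apply: (measurableT_comp mk); exact: measurable_funB.
move=> xi; have [xxi|xxi] := boolP (xi \in `]x, b[); last first.
  by rewrite !ind_notin// mul0r normr0 mulr0.
rewrite !ind_in// mul1r mulr1 normrM; apply: ler_pM => //; apply: kK.
by move: xI xxi; rewrite !in_itv/= => /andP[? ?] /andP[? ?]; apply/andP; split; lra.
Qed.

Lemma volt_le k g (m : R -> R) K x : vkernel k -> bddm g ->
  (forall r, 0 < r < b - a -> `|k r| <= K) -> x \in `]a, b[ ->
  itg mu (fun xi => \1_`]x, b[ xi * m xi) ->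
  (forall xi, x < xi < b -> `|g xi| <= m xi) ->
  `|volt k g x| <= K * \int[mu]_xi (\1_`]x, b[ xi * m xi).
Proof.
move=> vk bg kK xI im gm; rewrite volt_in// -RintegralZl//.
apply: Rint_absle; first exact: itg_measurable (itg_volt_in vk bg xI).
  move=> xi; have [xxi|xxi] := boolP (xi \in `]x, b[); last first.
    by rewrite !ind_notin// !mul0r normr0 mulr0.
  rewrite !ind_in// !mul1r normrM; apply: ler_pM => //; last first.
    by apply: gm; move: xxi; rewrite in_itv.
  by apply: kK; move: xI xxi; rewrite !in_itv/=; lra.
exact: itgZ.
Qed.

Lemma voltB k g h x : vkernel k -> bddm g -> bddm h ->
  volt k g x - volt k h x = volt k (fun xi => g xi - h xi) x.
Proof.
move=> vk bg bh; have [xI|xI] := boolP (x \in `]a, b[); last first.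
  by rewrite !volt_out// subrr.
rewrite !volt_in// -RintegralB//; [|exact: itg_volt_in|exact: itg_volt_in].
by apply: eq_Rintegral => xi _; ring.
Qed.

Lemma bddm_volt k g : vkernel k -> bddm g -> bddm (volt k g).
Proof.
move=> vk bg; split; first exact: measurable_volt.
have [_ [K kK]] := vk; have [G G0 gG] := bddm_ge0 bg.
have K0 := kernel_bound_ge0 kK.
exists (K * (G * (b - a))) => x; have [xI|xI] := boolP (x \in `]a, b[); last first.
  by rewrite volt_out// normr0 !mulr_ge0// subr_ge0 ltW.
have ic : itg mu (fun xi => \1_`]x, b[ xi * G) by exact: itg_ind_bddm (bddm_cst G).
apply: le_trans (volt_le vk bg kK xI ic (fun xi _ => gG xi)) _.
rewrite ler_wpM2l// Rint_ind Rintegral_cst//.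
move: xI; rewrite in_itv/= => /andP[ax xb].
rewrite ler_wpM2l//= lebesgue_measure_itv/= lte_fin xb /=; lra.
Qed.

Section Existence.
Variables (k p chi : R -> R).
Hypotheses (vk : vkernel k) (bp : bddm p) (bchi : bddm chi).

Let T X := volt k (fun x => p x * X x + chi x).
Let u n := iter n T (fun _ => 0).

Let bddm_u n : bddm (u n).
Proof.
elim: n => [|n ih]; first exact: bddm_cst.
by apply: bddm_volt => //; apply: bddmD => //; exact: bddmM.
Qed.

(** Picard iteration from 0. In the norm weighted by exp(kap (b - x)) the map T contracts by 1/2,
    because integrating the weight over (x, b) gains a factor 1 / kap. *)
Lemma volt_exists : exists2 X, bddm X &
  forall x, X x = volt k (fun x => p x * X x + chi x) x.
Proof.
have [_ [K kK]] := vk; have [P P0 pP] := bddm_ge0 bp.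
have K0 := kernel_bound_ge0 kK.
have [M M0 uM] := bddm_ge0 (bddm_u 1).
(* Chosen so that K P / kap <= 1/2; the summand 1 keeps kap positive when K P = 0. *)
pose kap := 2 * (K * P) + 1.
have KP0 : 0 <= K * P by exact: mulr_ge0.
have kap0 : 0 < kap by rewrite /kap; lra.
pose w x := expR (kap * (b - x)).
have w0 x : 0 <= w x by exact: expR_ge0.
pose W x := \1_`]a, b[ x * w x.
have W0 x : 0 <= W x by rewrite mulr_ge0.
have cw : continuous w.
  move=> y; apply: is_derive1_continuous (is_derive1_exp (is_derive1_scale kap
    (is_derive1_sub (is_derive1_const b y) (is_derive1_id y)))).
have step X Y N : bddm X -> bddm Y -> 0 <= N -> (forall x, `|X x - Y x| <= N * W x) ->
    forall x, `|T X x - T Y x| <= N / 2 * W x.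
  move=> bX bY N0 XY x; have [xI|xI] := boolP (x \in `]a, b[); last first.
    rewrite /T !volt_out// subrr normr0 mulr_ge0// divr_ge0//.
  rewrite /T voltB//; [|by apply: bddmD => //; exact: bddmM..].
  have bXY : bddm (fun x => p x * (X x - Y x)) by apply: bddmM => //; exact: bddmB.
  rewrite [X in volt k X](_ : _ = fun x => p x * (X x - Y x)); last first.
    by apply/funext => xi; ring.
  have im : itg mu (fun xi => \1_`]x, b[ xi * (P * N * w xi)).
    apply: itg_ind_continuous => y.
    by apply: (@continuousM _ R^o (fun=> P * N) w y); [exact: cst_continuous|exact: cw].
  have XYm xi : x < xi < b -> `|p xi * (X xi - Y xi)| <= P * N * w xi.
    move=> /andP[xxi xib]; rewrite normrM -mulrA; apply: ler_pM => //.
    apply: le_trans (XY xi) _; rewrite ler_wpM2l// /W ind_in ?mul1r//.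
    by move: xI; rewrite !in_itv/= => /andP[? ?]; apply/andP; split; lra.
  apply: le_trans (volt_le vk bXY kK xI im XYm) _.
  rewrite (_ : \int[mu]_xi _ = P * N * \int[mu]_xi (\1_`]x, b[ xi * w xi)); last first.
    rewrite -RintegralZl//; last exact: itg_ind_continuous.
    by apply: eq_Rintegral => xi _; ring.
  have xb : x <= b by move: xI; rewrite in_itv/= => /andP[_ /ltW].
  apply: (@le_trans _ _ (K * (P * N * (w x / kap)))).
    rewrite ler_wpM2l// ler_wpM2l ?mulr_ge0//; exact: Rint_weight_le.
  rewrite /W ind_in// mul1r.
  rewrite (_ : K * _ = N * w x * (K * P / kap)); last by ring.
  rewrite (_ : N / 2 * w x = N * w x * 2^-1); last by ring.
  rewrite ler_wpM2l ?mulr_ge0// ler_pdivrMr// /kap; lra.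
have du n x : `|u n.+1 x - u n x| <= M * W x / 2 ^+ n.
  elim: n x => [|n ih] x.
    rewrite expr0 divr1 subr0; have [xI|xI] := boolP (x \in `]a, b[); last first.
      by rewrite /u/= /T volt_out// normr0 mulr_ge0.
    apply: le_trans (uM x) _; rewrite ler_peMr// /W ind_in// mul1r.
    rewrite -expR0 ler_expR mulr_ge0 ?(ltW kap0)// subr_ge0.
    by move: xI; rewrite in_itv/= => /andP[_ /ltW].
  have := step (u n.+1) (u n) (M / 2 ^+ n) (bddm_u _) (bddm_u _).
  move=> /(_ _ _ x) h; apply: le_trans (h _ _) _.
  - by rewrite divr_ge0// exprn_ge0.
  - by move=> z; rewrite mulrAC.
  - by rewrite exprS le_eqVlt; apply/orP; left; apply/eqP; field; rewrite expf_neq0.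
have /choice[X XP] : forall x, exists l, (fun n => u n x) @ \oo --> l /\
    forall n, `|l - u n x| <= 2 * (M * W x) / 2 ^+ n.
  move=> x; have [l ? ?] := halving_cvg (fun n => du n x); by exists l.
have bX : bddm X.
  split.
    apply: (@measurable_fun_cvg _ _ _ _ u) => [n|x _]; first by case: (bddm_u n).
    by case: (XP x).
  exists (2 * M * expR (kap * (b - a))) => x.
  have [_ /(_ 0%N)] := XP x; rewrite subr0 expr0 divr1 mulrA => h.
  apply: le_trans h _; rewrite ler_wpM2l ?mulr_ge0// /W.
  have [xI|xI] := boolP (x \in `]a, b[); last first.
    by rewrite ind_notin// mul0r expR_ge0.
  rewrite ind_in// mul1r ler_expR ler_pM2l// lerD2l lerN2.
  by move: xI; rewrite in_itv/= => /andP[/ltW].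
exists X => // x; apply/eqP; rewrite -subr_eq0 -normr_le0.
apply: (@le_halfpow _ (2 * (M * W x))) => n; rewrite add0r.
have XuN : forall x, `|X x - u n x| <= 2 * M / 2 ^+ n * W x.
  by move=> z; have [_ /(_ n)] := XP z; congr (_ <= _); ring.
have N0 : 0 <= 2 * M / 2 ^+ n by rewrite divr_ge0 ?mulr_ge0// exprn_ge0.
have h1 := step X (u n) _ bX (bddm_u n) N0 XuN x.
have [_ /(_ n.+1) h2] := XP x.
(* Both differences tend to 0 geometrically: the first by the choice of the limit, the second by the
   contraction. *)
rewrite (_ : X x - _ = (X x - u n.+1 x) - (T X x - T (u n) x)); last first.
  change (X x - T X x = X x - T (u n) x - (T X x - T (u n) x)).
  by ring.
apply: le_trans (ler_normB _ _) _; apply: le_trans (lerD h2 h1) _.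
rewrite exprS le_eqVlt; apply/orP; left; apply/eqP; field.
by rewrite expf_neq0.
Qed.

End Existence.
End Volterra.

(** * The equation X'' = l^2 X + g and the d'Alembert estimate *)

Section WaveEstimate.
Context (R : realType) (a b : R).
Hypothesis ab : a < b.
Local Notation mu := (@lebesgue_measure R).
Local Notation volt := (volt a b).
Local Notation vkernel := (vkernel a b).

Lemma vkernel_shl l : vkernel (shl l).
Proof. by apply: vkernel_continuous => //; exact: continuous_shl. Qed.

Lemma vkernel_id : vkernel (fun r => r).
Proof. by apply: vkernel_continuous => // r; exact: cvg_id. Qed.

Lemma Rint_shl l (x y : R) : x <= y ->
  \int[mu]_z (\1_`]x, y[ z * ((z - x) * (l ^+ 2 * shl l (y - z)))) =
  shl l (y - x) - (y - x).
Proof.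
move=> xy.
have dyz (z : R) : is_derive z 1 (fun z => y - z) (0 - 1).
  exact: (is_derive1_sub (is_derive1_const y z) (is_derive1_id z)).
have dzx (z : R) : is_derive z 1 (fun z => z - x) (1 - 0).
  exact: (is_derive1_sub (is_derive1_id z) (is_derive1_const x z)).
have ds (z : R) : is_derive z 1 (fun z => shl l (y - z)) (chl l (y - z) * (0 - 1)).
  exact: (@is_derive1_comp R (shl l) (fun z => y - z) z _ _ (is_derive_shl l _) (dyz z)).
have dc (z : R) : is_derive z 1 (fun z => chl l (y - z)) (l ^+ 2 * shl l (y - z) * (0 - 1)).
  exact: (@is_derive1_comp R (chl l) (fun z => y - z) z _ _ (is_derive_chl l _) (dyz z)).
have dF (z : R) : is_derive z 1
    (fun z => - ((z - x) * chl l (y - z)) - shl l (y - z))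
    ((z - x) * (l ^+ 2 * shl l (y - z))).
  have := is_derive1_sub (is_derive1_opp (is_derive1_mul (dzx z) (dc z))) (ds z).
  by move/is_derive1_eq; apply; ring.
rewrite (Rint_ind_FTC xy dF).
  by rewrite !subrr shl0 chl0; ring.
move=> z; exact: is_derive1_continuous (is_derive1_mul (dzx z) (is_derive1_scale (l ^+ 2) (ds z))).
Qed.

(** With the kernel sinh(l r) / l the operator [volt] solves X'' = l^2 X + g with zero Cauchy data
    at b. In integral form this is the resolvent identity for the kernel r, obtained by Fubini from
    [Rint_shl]. *)
Lemma volt_shl l g x : bddm g ->
  volt (shl l) g x = volt (fun r => r) (fun z => l ^+ 2 * volt (shl l) g z + g z) x.
Proof.
move=> bg; have vs := vkernel_shl l; have vi := vkernel_id.
have [xI|xI] := boolP (x \in `]a, b[); last by rewrite !volt_out.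
have bX := bddm_volt ab vs bg.
have [ax xb] : a < x /\ x < b by apply/andP; move: xI; rewrite in_itv.
pose h (z : R) := \1_`]x, b[ z * ((z - x) * l ^+ 2).
have mh : measurable_fun setT h.
  apply: measurable_funM; first exact: measurable_ind.
  by apply: measurable_funM => //; exact: measurable_funB.
have hM z : `|h z| <= (b - x) * l ^+ 2.
  rewrite /h; have [zI|zI] := boolP (z \in `]x, b[); last first.
    by rewrite ind_notin// mul0r normr0 mulr_ge0 ?sqr_ge0// subr_ge0 ltW.
  rewrite ind_in// mul1r normrM (ger0_norm (sqr_ge0 _)) ler_wpM2r ?sqr_ge0//.
  by move: zI; rewrite in_itv/= => /andP[xz zb]; rewrite ger0_norm; lra.
have iF : itg (mu \x mu)%E (fun z => h z.1 * volt2 a b (shl l) g z).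
  have i2 := itg2_volt ab vs (bddm_itg a b bg).
  have mh1 : measurable_fun setT (fun z : measurableTypeR R * measurableTypeR R => h z.1).
    exact: measurableT_comp mh measurable_fst.
  exact: (itg_mulb i2 mh1 (fun z => hM z.1)).
have E1 : \int[mu]_z (\1_`]x, b[ z * ((z - x) * (l ^+ 2 * volt (shl l) g z))) =
    \int[mu]_z \int[mu]_xi (h z * volt2 a b (shl l) g (z, xi)).
  apply: Rint_ae.
  - apply: measurable_funM; first exact: measurable_ind.
    apply: measurable_funM; first exact: measurable_funB.
    by apply: measurable_funM => //; case: bX.
  - exact: itg_measurable (itg2_int1 iF).
  - apply: ae_imp (itg2_ae1 (itg2_volt ab vs (bddm_itg a b bg))) => z iz.
    by rewrite RintegralZl// /h /volt -!mulrA.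
have E2 xi : \int[mu]_z (h z * volt2 a b (shl l) g (z, xi)) =
    \1_`]x, b[ xi * ((shl l (xi - x) - (xi - x)) * g xi).
  have [xiI|xiI] := boolP (xi \in `]x, b[); last first.
    rewrite ind_notin// mul0r.
    rewrite (_ : (fun z => _) = fun=> 0); first by rewrite /Rintegral integral0.
    apply/funext => z; rewrite /h /volt2/=.
    have [zI|zI] := boolP (z \in `]x, b[); last by rewrite ind_notin// !mul0r.
    have [xixb|xixb] := boolP (xi \in `]a, b[); last first.
      by rewrite (ind_notin xixb) !mul0r !mulr0.
    rewrite (@ind_notin _ `]0, b - a[) ?(mul0r, mulr0)// in_itv/= negb_and -leNgt subr_le0.
    move: xiI zI xixb; rewrite !in_itv/= negb_and -!leNgt => xiI /andP[xz zb] /andP[axi xib].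
    by case/orP: xiI => h'; apply/orP; left; lra.
  move: (xiI); rewrite in_itv/= => /andP[xxi xib].
  rewrite ind_in// mul1r -(Rint_shl l (ltW xxi)) -RintegralZr//; last first.
    apply: itg_ind_continuous => z.
    have dyz : is_derive z 1 (fun z => xi - z) (0 - 1).
      exact: (is_derive1_sub (is_derive1_const xi z) (is_derive1_id z)).
    have ds := @is_derive1_comp R (shl l) (fun z => xi - z) z _ _ (is_derive_shl l _) dyz.
    exact: (is_derive1_continuous (is_derive1_mul (is_derive1_sub (is_derive1_id z)
      (is_derive1_const x z)) (is_derive1_scale (l ^+ 2) ds))).
  apply: eq_Rintegral => z _; rewrite /h /volt2/=.
  rewrite (@ind_in _ `]a, b[ xi); last by rewrite in_itv/= xib (lt_trans ax xxi).
  have [zI|zI] := boolP (z \in `]x, xi[); last first.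
    rewrite (ind_notin zI) !mul0r.
    have [zxb|zxb] := boolP (z \in `]x, b[); last by rewrite (ind_notin zxb) !mul0r.
    rewrite (@ind_notin _ `]0, b - a[) ?(mul0r, mulr0)// in_itv/= negb_and -leNgt subr_le0.
    move: zI zxb; rewrite !in_itv/= => zI /andP[xz _].
    by move: zI; rewrite xz/= -leNgt => ->.
  move: (zI); rewrite in_itv/= => /andP[xz zxi].
  rewrite !ind_in ?in_itv/=.
  - by ring.
  - by apply/andP; split; lra.
  - by apply/andP; split; lra.
  - by apply/andP; split; lra.
  - by apply/andP; split; lra.
have bg' : bddm (fun z => l ^+ 2 * volt (shl l) g z) by exact: bddmM (bddm_cst _) bX.
have E3 : volt (fun r => r) (fun z => l ^+ 2 * volt (shl l) g z) x =
    volt (shl l) g x - volt (fun r => r) g x.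
  rewrite volt_in// E1 (Rfubini iF).
  under eq_Rintegral do rewrite E2.
  rewrite !volt_in// -RintegralB//;
    [|exact: (itg_volt_in vs bg xI)|exact: (itg_volt_in vi bg xI)].
  by apply: eq_Rintegral => xi _; ring.
apply/eqP; rewrite -subr_eq0; apply/eqP.
transitivity (volt (fun r => r) (fun z => l ^+ 2 * volt (shl l) g z) x -
   (volt (fun r => r) (fun z => l ^+ 2 * volt (shl l) g z + g z) x - volt (fun r => r) g x)).
  by rewrite E3; ring.
rewrite voltB//; last exact: bddmD.
have -> : (fun xi => l ^+ 2 * volt (shl l) g xi + g xi - g xi) =
    fun xi => l ^+ 2 * volt (shl l) g xi by apply/funext => z; ring.
by rewrite subrr.
Qed.

Lemma Rint_norm_le (f : R -> R) (u v B : R) : u <= v -> continuous f ->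
  (forall z, u <= z <= v -> `|f z| <= B) ->
  \int[mu]_(z in `[u, v]) `|f z| <= B * (v - u).
Proof.
move=> uv cf fB.
have cn : continuous (fun z => `|f z|) by move=> z; apply: cvg_norm; exact: cf.
have ifn : mu.-integrable `[u, v] (EFin \o (fun z => `|f z|)).
  by apply: continuous_compact_integrable; [exact: segment_compact|exact: continuous_subspaceT].
have icst : mu.-integrable `[u, v] (EFin \o (fun _ => B)).
  apply: continuous_compact_integrable; first exact: segment_compact.
  by apply: continuous_subspaceT => z; exact: cvg_cst.
have h : \int[mu]_(z in `[u, v]) `|f z| <= \int[mu]_(z in `[u, v]) B.
  by apply: le_Rintegral.
apply: le_trans h _; rewrite Rintegral_cst//= lebesgue_measure_itv/= lte_fin.
case: ifPn => //; rewrite -leNgt => vu /=.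
by rewrite (_ : v = u) ?subrr ?mulr0//; lra.
Qed.

Lemma Rint_norm_sub (f : R -> R) (u v u' v' : R) : u' <= u -> v <= v' ->
  continuous f ->
  \int[mu]_(z in `[u, v]) `|f z| <= \int[mu]_(z in `[u', v']) `|f z|.
Proof.
move=> uu vv cf.
have cn : continuous (fun z => `|f z|) by move=> z; apply: cvg_norm; exact: cf.
have ifn x y : mu.-integrable `[x, y] (EFin \o (fun z => `|f z|)).
  by apply: continuous_compact_integrable; [exact: segment_compact|exact: continuous_subspaceT].
rewrite -!Rint_ind; apply: le_Rintegral => //; [exact/itg_ind_itv|exact/itg_ind_itv|].
move=> z _; have [zI|zI] := boolP (z \in `[u, v]); last first.
  by rewrite (ind_notin zI) mul0r mulr_ge0// indicE.
rewrite !ind_in//; move: zI; rewrite !in_itv/= => /andP[uz zv].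
by rewrite (le_trans uu uz) (le_trans zv vv).
Qed.

(** The sum D(x, s) of the c_j cosh(l_j s) X_j(x) satisfies a wave-type integral equation: by
    [dalembert_bound], its value at (x, s) is controlled by means of D(xi, .) over (s - r, s + r), r
    = xi - x, and by the sum of the c_j cosh(l_j z). Gronwall's inequality then bounds D by the L^1
    norm of the latter, with a constant independent of the c_j and l_j; the conclusion is the case s
    = 0. *)
Lemma dalembert_est (I : Type) (js : seq I) (c l : I -> R) (X : I -> R -> R)
    (p chi : R -> R) (P Q : R) :
  (forall j, 0 <= l j) -> (forall j, bddm (X j)) -> bddm p -> bddm chi ->
  (forall x, `|p x| <= P) -> (forall x, `|chi x| <= Q) ->
  (forall j x, X j x = volt (shl (l j)) (fun z => p z * X j z + chi z) x) ->
  forall x, x \in `]a, b[ ->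
  `|\sum_(j <- js) c j * X j x| <=
  (b - a) * Q * expR ((2 * (P * (b - a)) + 1) * (b - a)) *
  \int[mu]_(z in `[- (b - a), b - a]) `|\sum_(j <- js) c j * chl (l j) z|.
Proof.
move=> l0 bX bp bchi pP cQ XE.
have P0 : 0 <= P by exact: le_trans (pP 0).
have Q0 : 0 <= Q by exact: le_trans (cQ 0).
have L0 : 0 < b - a by rewrite subr_gt0.
set L := b - a in L0 *.
pose kap := 2 * (P * L) + 1.
have PL0 : 0 <= P * L by rewrite mulr_ge0// ltW.
have kap0 : 0 < kap by rewrite /kap; lra.
pose th z := \sum_(j <- js) c j * chl (l j) z.
have cth : continuous th.
  move=> z; apply: (@is_derive1_continuous _ _ _ (\sum_(j <- js) c j * (l j ^+ 2 * shl (l j) z))).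
  by apply: is_derive1_sum => j; apply: is_derive1_scale; exact: is_derive_chl.
rewrite -/(th _).
pose A0 := \int[mu]_(z in `[- L, L]) `|th z|.
have A00 : 0 <= A0 by apply: Rintegral_ge0.
pose D (z : R * R) := \sum_(j <- js) c j * chl (l j) z.2 * X j z.1.
(* The cone |s| <= x - a contains the points (x, 0) and is stable under the domain of dependence of
   the integral equation. *)
pose Y := {z : R * R | (z.1 \in `]a, b[) && (`|z.2| <= z.1 - a)}.
pose w (x : R) := expR (kap * (b - x)).
have cw : continuous w.
  move=> y; exact: is_derive1_continuous (is_derive1_exp (is_derive1_scale kap
    (is_derive1_sub (is_derive1_const b y) (is_derive1_id y)))).
have w_gt0 x : 0 < w x by exact: expR_gt0.
(* An a priori bound that depends on the coefficients and frequencies; only its finiteness matters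
   for [halving]. *)
have HM (js' : seq I) : exists2 M, 0 <= M & forall z : Y,
    `|\sum_(j <- js') c j * chl (l j) (sval z).2 * X j (sval z).1| <= M.
  elim: js' => [|j s [M M0 ih]].
    by exists 0 => // z; rewrite big_nil normr0.
  have [N N0 hN] := bddm_ge0 (bX j).
  exists (`|c j| * expR (l j * L) * N + M).
    by rewrite addr_ge0// !mulr_ge0// expR_ge0.
  move=> z; rewrite big_cons; apply: le_trans (ler_normD _ _) _.
  apply: lerD => //; rewrite normrM (normrM (c j)); apply: ler_pM => //.
  rewrite ler_wpM2l// ger0_norm ?chl_ge0//; apply: le_trans (chl_le _ (l0 j)) _.
  rewrite ler_expR ler_wpM2l//; case: z => -[x s'] /= /andP[].
  by rewrite in_itv/= /L => /andP[ax xb]; lra.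
have [M M0 DM] := HM js.
have main : forall z : Y, `|D (sval z)| <= 2 * (L * Q * A0 / 2) * w (sval z).1.
  apply: (halving (M := M)) => //.
  - move=> [[x s] /= /andP[]]; rewrite in_itv/= => /andP[ax xb] _.
    rewrite -expR0 ler_expR mulr_ge0 ?(ltW kap0)//; lra.
  - by rewrite divr_ge0// !mulr_ge0// ltW.
  - move=> z; apply: le_trans (DM z) _; rewrite ler_peMr//.
    case: z => -[x s] /= /andP[]; rewrite in_itv/= => /andP[ax xb] _.
    rewrite -expR0 ler_expR mulr_ge0 ?(ltW kap0)//; lra.
  move=> N N0 DN [[x s] xs] /=; case/andP: (xs) => /= xI sx.
  have [ax xb] : a < x /\ x < b by apply/andP; move: xI; rewrite in_itv.
  have ig j : itg mu (fun xi => c j * chl (l j) s *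
      (\1_`]x, b[ xi * (shl (l j) (xi - x) * (p xi * X j xi + chi xi)))).
    apply: itgZ; apply: (itg_volt_in (vkernel_shl _) _ xI).
    by apply: bddmD => //; exact: bddmM.
  have DE : D (x, s) = \int[mu]_xi \sum_(j <- js) (c j * chl (l j) s *
      (\1_`]x, b[ xi * (shl (l j) (xi - x) * (p xi * X j xi + chi xi)))).
    rewrite Rint_sum//; apply: eq_bigr => j _.
    rewrite RintegralZl//.
      by congr (_ * _); rewrite (XE j x) volt_in.
    apply: (itg_volt_in (vkernel_shl _) _ xI).
    by apply: bddmD => //; exact: bddmM.
  have im : itg mu (fun xi => \1_`]x, b[ xi * (P * L * N * w xi + Q * A0 / 2)).
    apply: itg_ind_continuous => y; apply: cvgD; last exact: cvg_cst.
    by apply: cvgM; [exact: cvg_cst|exact: cw].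
  apply: (@le_trans _ _ (\int[mu]_xi (\1_`]x, b[ xi * (P * L * N * w xi + Q * A0 / 2)))).
    rewrite DE; apply: Rint_absle => //; first exact: itg_measurable (itg_sum _ ig).
    move=> xi; have [xiI|xiI] := boolP (xi \in `]x, b[); last first.
      rewrite big1 ?normr0; first by rewrite ind_notin// mul0r.
      by move=> j _; rewrite ind_notin// mul0r mulr0.
    have [xxi xib] : x < xi /\ xi < b by apply/andP; move: xiI; rewrite in_itv.
    rewrite (ind_in xiI) mul1r.
    have r0 : 0 <= xi - x by lra.
    rewrite (_ : \sum_(j <- js) _ =
      p xi * \sum_(j <- js) (c j * X j xi) * (chl (l j) s * shl (l j) (xi - x)) +
      chi xi * \sum_(j <- js) c j * (chl (l j) s * shl (l j) (xi - x))); last first.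
      rewrite !mulr_sumr -big_split/=; apply: eq_bigr => j _.
      by ring.
    have B1 : `|\sum_(j <- js) (c j * X j xi) * (chl (l j) s * shl (l j) (xi - x))| <= L * N * w xi.
      apply: le_trans (dalembert_bound _ _ _ _ r0) _.
      apply: (@le_trans _ _ (2^-1 * (N * w xi * (s + (xi - x) - (s - (xi - x)))))).
        rewrite ler_pM2l ?invr_gt0//; apply: Rint_norm_le.
        - lra.
        - move=> z; apply: (@is_derive1_continuous _ _ _
            (\sum_(j <- js) (c j * X j xi) * (l j ^+ 2 * shl (l j) z))).
          by apply: is_derive1_sum => j; apply: is_derive1_scale; exact: is_derive_chl.
        - move=> z /andP[z1 z2].
          (* Indeed |z| <= |s| + (xi - x) <= (x - a) + (xi - x) = xi - a. *)
          have zY : ((xi, z).1 \in `]a, b[) && (`|(xi, z).2| <= (xi, z).1 - a).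
            rewrite /= in_itv/= xib (lt_trans ax xxi)/=.
            by move: sx => /=; rewrite !ler_norml => /andP[s1 s2]; apply/andP; split; lra.
          have := DN (exist _ (xi, z) zY); rewrite /D/=.
          by under eq_bigr do rewrite mulrAC.
      rewrite (_ : 2^-1 * _ = N * w xi * (xi - x)); last by field.
      rewrite (_ : L * N * w xi = N * w xi * L); last by ring.
      by rewrite ler_wpM2l ?mulr_ge0 ?(ltW (w_gt0 _))// /L; lra.
    have B2 : `|\sum_(j <- js) c j * (chl (l j) s * shl (l j) (xi - x))| <= A0 / 2.
      apply: le_trans (dalembert_bound _ _ _ _ r0) _.
      rewrite mulrC ler_pM2r ?invr_gt0//; apply: Rint_norm_sub => //.
        by move: sx => /=; rewrite ler_norml /L => /andP[s1 s2]; lra.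
      by move: sx => /=; rewrite ler_norml /L => /andP[s1 s2]; lra.
    apply: le_trans (ler_normD _ _) _; rewrite !normrM; apply: lerD.
      by rewrite -!mulrA; apply: ler_pM => //; rewrite mulrA.
    by rewrite -mulrA; apply: ler_pM.
  have iw : itg mu (fun xi => \1_`]x, b[ xi * w xi) by exact: itg_ind_continuous.
  rewrite (_ : (fun xi => _) = fun xi => P * L * N * (\1_`]x, b[ xi * w xi) +
     (Q * A0 / 2) * \1_`]x, b[ xi); last by apply/funext => xi; ring.
  have i1 : itg mu (\1_`]x, b[ : R -> R) by exact: itg_ind1.
  rewrite RintegralD//; [|exact: (itgZ _ iw)|exact: (itgZ _ i1)].
  rewrite RintegralZl// RintegralZl//.
  have I1 : \int[mu]_t (\1_`]x, b[ t) = b - x.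
    rewrite /Rintegral integral_indic//= setIT lebesgue_measure_itv/= lte_fin.
    by rewrite xb.
  rewrite I1 [leRHS]mulrDl addrC; apply: lerD.
    apply: (@le_trans _ _ (L * Q * A0 / 2 * 1)).
      rewrite mulr1 (_ : L * Q * A0 / 2 = Q * A0 / 2 * L); last by ring.
      by rewrite ler_wpM2l ?divr_ge0 ?mulr_ge0// /L; lra.
    rewrite ler_wpM2l ?divr_ge0 ?mulr_ge0// ?(ltW L0)//.
    by rewrite -expR0 ler_expR mulr_ge0 ?(ltW kap0)//; lra.
  apply: (@le_trans _ _ (P * L * N * (w x / kap))).
    rewrite ler_wpM2l ?mulr_ge0//; first exact: ltW.
    by apply: Rint_weight_le => //; exact: ltW.
  rewrite (_ : P * L * N * _ = N * w x * (P * L / kap)); last by ring.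
  rewrite (_ : N / 2 * w x = N * w x * 2^-1); last by ring.
  rewrite ler_wpM2l ?mulr_ge0 ?(ltW (w_gt0 _))// ler_pdivrMr// /kap; lra.
move=> x xI.
have [ax xb] : a < x /\ x < b by apply/andP; move: xI; rewrite in_itv.
have xY : ((x, 0 : R).1 \in `]a, b[) && (`|(x, 0 : R).2| <= (x, 0 : R).1 - a).
  by apply/andP; split => //=; rewrite normr0 subr_ge0 ltW.
have := main (exist _ (x, 0 : R) xY); rewrite /D/=.
under eq_bigr do rewrite chl0 mulr1.
move=> h; apply: le_trans h _.
rewrite (_ : 2 * (L * Q * A0 / 2) * w x = L * Q * A0 * w x); last by field.
rewrite [leRHS]mulrAC ler_wpM2l ?mulr_ge0 ?(ltW L0)//.
rewrite /w ler_expR ler_pM2l// /L; lra.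
Qed.

End WaveEstimate.

(** * Exponential series and the double exponential cut-off *)

Section ExponentialSeries.
Context (R : realType).
Implicit Types x y z : R.

Lemma series_exp_diff y z (n m : nat) : (n <= m)%N -> `|y| <= z ->
  `|series (exp_coeff y) m - series (exp_coeff y) n| <=
  series (exp_coeff z) m - series (exp_coeff z) n.
Proof.
move=> nm yz; have z0 : 0 <= z by exact: le_trans yz.
rewrite -(subnKC nm); elim: (m - n)%N => [|k ih].
  by rewrite addn0 !subrr normr0.
rewrite addnS /series/= !big_nat_recr//=.
rewrite [X in `|X|](_ : _ = exp_coeff y (n + k) +
  (series (exp_coeff y) (n + k)%N - series (exp_coeff y) n)); last first.
  by rewrite /series/=; ring.
rewrite [leRHS](_ : _ = exp_coeff z (n + k) +
  (series (exp_coeff z) (n + k)%N - series (exp_coeff z) n)); last first.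
  by rewrite /series/=; ring.
apply: le_trans (ler_normD _ _) _; apply: lerD => //.
rewrite /exp_coeff/= normrM normrX [X in _ * X]ger0_norm ?invr_ge0//.
by rewrite ler_wpM2r ?invr_ge0// lerXn2r ?nnegrE.
Qed.

Lemma cvg_series_expR y : series (exp_coeff y) @ \oo --> expR y.
Proof. exact: is_cvg_series_exp_coeff. Qed.

(** The tail of the series at y is dominated term by term by the tail at z, which makes the
    convergence uniform on |y| <= z. *)
Lemma series_exp_remainder y z (n : nat) : `|y| <= z ->
  `|expR y - series (exp_coeff y) n| <= expR z - series (exp_coeff z) n.
Proof.
move=> yz.
have cy : (fun m => `|series (exp_coeff y) m - series (exp_coeff y) n|) @ \oo -->
    `|expR y - series (exp_coeff y) n|.
  by apply: cvg_norm; apply: cvgB; [exact: cvg_series_expR|exact: cvg_cst].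
have cz : (fun m => series (exp_coeff z) m - series (exp_coeff z) n) @ \oo -->
    expR z - series (exp_coeff z) n.
  by apply: cvgB; [exact: cvg_series_expR|exact: cvg_cst].
rewrite -(cvg_lim _ cy)// -(cvg_lim _ cz)//; apply: ler_lim.
- by apply/cvg_ex; eexists; exact: cy.
- by apply/cvg_ex; eexists; exact: cz.
- by exists n => // m /= nm; exact: series_exp_diff.
Qed.

Lemma series_exp_unif z (e : R) : 0 < e -> exists n : nat, forall y,
  `|y| <= z -> `|expR y - series (exp_coeff y) n.+1| <= e.
Proof.
move=> e0; have /cvgrPdist_le/(_ _ e0)[n _ hn] := @cvg_series_expR z.
exists n => y yz; apply: le_trans (series_exp_remainder n.+1 yz) _.
by apply: le_trans (ler_norm _) _; exact: (hn n.+1 (leqnSn n)).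
Qed.

Lemma series_exp_le (n : nat) : series (exp_coeff (1 : R)) n <= expR 1.
Proof.
rewrite -subr_ge0; apply: le_trans (series_exp_remainder (y := 1) n _) => //.
by rewrite normr1.
Qed.

Lemma expR_ge_pow x (m : nat) : 0 <= x -> (0 < m)%N -> (x / m%:R) ^+ m <= expR x.
Proof.
move=> x0 m0; have m0' : (m%:R : R) != 0 by rewrite pnatr_eq0 -lt0n.
rewrite [in leRHS](_ : x = m%:R * (x / m%:R)); last first.
  by rewrite mulrC divfK.
rewrite expRM_natl lerXn2r ?nnegrE ?divr_ge0 ?expR_ge0//.
by have := expR_ge1Dx (x / m%:R); lra.
Qed.

(** This is exp(x) >= (x / m)^m with m = K + 1 and x = y tau; taking one power more than K leaves
    the decaying factor 1 / y. *)
Lemma pow_exp_bound (K : nat) (tau y : R) : 0 < tau -> 0 < y ->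
  y ^+ K * expR (- (y * tau)) <= (K.+1%:R / tau) ^+ K.+1 / y.
Proof.
move=> tau0 y0; have yt : 0 < y * tau by rewrite mulr_gt0.
have := expR_ge_pow (ltW yt) (ltn0Sn K).
rewrite expRN => h; rewrite ler_pdivrMr ?expR_gt0//.
have -> : y ^+ K = (K.+1%:R / tau) ^+ K.+1 / y * (y * tau / K.+1%:R) ^+ K.+1.
  rewrite mulrAC -exprMn_comm; last exact: mulrC.
  rewrite (_ : _ / tau * _ = y); last first.
    have : (K.+1%:R : R) != 0 by rewrite pnatr_eq0.
    by move: (K.+1%:R : R) => k k0; field; rewrite k0 gt_eqF.
  by rewrite exprSr mulfK ?gt_eqF.
by rewrite ler_wpM2l// divr_ge0 ?exprn_ge0 ?divr_ge0// ltW.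
Qed.

(** The function approximates the indicator of (- tau, tau). For s >= 2 tau the first inner
    exponential is at least A tau, so the first term is at most 1 / (A tau); the second inner
    exponential is at most 1 / (A tau), so the second term is that close to 1. The function is even
    in s. *)
Lemma double_exp_bound (A s tau : R) : 0 < A -> 0 < tau -> 2 * tau <= `|s| ->
  `|expR (- expR (A * (s - tau))) + expR (- expR (A * (- s - tau))) - 1| <=
  (A * tau)^-1.
Proof.
move=> A0 tau0; have At : 0 < A * tau by rewrite mulr_gt0.
wlog s0 : s / 0 <= s.
  move=> W hs; have [s0|/ltW s0] := leP 0 s; first exact: W.
  have := W (- s); rewrite normrN opprK oppr_ge0 => /(_ s0 hs).
  by rewrite [X in `|X - 1|]addrC.
rewrite ger0_norm// => ss.
set z1 := expR (A * (s - tau)); set z2 := expR (A * (- s - tau)).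
have z1b : A * tau <= z1.
  apply: (@le_trans _ _ (A * (s - tau))); first by rewrite ler_pM2l//; lra.
  by have := expR_ge1Dx (A * (s - tau)); rewrite -/z1; lra.
have e1 : expR (- z1) <= (A * tau)^-1.
  rewrite expRN lef_pV2 ?posrE ?expR_gt0//; apply: (le_trans z1b).
  by have := expR_ge1Dx z1; lra.
have z2b : z2 <= (A * tau)^-1.
  rewrite /z2 (_ : A * (- s - tau) = - (A * (s + tau))); last by ring.
  rewrite expRN lef_pV2 ?posrE ?expR_gt0//.
  apply: (@le_trans _ _ (A * (s + tau))); first by rewrite ler_pM2l//; lra.
  by have := expR_ge1Dx (A * (s + tau)); lra.
have e2 : 1 - z2 <= expR (- z2) by have := expR_ge1Dx (- z2); lra.
have e2' : expR (- z2) <= 1 by rewrite expR_le1 oppr_le0 expR_ge0.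
have e1' := expR_ge0 (- z1).
by rewrite ler_norml; apply/andP; split; lra.
Qed.

Lemma double_exp_le1 (x y : R) :
  `|expR (- expR x) + expR (- expR y) - 1| <= 1.
Proof.
have h z : 0 <= expR (- expR z) <= 1.
  by rewrite expR_ge0 expR_le1 oppr_le0 expR_ge0.
by move: (h x) (h y) => /andP[? ?] /andP[? ?]; rewrite ler_norml; apply/andP; split; lra.
Qed.

Lemma le_inv_nat (C x y : R) (n0 : nat) :
  (forall n : nat, (n0 <= n)%N -> x <= y + C / n.+1%:R) -> x <= y.
Proof.
move=> h; rewrite leNgt; apply/negP => yx.
have C0 : C <= `|C| by exact: ler_norm.
pose n := maxn n0 (Num.truncn (`|C| / (x - y))).
have := h n (leq_maxl _ _); apply/negP; rewrite -ltNge -ltrBrDl.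
apply: (@le_lt_trans _ _ (`|C| / n.+1%:R)).
  by rewrite ler_wpM2r ?invr_ge0.
rewrite ltr_pdivrMr// mulrC -ltr_pdivrMr ?subr_gt0//.
apply: lt_le_trans (truncnS_gt _) _.
by rewrite ler_nat ltnS leq_maxr.
Qed.

End ExponentialSeries.

(** * From polynomial growth in the frequency to the vanishing of the pairing with the source *)

Section Mikusinski.
Context (R : realType) (a b : R) (p f : R -> R).
Hypotheses (ab : a < b) (bp : bddm p).
Local Notation mu := (@lebesgue_measure R).
Hypothesis fi : itg mu f.
Local Notation volt := (volt a b).
Local Notation L := (b - a).

(* [source_bound C K T0 l0]: the bound on the source term obtained from the
   truncated Laplace transform in time at the frequency s with s^alpha = l^2. *)
Definition source_bound (C : R) (K : nat) (T0 l0 : R) : Prop :=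
  forall l X chi MX Mchi, l0 <= l -> bddm X -> bddm chi ->
  (forall x, `|X x| <= MX) -> (forall x, `|chi x| <= Mchi) ->
  (forall x, X x = volt (fun r => r) (fun z => l ^+ 2 * X z + (p z * X z + chi z)) x) ->
  `|\int[mu]_x (X x * f x)| <= C * l ^+ K * (expR (- (T0 * l ^+ 2)) * MX + Mchi).

Section Family.
Variable g0 : R -> R.
Hypothesis bg0 : bddm g0.

Let X0 := volt (fun r => r) g0.
Let chi x := g0 x - p x * X0 x.

(** The choice chi = g0 - p X0 makes X0, the double primitive of g0, the member of the family at l =
    0: X0'' = g0 = p X0 + chi. *)
Lemma wave_family : exists X : R -> R -> R, [/\ X 0 = X0,
  forall l, bddm (X l) &
  forall l x, X l x = volt (shl l) (fun z => p z * X l z + chi z) x].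
Proof.
have bX0 : bddm X0 by exact: (bddm_volt ab (vkernel_id ab) bg0).
have bchi : bddm chi by apply: bddmB => //; exact: bddmM.
have /choice[Xf XfP] : forall l, exists Y, bddm Y /\
    forall x, Y x = volt (shl l) (fun z => p z * Y z + chi z) x.
  move=> l; have [Y bY YE] := volt_exists ab (vkernel_shl ab l) bp bchi.
  by exists Y.
exists (fun l => if l == 0 then X0 else Xf l); split=> [|l|l x].
- by rewrite eqxx.
- by case: eqP => // _; case: (XfP l).
- case: eqP => [->|_]; last by case: (XfP l).
  rewrite /X0 (_ : shl 0 = fun r => r); last by apply/funext => r; rewrite /shl eqxx.
  congr volt; apply/funext => z; rewrite /chi /X0; ring.
Qed.

End Family.

(** The pairings of f with X_l, l > 0, grow at most polynomially. A combination of the X_l with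
    coefficient 1 at l = 0 and rapidly small coefficients elsewhere is itself small in sup norm by
    [dalembert_est], so the pairing with X_0 is small. *)
Lemma mikusinski_source (C T0 l0 : R) (K : nat) (g0 : R -> R) :
  0 <= C -> 0 < T0 -> source_bound C K T0 l0 -> bddm g0 ->
  \int[mu]_x (volt (fun r => r) g0 x * f x) = 0.
Proof.
move=> C0 T00 HS bg0.
have L0 : 0 < L by rewrite subr_gt0.
have [P P0 pP] := bddm_ge0 bp.
have [X [X0E bX XE]] := wave_family bg0.
pose X0 := volt (fun r => r) g0.
pose chi x := g0 x - p x * X0 x.
have bX0 : bddm X0 by exact: (bddm_volt ab (vkernel_id ab) bg0).
have bchi : bddm chi by apply: bddmB => //; exact: bddmM.
have [Q Q0 cQ] := bddm_ge0 bchi.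
pose E := L * Q * expR ((2 * (P * L) + 1) * L).
have E0 : 0 <= E by rewrite !mulr_ge0// ?expR_ge0// ltW.
have XM l : 0 <= l -> forall x, `|X l x| <= E * (2 * L * expR (l * L)).
  move=> l_ge0 x; have [xI|xI] := boolP (x \in `]a, b[); last first.
    rewrite XE volt_out// normr0 !mulr_ge0// ?expR_ge0// ltW//.
  have := @dalembert_est R a b ab unit [:: tt] (fun=> 1) (fun=> l) (fun=> X l)
    p chi P Q (fun=> l_ge0) (fun=> bX l) bp bchi pP cQ (fun=> XE l) x xI.
  rewrite big_cons big_nil addr0 mul1r => h; apply: le_trans h _.
  rewrite -/E ler_wpM2l//.
  rewrite (_ : (fun z => _) = fun z => `|chl l z|); last first.
    by apply/funext => z; rewrite big_cons big_nil addr0 mul1r.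
  apply: le_trans (Rint_norm_le (B := expR (l * L)) _ _ _) _.
  - by lra.
  - exact: continuous_chl.
  - move=> z /andP[z1 z2]; rewrite ger0_norm ?chl_ge0//.
    apply: le_trans (chl_le _ l_ge0) _; rewrite ler_expR ler_wpM2l//.
    by rewrite ler_norml; apply/andP; split; lra.
  - by rewrite le_eqVlt; apply/orP; left; apply/eqP; ring.
(* Completing the square, l L - T0 l^2 <= L^2 / (4 T0): the Gaussian factor absorbs the exponential
   growth of X_l. *)
pose C2 := E * (2 * L) * expR (L ^+ 2 / (4 * T0)) + Q.
have C20 : 0 <= C2 by rewrite addr_ge0// !mulr_ge0 ?expR_ge0// ltW.
have cl l : 0 <= l -> l0 <= l -> `|\int[mu]_x (X l x * f x)| <= C * C2 * l ^+ K.
  move=> l_ge0 ll0.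
  have XE' x : X l x = volt (fun r => r) (fun z => l ^+ 2 * X l z + (p z * X l z + chi z)) x.
    have bG : bddm (fun z => p z * X l z + chi z) by apply: bddmD => //; exact: bddmM.
    rewrite [LHS]XE (volt_shl ab l x bG); congr volt; apply/funext => z.
    by rewrite -XE.
  apply: le_trans (HS l (X l) chi _ Q ll0 (bX l) bchi (XM l l_ge0) cQ XE') _.
  rewrite (_ : C * C2 * l ^+ K = C * l ^+ K * C2); last by ring.
  rewrite ler_wpM2l ?mulr_ge0 ?exprn_ge0// /C2 lerD2r.
  rewrite [leLHS](_ : _ = E * (2 * L) * (expR (- (T0 * l ^+ 2)) * expR (l * L)));
    last by ring.
  rewrite ler_wpM2l ?mulr_ge0 ?(ltW L0)//.
  rewrite -expRD ler_expR -subr_ge0.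
  rewrite (_ : _ - _ = (2 * T0 * l - L) ^+ 2 / (4 * T0)).
    by rewrite divr_ge0 ?sqr_ge0// mulr_ge0// ltW.
  by field; rewrite gt_eqF.
pose N1 := \int[mu]_x `|f x|.
have N10 : 0 <= N1 by exact: Rintegral_ge0.
pose v := \int[mu]_x (X0 x * f x).
have main (tau : R) (n N : nat) (e : R) : 0 < tau -> 0 < e -> l0 <= n.+1%:R ->
    (forall y, `|y| <= expR (n.+1%:R * L) ->
      `|expR y - series (exp_coeff y) N.+1| <= e) ->
    `|v| <= N1 * E * (4 * tau + 2 * L * ((n.+1%:R * tau)^-1 + 2 * e)) +
      2 * C * C2 * (K.+1%:R / tau) ^+ K.+1 * expR 1 / n.+1%:R.
  move=> tau0 e0 nl0 hN; set A : R := n.+1%:R.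
  have A0 : 0 < A by rewrite /A ltr0n.
  (* Expansion of exp(- exp(A (z - tau))) + exp(- exp(A (- z - tau))) - 1: for j > 0 the two series
     combine into 2 cosh(j A z), and for j = 0 they give 1 + 1 - 1 = 1. The sum is cut after j = N,
     with error e for each series. *)
  pose c (j : nat) : R := if j == 0%N then 1
    else 2 * ((-1) ^+ j / j`!%:R * expR (- (j%:R * A * tau))).
  pose l (j : nat) : R := j%:R * A.
  have l_ge0 j : 0 <= l j by rewrite mulr_ge0// ltW.
  pose js := index_iota 0 N.+1.
  pose th z := \sum_(j <- js) c j * chl (l j) z.
  have thE z : th z = series (exp_coeff (- expR (A * (z - tau)))) N.+1 +
      series (exp_coeff (- expR (A * (- z - tau)))) N.+1 - 1.
    rewrite /th /js /series/= big_nat_recl// [X in _ = X + _ - _]big_nat_recl//.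
    rewrite [X in _ = _ + X - _]big_nat_recl//.
    rewrite {1}/c eqxx /l mul0r mul1r /chl mul0r oppr0 expR0.
    rewrite /exp_coeff/= !expr0 fact0 divr1.
    rewrite [RHS](_ : _ = 1 + (\sum_(0 <= i < N) ((- expR (A * (z - tau))) ^+ i.+1 / i.+1`!%:R) +
      \sum_(0 <= i < N) ((- expR (A * (- z - tau))) ^+ i.+1 / i.+1`!%:R))); last by ring.
    congr (_ + _); first by field.
    rewrite -big_split/=; apply: eq_bigr => i _.
    have ex (t : R) : (- expR (A * (t - tau))) ^+ i.+1 =
        (-1) ^+ i.+1 * (expR (i.+1%:R * A * t) * expR (- (i.+1%:R * A * tau))).
      by rewrite [LHS]exprNn; congr (_ * _); rewrite -expRM_natl -expRD; congr expR; ring.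
    rewrite !ex (_ : i.+1%:R * A * - z = - (i.+1%:R * A * z)); last by ring.
    rewrite /c/=.
    have : (i.+1`!%:R : R) != 0 by rewrite pnatr_eq0 -lt0n fact_gt0.
    move: (i.+1`!%:R : R) => k k0.
    move: (expR (i.+1%:R * A * z)) (expR (- (i.+1%:R * A * z)))
      (expR (- (i.+1%:R * A * tau))) ((-1) ^+ i.+1) => e1 e2 e3 e4.
    by field.
  have cth : continuous th.
    move=> z; apply: (@is_derive1_continuous _ _ _ (\sum_(j <- js) c j * (l j ^+ 2 * shl (l j) z))).
    by apply: is_derive1_sum => j; apply: is_derive1_scale; exact: is_derive_chl.
  have thb z : - L <= z <= L -> `|th z| <= \1_`]- (2 * tau), 2 * tau[ z + ((A * tau)^-1 + 2 * e).
    move=> /andP[z1 z2]; rewrite thE.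
    set y1 := - expR _; set y2 := - expR _.
    have hy (t : R) : t <= L -> `|- expR (A * (t - tau))| <= expR (A * L).
      move=> tL; rewrite normrN ger0_norm ?expR_ge0// ler_expR ler_pM2l//; lra.
    have h1 := hN y1 (hy z z2).
    have h2 := hN y2 (hy (- z) ltac:(lra)).
    rewrite [X in `|X|](_ : _ = (expR y1 + expR y2 - 1) +
      ((series (exp_coeff y1) N.+1 - expR y1) + (series (exp_coeff y2) N.+1 - expR y2)));
      last by ring.
    apply: le_trans (ler_normD _ _) _.
    rewrite [leRHS]addrA; apply: lerD; last first.
      apply: le_trans (ler_normD _ _) _.
      by rewrite distrC in h1; rewrite distrC in h2; lra.
    have At : 0 < (A * tau)^-1 by rewrite invr_gt0 mulr_gt0.
    have [zI|zI] := boolP (z \in `]- (2 * tau), 2 * tau[).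
      rewrite ind_in//.
      apply: le_trans (double_exp_le1 (A * (z - tau)) (A * (- z - tau))) _.
      by rewrite lerDl ltW.
    rewrite ind_notin// add0r; apply: double_exp_bound => //.
    by rewrite leNgt; apply: contra zI; rewrite ltr_norml in_itv.
  have thI : \int[mu]_(z in `[- L, L]) `|th z| <=
      4 * tau + 2 * L * ((A * tau)^-1 + 2 * e).
    have ith : itg mu (fun z => \1_`[- L, L] z * `|th z|).
      apply/itg_ind_itv; apply: continuous_compact_integrable; first exact: segment_compact.
      by apply: continuous_subspaceT => z; apply: cvg_norm; exact: cth.
    have i1 : itg mu (\1_`]- (2 * tau), 2 * tau[ : R -> R) by exact: itg_ind1.
    have i2 : itg mu (\1_`[- L, L] : R -> R) by exact: itg_ind1.
    rewrite -Rint_ind.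
    apply: (@le_trans _ _ (\int[mu]_z (\1_`]- (2 * tau), 2 * tau[ z +
       ((A * tau)^-1 + 2 * e) * \1_`[- L, L] z))).
      apply: le_Rintegral => //; first exact: (itgD i1 (itgZ _ i2)).
      move=> z _; have [zI|zI] := boolP (z \in `[- L, L]); last first.
        by rewrite !(ind_notin zI) mul0r mulr0 addr0 indicE.
      rewrite !(ind_in zI) mul1r mulr1; apply: thb; move: zI; by rewrite in_itv.
    rewrite RintegralD//; last exact: (itgZ _ i2).
    rewrite RintegralZl//.
    rewrite /Rintegral !integral_indic//= !setIT !lebesgue_measure_itv/= !lte_fin.
    have -> : - (2 * tau) < 2 * tau by lra.
    have -> : - L < L by lra.
    by rewrite -!EFinB /= le_eqVlt; apply/orP; left; apply/eqP; move: (A * tau)^-1 => q; ring.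
  have iXf j : itg mu (fun x => X j x * f x) by exact: itg_bddm.
  (* The sought pairing is the term j = 0: it is the pairing of the small combination minus the
     terms j > 0. *)
  have vE : v = \int[mu]_x ((\sum_(j <- js) c j * X (l j) x) * f x) -
     \sum_(1 <= j < N.+1) c j * \int[mu]_x (X (l j) x * f x).
    have -> : \int[mu]_x ((\sum_(j <- js) c j * X (l j) x) * f x) =
        \sum_(j <- js) c j * \int[mu]_x (X (l j) x * f x).
      under eq_Rintegral do rewrite mulr_suml.
      rewrite Rint_sum; last first.
        move=> j; have := itgZ (c j) (iXf (l j)).
        by congr itg; apply/funext => x; rewrite mulrA.
      apply: eq_bigr => j _; rewrite -RintegralZl//; last exact: iXf.
      by apply: eq_Rintegral => x _; rewrite mulrA.
    rewrite /js big_ltn// {1}/c eqxx mul1r /l mul0r X0E.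
    by rewrite addrK.
  rewrite vE; apply: le_trans (ler_normB _ _) _; apply: lerD.
    rewrite -mulrA mulrC.
    have bD : bddm (fun x => \sum_(j <- js) c j * X (l j) x).
      elim: js {th thE cth thb thI vE} => [|j s ih].
        by under eq_fun do rewrite big_nil; exact: bddm_cst.
      under eq_fun do rewrite big_cons; apply: bddmD => //.
      by apply: bddmM => //; exact: bddm_cst.
    apply: Rint_mulb_le => //; first by case: bD.
    move=> x; have [xI|xI] := boolP (x \in `]a, b[); last first.
      rewrite big1 ?normr0; last by move=> j _; rewrite XE volt_out// mulr0.
      rewrite mulr_ge0// addr_ge0//; first by lra.
      rewrite !mulr_ge0 ?(ltW L0)// addr_ge0 ?invr_ge0 ?mulr_ge0 ?ltW//.
    have := @dalembert_est R a b ab nat js c l (fun j => X (l j))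
      p chi P Q l_ge0 (fun j => bX (l j)) bp bchi pP cQ (fun j => XE (l j)) x xI.
    by move=> h; apply: le_trans h _; rewrite -/E ler_wpM2l.
  apply: le_trans (ler_norm_sum _ _ _) _.
  pose B := (K.+1%:R / tau) ^+ K.+1.
  have B0 : 0 <= B by rewrite exprn_ge0// divr_ge0// ltW.
  (* By [pow_exp_bound], (j A)^K exp(- j A tau) <= B / (j A) <= B / A, and the remaining factors 1 /
     j! sum to at most exp(1), uniformly in N. *)
  apply: (@le_trans _ _ (\sum_(1 <= j < N.+1) (2 * C * C2 * B / A) * exp_coeff 1 j)).
    rewrite !big_nat; apply: ler_sum => j /andP[j1 _].
    have j0 : (0 < j)%N by [].
    have lj0 : 0 < l j by rewrite mulr_gt0// ltr0n.
    have lj : A <= l j by rewrite /l ler_peMl ?(ltW A0)// ler1n.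
    rewrite normrM {1}/c -[j == 0%N]negbK -lt0n j0/=.
    rewrite !normrM normrX normrN normr1 expr1n mul1r.
    rewrite [`|2|]ger0_norm// [`|_^-1|]ger0_norm ?invr_ge0// [`|expR _|]ger0_norm ?expR_ge0//.
    rewrite /exp_coeff/= expr1n mul1r.
    apply: (@le_trans _ _ (2 * ((j`!%:R)^-1 * expR (- (l j * tau))) * (C * C2 * l j ^+ K))).
      rewrite ler_wpM2l ?mulr_ge0 ?invr_ge0 ?expR_ge0//.
      by apply: cl => //; apply: le_trans lj.
    rewrite [leLHS](_ : _ = 2 * C * C2 * (j`!%:R)^-1 * (l j ^+ K * expR (- (l j * tau))));
      last by ring.
    rewrite [leRHS](_ : _ = 2 * C * C2 * (j`!%:R)^-1 * (B / A)); last by ring.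
    rewrite ler_wpM2l ?mulr_ge0 ?invr_ge0//.
    apply: le_trans (pow_exp_bound K tau0 lj0) _.
    by rewrite ler_wpM2l// lef_pV2 ?posrE.
  rewrite -mulr_sumr [leRHS]mulrAC ler_wpM2l//.
    by rewrite divr_ge0 ?(ltW A0)// !mulr_ge0.
  apply: le_trans (series_exp_le R N.+1); rewrite /series/= [leRHS]big_ltn//.
  by rewrite lerDr exp_coeff_ge0.
apply/eqP; rewrite -normr_le0 -/X0 -/v.
(* First limit: tau is fixed, A = n + 1 tends to infinity with e = 1 / (n + 1), and N is chosen
   after n. Only afterwards does tau tend to 0. *)
have step1 (tau : R) : 0 < tau -> `|v| <= N1 * E * (4 * tau).
  move=> tau0; pose B := (K.+1%:R / tau) ^+ K.+1.
  apply: (@le_inv_nat _ (N1 * E * (2 * L * (tau^-1 + 2)) + 2 * C * C2 * B * expR 1) _ _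
     (Num.truncn l0).+1) => n nl0.
  have n0 : 0 < n.+1%:R :> R by rewrite ltr0n.
  have [N hN] := series_exp_unif (expR (n.+1%:R * L)) (e := n.+1%:R^-1) ltac:(by rewrite invr_gt0).
  have := main tau n N n.+1%:R^-1 tau0 _ _ hN.
  move=> h; apply: le_trans (h _ _) _; first by rewrite invr_gt0.
    apply: (le_trans (ltW (truncnS_gt _))); rewrite ler_nat.
    by rewrite (leq_trans nl0).
  rewrite -/B le_eqVlt; apply/orP; left; apply/eqP.
  by move: (n.+1%:R : R) n0 => k k0; field; rewrite !gt_eqF.
apply: (@le_inv_nat _ (N1 * E * 4) _ _ 0%N) => n _; rewrite add0r.
apply: le_trans (step1 n.+1%:R^-1 _) _; first by rewrite invr_gt0.
by rewrite mulrA.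
Qed.

End Mikusinski.

(** * Smooth functions, bumps and mollified steps *)

Section SmoothFunctions.
Context (R : realType).
Implicit Types (f g h : R -> R) (x c : R).

Definition smooth f := forall n x, derivable (derive1n n f) x 1.

Lemma derivable_is_derive1 f x : derivable f x 1 -> is_derive x 1 f (derive1 f x).
Proof. by move=> df; split => //; rewrite derive1E. Qed.

Lemma is_derive_derive1 f x c : is_derive x 1 f c -> derive1 f x = c.
Proof. by case=> _ <-; rewrite derive1E. Qed.

(** A coinduction principle: exhibiting a class stable under derivation avoids closed formulas for
    iterated derivatives. Below, the class is that of sums, of affine changes of variable,
    [prodspan] or [flatspan]. *)
Lemma smooth_coind (P : (R -> R) -> Prop) :
  (forall f, P f -> exists2 g, P g & forall x, is_derive x 1 f (g x)) ->
  forall f, P f -> smooth f.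
Proof.
move=> HP f Pf n.
suff [g Pg ->] : exists2 g, P g & derive1n n f = g.
  by move=> x; have [g' _ /(_ x) []] := HP g Pg.
elim: n => [|n [g Pg gE]]; first by exists f.
have [g' Pg' dg] := HP g Pg; exists g' => //.
rewrite derive1nS gE; apply/funext => x; exact: is_derive_derive1.
Qed.

Lemma smooth_is_derive f x : smooth f -> is_derive x 1 f (derive1 f x).
Proof. by move=> sf; apply: derivable_is_derive1; exact: (sf 0%N). Qed.

Lemma smooth_derive1 f : smooth f -> smooth (derive1 f).
Proof. by move=> sf n x; rewrite -derive1Sn; exact: sf. Qed.

Lemma smooth_continuous f : smooth f -> continuous f.
Proof. by move=> sf x; exact: is_derive1_continuous (smooth_is_derive x sf). Qed.

Lemma smooth_prim f g : smooth g -> (forall x, is_derive x 1 f (g x)) -> smooth f.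
Proof.
move=> sg df.
have H h : (smooth h \/ h = f) -> exists2 h', (smooth h' \/ h' = f) &
    forall x, is_derive x 1 h (h' x).
  case=> [sh|->]; last by exists g => //; left.
  exists (derive1 h); first by left; exact: smooth_derive1.
  by move=> x; exact: smooth_is_derive.
by apply: (smooth_coind H); right.
Qed.

Lemma smoothD f g : smooth f -> smooth g -> smooth (fun x => f x + g x).
Proof.
move=> sf sg; apply: (smooth_coind (P := fun h => exists f g,
  [/\ smooth f, smooth g & h = fun x => f x + g x])) => [h|]; last by exists f, g.
move=> [f1 [g1 [sf1 sg1 ->]]]; exists (fun x => derive1 f1 x + derive1 g1 x).
  by exists (derive1 f1), (derive1 g1); split => //; exact: smooth_derive1.
by move=> x; apply: is_derive1_add; exact: smooth_is_derive.
Qed.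

Lemma smooth_affine f (u v c : R) : smooth f -> smooth (fun x => c * f (u * x + v)).
Proof.
move=> sf; apply: (smooth_coind (P := fun h => exists f c,
  smooth f /\ h = fun x => c * f (u * x + v))) => [h|]; last by exists f, c.
move=> [f1 [c1 [sf1 ->]]]; exists (fun x => (c1 * u) * derive1 f1 (u * x + v)).
  by exists (derive1 f1), (c1 * u); split => //; exact: smooth_derive1.
move=> x.
have da : is_derive x 1 (fun y => u * y + v) (u * 1 + 0).
  exact: (is_derive1_add (is_derive1_scale u (is_derive1_id x)) (is_derive1_const v x)).
have := is_derive1_scale c1 (@is_derive1_comp R f1 (fun y => u * y + v) x _ _
  (smooth_is_derive _ sf1) da).
by move/is_derive1_eq; apply; ring.
Qed.

Inductive prodspan : (R -> R) -> Prop :=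
| prodspan_mul f g : smooth f -> smooth g -> prodspan (fun x => f x * g x)
| prodspan_add h1 h2 : prodspan h1 -> prodspan h2 -> prodspan (fun x => h1 x + h2 x).

Lemma smoothM f g : smooth f -> smooth g -> smooth (fun x => f x * g x).
Proof.
move=> sf sg; apply: (smooth_coind (P := prodspan)); last exact: prodspan_mul.
move=> h; elim=> [f1 g1 sf1 sg1|h1 h2 _ [h1' p1 d1] _ [h2' p2 d2]].
  exists (fun x => f1 x * derive1 g1 x + g1 x * derive1 f1 x).
    by apply: prodspan_add; apply: prodspan_mul => //; exact: smooth_derive1.
  by move=> x; apply: is_derive1_mul; exact: smooth_is_derive.
exists (fun x => h1' x + h2' x); first exact: prodspan_add.
by move=> x; exact: is_derive1_add.
Qed.

End SmoothFunctions.

Section FlatExponential.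
Context (R : realType).
Implicit Types (x c : R).

(** For n = 0 the classical flat function exp(- 1 / x); the powers of 1 / x are those that its
    derivatives produce. *)
Definition flat (n : nat) x : R := if 0 < x then x^-1 ^+ n * expR (- x^-1) else 0.

Lemma flat_eq0 n x : x <= 0 -> flat n x = 0.
Proof. by rewrite /flat ltNge => ->. Qed.

(** From [pow_exp_bound] at y = 1 / x. The quadratic bound makes the difference quotient at 0 tend
    to 0. *)
Lemma flat_le n x : 0 <= x -> `|flat n x| <= n.+2%:R ^+ n.+2 * x ^+ 2.
Proof.
rewrite le_eqVlt => /predU1P[<-|x0].
  by rewrite /flat ltxx normr0 expr0n/= mulr0.
rewrite /flat x0 ger0_norm ?mulr_ge0 ?exprn_ge0 ?invr_ge0 ?(ltW x0) ?expR_ge0//.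
have xi0 : 0 < x^-1 by rewrite invr_gt0.
have := pow_exp_bound n.+1 ltr01 xi0; rewrite mulr1 divr1 invrK => h.
rewrite (_ : x^-1 ^+ n * expR (- x^-1) = x * (x^-1 ^+ n.+1 * expR (- x^-1))).
  by rewrite expr2 [leRHS]mulrCA ler_wpM2l ?(ltW x0).
rewrite [in RHS]exprS; move: (x^-1 ^+ n) (expR _) => q1 q2.
by field; exact: lt0r_neq0.
Qed.

Lemma is_derive_flat n x : is_derive x 1 (flat n) (flat n.+2 x - n%:R * flat n.+1 x).
Proof.
have [x0|x0|->] := ltgtP x 0.
- rewrite (flat_eq0 _ (ltW x0)) (flat_eq0 _ (ltW x0)) mulr0 subrr.
  apply: (@near_eq_is_derive _ _ _ (fun=> 0 : R) _ x 1 0 _ (is_derive1_const 0 x)).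
  near=> y; rewrite flat_eq0//; apply: ltW.
  by near: y; exact: lt_nbhsl.
- have xn : x != 0 by exact: lt0r_neq0.
  have dv : is_derive x 1 (fun y : R => y^-1) (- x ^- 2 *: 1).
    exact: (is_deriveV (f := id)).
  have de := is_derive1_exp (is_derive1_opp dv).
  have dX : is_derive x 1 (fun y : R => y^-1 ^+ n) (n%:R * x^-1 ^+ n.-1 * (- x ^- 2)).
    have := is_deriveX n dv; rewrite exprfctE.
    by move/is_derive1_eq; apply; rewrite /GRing.scale/= mulr1.
  apply: (@near_eq_is_derive _ _ _ (fun y : R => y^-1 ^+ n * expR (- y^-1)) _ x 1).
    near=> y; rewrite /flat (_ : 0 < y)//.
    by near: y; exact: lt_nbhsr.
  have := is_derive1_mul dX de; move/is_derive1_eq; apply.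
  rewrite /flat x0 /GRing.scale/= mulr1.
  case: n {dX} => [|n] /=; first by rewrite !mul0r expr0; move: (expR _) => q; field.
  rewrite [x^-1 ^+ n.+3]exprS [x^-1 ^+ n.+2]exprS [x^-1 ^+ n.+1]exprS.
  by move: (x^-1 ^+ n) (expR _) (n.+1%:R : R) => q1 q2 q3; field.
- rewrite !flat_eq0// mulr0 subrr.
  have H : h^-1 *: ((flat n \o shift 0) (h *: 1) - flat n 0) @[h --> 0^'] --> (0 : R).
    apply/cvgrPdist_le => e e0; near=> h.
    have h0 : h != 0 by near: h; exact: nbhs_dnbhs_neq.
    rewrite sub0r normrN /= /GRing.scale/= mulr1 addr0.
    rewrite (flat_eq0 _ (lexx 0)) subr0.
    have [hneg|hpos] := leP h 0; first by rewrite flat_eq0// mulr0 normr0 ltW.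
    rewrite normrM ger0_norm ?invr_ge0 ?(ltW hpos)//.
    rewrite mulrC ler_pdivrMr//; apply: le_trans (flat_le n (ltW hpos)) _.
    rewrite expr2 mulrA.
    rewrite ler_wpM2r ?(ltW hpos)//.
    have c0 : 0 < n.+2%:R ^+ n.+2 :> R by rewrite exprn_gt0.
    rewrite mulrC -ler_pdivlMr//.
    have : `|h| <= e / n.+2%:R ^+ n.+2.
      by near: h; apply: dnbhs0_le; exact: divr_gt0.
    by apply: le_trans; exact: ler_norm.
  split; first by apply/cvg_ex; exists 0.
  exact: (cvg_lim _ H).
Unshelve. all: by end_near. Qed.

Inductive flatspan : (R -> R) -> Prop :=
| flatspan_flat n : flatspan (flat n)
| flatspan_comb c h1 h2 : flatspan h1 -> flatspan h2 ->
    flatspan (fun x => h1 x - c * h2 x).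

Lemma smooth_flat n : smooth (flat n).
Proof.
apply: (smooth_coind (P := flatspan)); last exact: flatspan_flat.
move=> h; elim=> [k|c h1 h2 _ [h1' p1 d1] _ [h2' p2 d2]].
  exists (fun x => flat k.+2 x - k%:R * flat k.+1 x); last exact: is_derive_flat.
  by apply: flatspan_comb; exact: flatspan_flat.
exists (fun x => h1' x - c * h2' x); first exact: flatspan_comb.
by move=> x; apply: is_derive1_sub => //; exact: is_derive1_scale.
Qed.

Definition bump x : R := flat 0 x * flat 0 (1 - x).

Lemma flat_ge0 n x : 0 <= flat n x.
Proof.
rewrite /flat; case: ifP => // x0.
by rewrite mulr_ge0 ?expR_ge0// exprn_ge0// invr_ge0 ltW.
Qed.

Lemma smooth_bump : smooth bump.
Proof.
apply: smoothM; first exact: smooth_flat.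
have := @smooth_affine R (flat 0) (-1) 1 1 (@smooth_flat 0).
by congr smooth; apply/funext => x; rewrite mul1r mulN1r addrC.
Qed.

Lemma bump_ge0 x : 0 <= bump x. Proof. by rewrite mulr_ge0// flat_ge0. Qed.

Lemma bump_out x : x \notin `]0, 1[ -> bump x = 0.
Proof.
rewrite in_itv/= negb_and -!leNgt /bump /flat => /orP[x0|x1].
  by rewrite ltNge x0/= mul0r.
by rewrite subr_gt0 (ltNge x 1) x1/= mulr0.
Qed.

Lemma bump_gt0 x : x \in `]0, 1[ -> 0 < bump x.
Proof.
rewrite in_itv/= /bump /flat subr_gt0 => /andP[-> ->].
by rewrite !expr0 !mul1r mulr_gt0 ?expR_gt0.
Qed.

End FlatExponential.

Section DominatedReal.
Context d (T : measurableType d) (R : realType) (mu : {measure set T -> \bar R}).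

Lemma Rint_dominated_cvg (f_ : nat -> T -> R) (f g : T -> R) :
  (forall n, measurable_fun setT (f_ n)) -> itg mu g ->
  (forall n x, `|f_ n x| <= g x) -> (forall x, (fun n => f_ n x) @ \oo --> f x) ->
  (fun n => \int[mu]_x f_ n x) @ \oo --> \int[mu]_x f x.
Proof.
move=> mf ig fg cf.
have mlim : measurable_fun setT f by apply: (measurable_fun_cvg mf) => x _; exact: cf.
have fgl x : `|f x| <= g x.
  have cn : (fun n => `|f_ n x|) @ \oo --> `|f x| by apply: cvg_norm; exact: cf.
  rewrite -(cvg_lim _ cn)//; apply: limr_le; first by apply/cvg_ex; eexists; exact: cn.
  by apply: nearW => n.
have ifl : itg mu f by exact: itg_le ig.
have H : (\int[mu]_x (f_ n x)%:E)%E @[n --> \oo] --> (\int[mu]_x (f x)%:E)%E.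
  apply: (@dominated_cvg _ _ _ mu setT _ (fun n x => (f_ n x)%:E) (fun x => (f x)%:E) (EFin \o g)) => //.
  - by move=> n; exact/measurable_EFinP.
  - by move=> x _; apply: cvg_EFin; [exact: nearW|exact: cf].
  - by move=> n x _; rewrite lee_fin.
have E : (\int[mu]_x f x)%:E = (\int[mu]_x (f x)%:E)%E.
  by rewrite /Rintegral fineK//; exact: integrable_fin_num ifl.
by move: H; rewrite -E => H'; exact: (fine_cvg H').
Qed.

End DominatedReal.

Section SmoothStep.
Context (R : realType).
Local Notation mu := (@lebesgue_measure R).

Lemma bump_ind (x : R) : bump x = \1_`]0, 1[ x * bump x.
Proof.
by have [xI|xI] := boolP (x \in `]0, 1[);
  [rewrite ind_in ?mul1r|rewrite ind_notin ?mul0r ?bump_out].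
Qed.

Lemma itg_bump : itg mu (@bump R).
Proof.
have := itg_ind_continuous 0 1 (smooth_continuous (@smooth_bump R)).
by congr itg; apply/funext => x; rewrite -bump_ind.
Qed.

Definition bump_mass : R := \int[mu]_x bump x.

Lemma bump_mass_gt0 : 0 < bump_mass.
Proof.
rewrite lt0r; apply/andP; split; last by apply: Rintegral_ge0 => r _; exact: bump_ge0.
apply/eqP => If0.
case: (ge0_Rint0_ae _ itg_bump If0) => [r|N [mN N0 HN]]; first exact: bump_ge0.
have : (mu `]0%R, 1%R[%classic <= mu N)%E.
  apply: le_measure; rewrite ?inE; [exact: measurable_itv|exact: mN|].
  move=> r /= r01; apply: (HN r) => /= /eqP.
  by rewrite gt_eqF// bump_gt0.
by rewrite N0 lebesgue_measure_itv/= lte_fin ltr01 oppr0 adde0 lee_fin ler10.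
Qed.

Definition kern (x : R) : R := bump_mass^-1 * bump x.
Definition step (x : R) : R := \int[mu]_(z in `]-oo, x]) kern z.

Lemma kern_ge0 x : 0 <= kern x.
Proof. by rewrite mulr_ge0 ?invr_ge0 ?bump_ge0// ltW ?bump_mass_gt0. Qed.

Lemma kern_out x : x \notin `]0, 1[ -> kern x = 0.
Proof. by move=> x01; rewrite /kern bump_out ?mulr0. Qed.

Lemma smooth_kern : smooth kern.
Proof.
have := @smooth_affine R (@bump R) 1 0 bump_mass^-1 (@smooth_bump R).
by congr smooth; apply/funext => x; rewrite mul1r addr0.
Qed.

Lemma itg_kern : itg mu kern. Proof. exact: (itgZ _ itg_bump). Qed.

Lemma Rint_kern : \int[mu]_x kern x = 1.
Proof. by rewrite RintegralZl//; [rewrite mulVf// gt_eqF// bump_mass_gt0|exact: itg_bump]. Qed.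

Lemma is_derive_step (x : R) : is_derive x 1 step (kern x).
Proof.
have ck : {for x, continuous kern} by exact: smooth_continuous smooth_kern x.
have xx : x < x + 1 by rewrite ltrDl.
have ik : mu.-integrable [set` Interval -oo%O (BRight (x + 1))] (EFin \o kern).
  by apply/itg_ind_itv; exact: (itg_ind _ itg_kern).
have [ds dE] := continuous_FTC1 xx ik (ltNyr _) ck.
by split => //; rewrite -derive1E.
Qed.

Lemma smooth_step : smooth step.
Proof. exact: (smooth_prim smooth_kern is_derive_step). Qed.

Lemma step_le0 x : x <= 0 -> step x = 0.
Proof.
move=> x0; rewrite /step -Rint_ind (_ : (fun z => _) = fun=> 0).
  by rewrite /Rintegral integral0.
apply/funext => z; have [z01|z01] := boolP (z \in `]0, 1[); last by rewrite kern_out ?mulr0.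
rewrite ind_notin ?mul0r//; move: z01; rewrite !in_itv/= => /andP[z0 _].
by rewrite -ltNge (le_lt_trans x0).
Qed.

Lemma step_ge1 x : 1 <= x -> step x = 1.
Proof.
move=> x1; rewrite /step -Rint_ind -Rint_kern; apply: eq_Rintegral => z _.
have [z01|z01] := boolP (z \in `]0, 1[); last by rewrite kern_out ?mulr0.
rewrite ind_in ?mul1r//; move: z01; rewrite !in_itv/= => /andP[_ z1].
by rewrite (le_trans (ltW z1)).
Qed.

Lemma step_ge0 x : 0 <= step x.
Proof. by apply: Rintegral_ge0 => z _; exact: kern_ge0. Qed.

Lemma step_le1 x : step x <= 1.
Proof.
rewrite /step -Rint_ind -Rint_kern; apply: le_Rintegral => //.
- exact: (itg_ind _ itg_kern).
- exact: itg_kern.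
- by move=> z _; rewrite ler_piMl ?kern_ge0.
Qed.

(** A mollifier of mass 1 on ]c, c + delta[, and, with [stepd], its primitive, a smooth step from 0
    to 1 across that interval. Both are written in the shape of [smooth_affine], whence the factor 1
    in [stepd]. *)
Definition kernd (delta c x : R) : R := delta^-1 * kern (delta^-1 * x + - (delta^-1 * c)).
Definition stepd (delta c x : R) : R := 1 * step (delta^-1 * x + - (delta^-1 * c)).

Lemma is_derive_stepd (delta c x : R) : is_derive x 1 (stepd delta c) (kernd delta c x).
Proof.
have da : is_derive x 1 (fun y => delta^-1 * y + - (delta^-1 * c)) (delta^-1 * 1 + 0).
  exact: (is_derive1_add (is_derive1_scale _ (is_derive1_id x)) (is_derive1_const _ x)).
have := is_derive1_scale 1 (@is_derive1_comp R step _ x _ _ (is_derive_step _) da).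
by move/is_derive1_eq; apply; rewrite /kernd; ring.
Qed.

Lemma smooth_stepd delta c : smooth (stepd delta c).
Proof. exact: (@smooth_affine R step _ _ _ smooth_step). Qed.

Lemma smooth_kernd delta c : smooth (kernd delta c).
Proof. exact: (@smooth_affine R kern _ _ _ smooth_kern). Qed.

Lemma kernd_ge0 delta c x : 0 < delta -> 0 <= kernd delta c x.
Proof. by move=> d0; rewrite mulr_ge0 ?kern_ge0// invr_ge0 ltW. Qed.

Lemma kernd_out delta c x : 0 < delta -> x \notin `]c, c + delta[ -> kernd delta c x = 0.
Proof.
move=> d0 xI; rewrite /kernd kern_out ?mulr0//; apply: contra xI.
rewrite -mulrBr !in_itv/= => /andP[h1 h2].
move: h1 h2; rewrite pmulr_rgt0 ?invr_gt0// subr_gt0 => -> /=.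
by rewrite mulrC ltr_pdivrMr// mul1r ltrBlDl.
Qed.

Lemma stepd_le delta c x : 0 < delta -> x <= c -> stepd delta c x = 0.
Proof.
move=> d0 xc; rewrite /stepd mul1r -mulrBr step_le0//.
by rewrite pmulr_rle0 ?invr_gt0// subr_le0.
Qed.

Lemma stepd_ge delta c x : 0 < delta -> c + delta <= x -> stepd delta c x = 1.
Proof.
move=> d0 xc; rewrite /stepd mul1r -mulrBr step_ge1//.
by rewrite mulrC ler_pdivlMr// mul1r lerBrDl.
Qed.

Lemma itg_kernd delta c : 0 < delta -> itg mu (kernd delta c).
Proof.
move=> d0; have := itg_ind_continuous c (c + delta) (smooth_continuous (@smooth_kernd delta c)).
congr itg; apply/funext => x; have [xI|xI] := boolP (x \in `]c, c + delta[).
  by rewrite ind_in ?mul1r.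
by rewrite ind_notin ?mul0r ?kernd_out.
Qed.

Lemma Rint_kernd delta c : 0 < delta -> \int[mu]_x kernd delta c x = 1.
Proof.
move=> d0; rewrite (_ : kernd delta c = fun x => \1_`]c, c + delta[ x * kernd delta c x).
  have cd : c <= c + delta by rewrite lerDl ltW.
  rewrite (Rint_ind_FTC cd (is_derive_stepd delta c) (smooth_continuous (@smooth_kernd delta c))).
  by rewrite stepd_ge// stepd_le// subr0.
apply/funext => x; have [xI|xI] := boolP (x \in `]c, c + delta[).
  by rewrite ind_in ?mul1r.
by rewrite ind_notin ?mul0r ?kernd_out.
Qed.

Lemma kernd_mean (H : R -> R) (delta c e : R) : 0 < delta -> measurable_fun setT H ->
  (forall x, c < x < c + delta -> `|H x - H c| <= e) ->
  `|\int[mu]_x (H x * kernd delta c x) - H c| <= e.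
Proof.
move=> d0 mH He.
have e0 : 0 <= e.
  by apply: le_trans (He (c + delta / 2) _); first exact: normr_ge0; apply/andP; split; lra.
have ik := @itg_kernd delta c d0; have Ik := @Rint_kernd delta c d0.
have iHk : itg mu (fun x => (H x - H c) * kernd delta c x).
  apply: (itg_le _ _ (itgZ e ik)).
    apply: measurable_funM; last exact: itg_measurable ik.
    exact: measurable_funB.
  move=> x; rewrite normrM (ger0_norm (kernd_ge0 _ _ d0)).
  have [xI|xI] := boolP (x \in `]c, c + delta[); last by rewrite kernd_out ?mulr0.
  by rewrite ler_wpM2r ?kernd_ge0// He//; move: xI; rewrite in_itv.
rewrite (_ : _ - H c = \int[mu]_x ((H x - H c) * kernd delta c x)); last first.
  rewrite -[X in _ - X]mulr1 -Ik -RintegralZl// -RintegralB//; last exact: (itgZ _ ik).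
    by apply: eq_Rintegral => x _; ring.
  have := itgD iHk (itgZ (H c) ik); congr itg; apply/funext => x; ring.
rewrite -[leRHS]mulr1 -[X in _ <= _ * X]Ik -RintegralZl//.
apply: Rint_absle; [exact: itg_measurable iHk| |exact: (itgZ _ ik)].
move=> x; rewrite normrM (ger0_norm (kernd_ge0 _ _ d0)).
have [xI|xI] := boolP (x \in `]c, c + delta[); last by rewrite kernd_out ?mulr0.
by rewrite ler_wpM2r ?kernd_ge0// He//; move: xI; rewrite in_itv.
Qed.

Lemma step_test_function (a b c d delta : R) : a < c -> c <= d -> 0 < delta -> d + delta < b ->
  test_function a b (fun x => stepd delta c x - stepd delta d x).
Proof.
move=> ac cd d0 db; split.
  have := smoothD (@smooth_stepd delta c) (@smooth_affine R _ 1 0 (-1) (@smooth_stepd delta d)).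
  by congr smooth; apply/funext => x; rewrite mul1r addr0 mulN1r.
apply: (@subset_trans _ `[c, d + delta]%classic); last first.
  move=> x /=; rewrite !in_itv/= => /andP[cx xd].
  by rewrite (lt_le_trans ac cx) (le_lt_trans xd db).
rewrite closureE; apply: smallest_sub; first exact: interval_closed.
move=> x /= phi0; rewrite in_itv/= !leNgt; apply/andP; split; apply: contraNN phi0 => h.
  by rewrite !stepd_le ?subrr// ltW// (lt_le_trans h).
by rewrite !stepd_ge ?subrr// ltW// (le_lt_trans _ h)// lerD2r.
Qed.

End SmoothStep.

(** * The du Bois-Reymond lemma and the vanishing of the source *)

Section DuBoisReymond.
Context (R : realType).
Local Notation mu := (@lebesgue_measure R).

Lemma itg_mul_kernd (H : R -> R) (delta c e : R) : 0 < delta -> measurable_fun setT H ->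
  (forall x, c < x < c + delta -> `|H x - H c| <= e) ->
  itg mu (fun x => H x * kernd delta c x).
Proof.
move=> d0 mH He; have ik := @itg_kernd R delta c d0.
apply: (itg_le _ _ (itgZ (e + `|H c|) ik)).
  by apply: measurable_funM => //; exact: itg_measurable ik.
move=> x; rewrite normrM (ger0_norm (kernd_ge0 _ _ d0)).
have [xI|xI] := boolP (x \in `]c, c + delta[); last by rewrite kernd_out ?mulr0.
rewrite ler_wpM2r ?kernd_ge0//.
have h : `|H x - H c| <= e by apply: He; move: xI; rewrite in_itv.
rewrite -[X in `|X|](subrK (H c)); apply: le_trans (ler_normD _ _) _.
by rewrite lerD2r.
Qed.

Lemma open_within_dist (a b : R) (h : R -> R) (c e : R) :
  {within `]a, b[, continuous h} -> c \in `]a, b[ -> 0 < e ->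
  exists2 d, 0 < d & forall x, `|c - x| < d -> `|h x - h c| <= e.
Proof.
move=> ch cI e0.
have {}ch : {in `]a, b[, continuous h}.
  have oI : open `]a, b[%classic by exact: interval_open.
  by apply/in_continuous_mksetP; move: ch; rewrite (continuous_open_subspace _ oI).
have /cvgrPdist_le/(_ e e0)/nbhs_ballP[d /= d0 hd] := ch c cI.
by exists d => // x xd; rewrite distrC; exact: hd.
Qed.

Lemma dubois (a b : R) (h q : R -> R) : {within `]a, b[, continuous h} ->
  itg mu (fun x => \1_`]a, b[ x * q x) ->
  (forall phi, test_function a b phi ->
    \int[mu]_(x in `]a, b[) (h x * derive1 phi x) =
    - \int[mu]_(x in `]a, b[) (q x * phi x)) ->
  forall c d, a < c -> c <= d -> d < b ->
  h d - h c = \int[mu]_x (\1_`]c, d[ x * q x).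
Proof.
move=> ch iq hq c d ac cd db.
pose H x := \1_`]a, b[ x * h x.
have cI : c \in `]a, b[ by rewrite in_itv/= ac (le_lt_trans cd).
have dI : d \in `]a, b[ by rewrite in_itv/= (lt_le_trans ac).
have mH : measurable_fun setT H.
  have := subspace_continuous_measurable_fun (measurable_itv `]a, b[) ch.
  move/(measurable_restrictT h (measurable_itv `]a, b[)).
  congr measurable_fun; apply/funext => x; rewrite /H /patch indicE.
  by case: ifPn => _; rewrite ?mul1r ?mul0r.
have Hclose z e : z \in `]a, b[ -> 0 < e -> exists2 eta, 0 < eta &
    forall x, z < x < z + eta -> `|H x - H z| <= e.
  move=> zI e0; have [eta eta0 he] := open_within_dist ch zI e0.
  move: (zI); rewrite in_itv/= => /andP[az zb].
  exists (Num.min eta (b - z)); first by rewrite lt_min eta0 subr_gt0.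
  move=> x /andP[zx]; rewrite -ltrBlDl lt_min => /andP[h1 h2].
  rewrite /H !ind_in ?mul1r//; last by rewrite in_itv/=; apply/andP; split; lra.
  by apply: he; rewrite distrC gtr0_norm ?subr_gt0.
(* Half the distance to b, so that the transition of the smoothed indicator beyond d stays inside
   (a, b). *)
pose eta := (b - d) / 2.
have eta0 : 0 < eta by rewrite divr_gt0// subr_gt0.
pose dl (n : nat) := eta / n.+1%:R.
have dl0 n : 0 < dl n by rewrite divr_gt0.
have dleta n : dl n <= eta by rewrite ler_pdivrMr// ler_peMr ?(ltW eta0)// ler1n.
have dlb n : d + dl n < b by have := dleta n; rewrite /eta; lra.
pose phi n x := stepd (dl n) c x - stepd (dl n) d x.
have tphi n : test_function a b (phi n) by exact: step_test_function.
have dphi n x : derive1 (phi n) x = kernd (dl n) c x - kernd (dl n) d x.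
  by apply: is_derive_derive1; apply: is_derive1_sub; exact: is_derive_stepd.
have dl_small e : 0 < e -> \forall n \near \oo, dl n <= e.
  move=> e0; have ee : 0 < e / eta by rewrite divr_gt0.
  near=> n; rewrite /dl mulrC -ler_pdivlMr//; apply: ltW.
  by near: n; exact: (near_infty_natSinv_lt (PosNum ee)).
have B : (fun n => \int[mu]_(x in `]a, b[) (h x * derive1 (phi n) x)) @ \oo --> h c - h d.
  have -> : h c - h d = H c - H d by rewrite /H !ind_in// !mul1r.
  apply/cvgrPdist_le => e e0; have e20 : 0 < e / 2 by rewrite divr_gt0.
  have [e1 e10 h1] := Hclose c _ cI e20.
  have [e2 e20' h2] := Hclose d _ dI e20.
  near=> n.
  have hc x : c < x < c + dl n -> `|H x - H c| <= e / 2.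
    move=> /andP[cx xc]; apply: h1; rewrite cx/= (lt_le_trans xc)// lerD2l.
    by near: n; exact: dl_small.
  have hd x : d < x < d + dl n -> `|H x - H d| <= e / 2.
    move=> /andP[cx xc]; apply: h2; rewrite cx/= (lt_le_trans xc)// lerD2l.
    by near: n; exact: dl_small.
  have -> : \int[mu]_(x in `]a, b[) (h x * derive1 (phi n) x) =
      \int[mu]_x (H x * kernd (dl n) c x) - \int[mu]_x (H x * kernd (dl n) d x).
    rewrite -Rint_ind -RintegralB//;
      [|exact: (itg_mul_kernd (dl0 n) mH hc)|exact: (itg_mul_kernd (dl0 n) mH hd)].
    by apply: eq_Rintegral => x _; rewrite dphi /H; ring.
  have m1 := kernd_mean (dl0 n) mH hc; have m2 := kernd_mean (dl0 n) mH hd.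
  rewrite distrC.
  rewrite [X in `|X|](_ : _ = (\int[mu]_x (H x * kernd (dl n) c x) - H c) -
    (\int[mu]_x (H x * kernd (dl n) d x) - H d)); last by ring.
  apply: le_trans (ler_normB _ _) _; lra.
have A : (fun n => \int[mu]_(x in `]a, b[) (q x * phi n x)) @ \oo -->
    \int[mu]_x (\1_`]c, d] x * q x).
  have := Rint_dominated_cvg (mu := mu) (f_ := fun n x => \1_`]a, b[ x * q x * phi n x)
    (f := fun x => \1_`]c, d] x * q x) (g := fun x => `|\1_`]a, b[ x * q x|).
  rewrite (_ : (fun n => \int[mu]_(x in `]a, b[) (q x * phi n x)) =
    fun n => \int[mu]_x (\1_`]a, b[ x * q x * phi n x)); last first.
    apply/funext => n; rewrite -Rint_ind; apply: eq_Rintegral => x _; exact: mulrA.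
  apply.
  - move=> n; apply: measurable_funM; first exact: itg_measurable iq.
    by apply: continuous_measurable_fun; apply: smooth_continuous; case: (tphi n).
  - exact: itg_abs.
  - move=> n x; rewrite normrM ler_piMr//.
    have := step_ge0 ((dl n)^-1 * x + - ((dl n)^-1 * c)).
    have := step_ge0 ((dl n)^-1 * x + - ((dl n)^-1 * d)).
    have := step_le1 ((dl n)^-1 * x + - ((dl n)^-1 * c)).
    have := step_le1 ((dl n)^-1 * x + - ((dl n)^-1 * d)).
    rewrite /phi /stepd !mul1r => ? ? ? ?; rewrite ler_norml; apply/andP; split; lra.
  - move=> x.
    have [xc|cx] := leP x c.
      rewrite (@ind_notin _ `]c, d]) ?mul0r; last by rewrite in_itv/= ltNge xc.
      apply: cvg_near_cst; apply: nearW => n.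
      by rewrite /phi (stepd_le (dl0 n) xc) (stepd_le (dl0 n) (le_trans xc cd)) subrr mulr0.
    have [xd|dx] := leP x d.
      have xI : x \in `]a, b[ by rewrite in_itv/= (lt_trans ac cx) (le_lt_trans xd db).
      rewrite (@ind_in _ `]c, d]) ?mul1r; last by rewrite in_itv/= cx.
      apply: cvg_near_cst; near=> n.
      rewrite ind_in// mul1r /phi (stepd_le (dl0 n) xd) stepd_ge// ?subr0 ?mulr1//.
      rewrite -lerBrDl; near: n; apply: dl_small; by rewrite subr_gt0.
    rewrite (@ind_notin _ `]c, d]) ?mul0r; last by rewrite in_itv/= cx/= -ltNge.
    apply: cvg_near_cst; near=> n.
    have dd : d + dl n <= x.
      by rewrite -lerBrDl; near: n; apply: dl_small; rewrite subr_gt0.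
    rewrite /phi (stepd_ge (dl0 n) dd) stepd_ge ?subrr ?mulr0//.
    by apply: le_trans dd; rewrite lerD2r.
have E : h c - h d = - \int[mu]_x (\1_`]c, d] x * q x).
  rewrite -(cvg_lim _ B)// -(cvg_lim _ (cvgN A))//; congr (lim (_ @ \oo)).
  by apply/funext => n; exact: hq.
rewrite -[LHS]opprB E opprK; apply: Rint_ae.
- have := itg_ind `]c, d] iq; move/itg_measurable; congr measurable_fun.
  apply/funext => x; have [xI|xI] := boolP (x \in `]c, d]); last by rewrite (ind_notin xI) !mul0r.
  rewrite (ind_in xI) !mul1r ind_in ?mul1r//; move: xI; rewrite !in_itv/= => /andP[h1 h2].
  by rewrite (lt_trans ac h1) (le_lt_trans h2 db).
- have := itg_ind `]c, d[ iq; move/itg_measurable; congr measurable_fun.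
  apply/funext => x; have [xI|xI] := boolP (x \in `]c, d[); last by rewrite (ind_notin xI) !mul0r.
  rewrite (ind_in xI) !mul1r ind_in ?mul1r//; move: xI; rewrite !in_itv/= => /andP[h1 h2].
  by rewrite (lt_trans ac h1) (lt_trans h2 db).
- apply: ae_imp (ae_neq d) => x xd; congr (_ * _).
  have [xI|xI] := boolP (x \in `]c, d[); last first.
    rewrite !ind_notin//; apply: contra xI; rewrite !in_itv/= => /andP[-> /=].
    by rewrite le_eqVlt (negbTE xd).
  by rewrite !ind_in//; move: xI; rewrite !in_itv/= => /andP[-> /ltW].
Unshelve. all: by end_near. Qed.

End DuBoisReymond.

Section SourceVanishes.
Context (R : realType).
Local Notation mu := (@lebesgue_measure R).

Lemma test_function_near0 (a b : R) (phi : R -> R) (x : R) :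
  test_function a b phi -> x \notin `]a, b[ -> \near x, phi x = 0.
Proof.
move=> [_ sphi] xI.
have : nbhs x (~` closure [set x | phi x != 0]).
  apply: open_nbhs_nbhs; split; first exact/closed_openC/closed_closure.
  by move=> /sphi /= h; move: xI; rewrite h.
apply: filterS => y /= hy; apply/eqP/negP => /negP py.
by apply: hy; exact: subset_closure.
Qed.

Lemma test_function_out (a b : R) (phi : R -> R) (x : R) :
  test_function a b phi -> x \notin `]a, b[ -> phi x = 0 /\ derive1 phi x = 0.
Proof.
move=> tphi xI; have n0 := test_function_near0 tphi xI; split.
  exact: (nbhs_singleton n0).
apply: is_derive_derive1.
apply: (@near_eq_is_derive _ _ _ (fun=> 0 : R) _ x 1 0 _ (is_derive1_const 0 x)).
by apply: filterS n0.
Qed.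

Lemma test_smooth (a b : R) (phi : R -> R) : test_function a b phi -> smooth phi.
Proof. by case. Qed.

Lemma smooth_derive1n n (phi : R -> R) : smooth phi -> smooth (derive1n n phi).
Proof.
move=> sphi; elim: n => [//|n ih]; rewrite derive1nS; exact: smooth_derive1.
Qed.

Lemma bddm_ind_continuous (a b : R) (g : R -> R) : continuous g ->
  bddm (fun x => \1_`]a, b[ x * g x).
Proof.
move=> cg; split.
  by apply: measurable_funM; [exact: measurable_ind|exact: continuous_measurable_fun].
have [ab|ba] := leP a b; last first.
  exists 0 => x; rewrite ind_notin ?mul0r ?normr0// in_itv/=.
  by apply/negP => /andP[h1 h2]; move: ba; rewrite ltNge (ltW (lt_trans h1 h2)).
have cc : {within `[a, b], continuous (fun r => `|g r|)}.
  by apply: continuous_subspaceT => r; apply: cvg_norm; exact: cg.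
have [c _ cM] := EVT_max ab cc.
exists `|g c| => x; have [xI|xI] := boolP (x \in `]a, b[); last first.
  by rewrite ind_notin// mul0r normr0.
rewrite ind_in// mul1r; apply: cM; move: xI; rewrite !in_itv/= => /andP[h1 h2].
by rewrite !ltW.
Qed.

(** Integration by parts; phi and its derivative vanish at b. Thus every test function is a double
    primitive from b, and pairings with such primitives detect f. *)
Lemma volt_derive2 (a b : R) (phi : R -> R) x : test_function a b phi ->
  volt a b (fun r => r) (fun x => \1_`]a, b[ x * derive1n 2 phi x) x =
  \1_`]a, b[ x * phi x.
Proof.
move=> tphi; have [xI|xI] := boolP (x \in `]a, b[); last first.
  by rewrite volt_out// ind_notin ?mul0r.
have [ax xb] : a < x /\ x < b by apply/andP; move: xI; rewrite in_itv.
have sphi := test_smooth tphi.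
rewrite volt_in// ind_in// mul1r.
have d1 (z : R) : is_derive z 1 (fun z => z - x) (1 - 0).
  exact: (is_derive1_sub (is_derive1_id z) (is_derive1_const x z)).
have dF (z : R) : is_derive z 1 (fun z => (z - x) * derive1 phi z - phi z)
    ((z - x) * derive1n 2 phi z).
  have := is_derive1_sub (is_derive1_mul (d1 z)
    (smooth_is_derive z (smooth_derive1 sphi))) (smooth_is_derive z sphi).
  by move/is_derive1_eq; apply => /=; ring.
have cF : continuous (fun z => (z - x) * derive1n 2 phi z).
  move=> z; apply: cvgM; first exact: is_derive1_continuous (d1 z).
  exact: smooth_continuous (@smooth_derive1n 2 _ sphi) z.
have bI : b \notin `]a, b[ by rewrite in_itv/= ltxx andbF.
have [pb dpb] := test_function_out tphi bI.
transitivity (\int[mu]_xi (\1_`]x, b[ xi * ((xi - x) * derive1n 2 phi xi))).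
  apply: eq_Rintegral => xi _; have [xiI|xiI] := boolP (xi \in `]x, b[); last first.
    by rewrite ind_notin// !mul0r.
  rewrite (@ind_in _ `]a, b[) ?mul1r//; move: xiI; rewrite !in_itv/= => /andP[h1 h2].
  by rewrite (lt_trans ax h1).
by rewrite (Rint_ind_FTC (ltW xb) dF cF) pb dpb; ring.
Qed.

(** The primitive of f is constant on (a, b), and by Lebesgue differentiation its derivative is f
    almost everywhere. *)
Lemma ae_eq0_of_integrals (a b : R) (f : R -> R) : itg mu f ->
  (forall c d, a < c -> c <= d -> d < b -> \int[mu]_x (\1_`]c, d[ x * f x) = 0) ->
  {ae mu, forall x, x \in `]a, b[ -> f x = 0}.
Proof.
move=> fi f0.
have ifi (i : interval R) : mu.-integrable [set` i] (EFin \o f).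
  by apply/itg_ind_itv; exact: itg_ind.
have locf : locally_integrable [set: R] f by apply: open_integrable_locally => //; exact: openT.
have := FTC1Ny (fun y => ifi _) locf.
apply: ae_imp => x [dF FE]; rewrite in_itv/= => /andP[ax xb].
rewrite -FE; apply: is_derive_derive1.
set F := fun x : R => _.
have F0 c d : a < c -> c <= d -> d < b -> F d = F c.
  move=> ac cd db; apply/eqP; rewrite -subr_eq0; apply/eqP.
  rewrite /F Rintegral_itvB//.
  rewrite -[RHS](f0 c d ac cd db) -Rint_ind; apply: Rint_ae.
  - exact: itg_measurable (itg_ind `]c, d] fi).
  - exact: itg_measurable (itg_ind `]c, d[ fi).
  - apply: ae_imp (ae_neq d) => z zd; congr (_ * _).
    have [zI|zI] := boolP (z \in `]c, d[); last first.
      rewrite !ind_notin//; apply: contra zI; rewrite !in_itv/= => /andP[-> /=].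
      by rewrite le_eqVlt (negbTE zd).
    by rewrite !ind_in//; move: zI; rewrite !in_itv/= => /andP[-> /ltW].
apply: (@near_eq_is_derive _ _ _ (fun=> F x : R) _ x 1 0 _ (is_derive1_const (F x) x)).
near=> y.
have ay : a < y by near: y; exact: lt_nbhsr.
have yb : y < b by near: y; exact: lt_nbhsl.
by have [xy|/ltW yx] := leP x y; [rewrite (F0 x y)|rewrite (F0 y x)].
Unshelve. all: by end_near. Qed.

(** Applied to the second derivative of a test function, [mikusinski_source] says that f is
    orthogonal to the test function. Then [dubois] with h = 0 yields that the integrals of f over
    subintervals vanish. *)
Lemma source_zero (a b : R) (p f : R -> R) (C T0 l0 : R) (K : nat) : a < b ->
  bddm p -> itg mu f -> 0 <= C -> 0 < T0 -> source_bound a b p f C K T0 l0 ->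
  {ae mu, forall x, x \in `]a, b[ -> f x = 0}.
Proof.
move=> ab bp fi C0 T00 HS.
apply: ae_eq0_of_integrals => // c d ac cd db.
have := @dubois R a b (fun=> 0) f _ (itg_ind _ fi) _ c d ac cd db.
rewrite subrr => H; apply/esym/H.
  by apply: continuous_subspaceT => x; exact: cvg_cst.
move=> phi tphi.
have bg : bddm (fun x => \1_`]a, b[ x * derive1n 2 phi x).
  apply: bddm_ind_continuous.
  exact: smooth_continuous (@smooth_derive1n 2 _ (test_smooth tphi)).
have := mikusinski_source ab bp fi C0 T00 HS bg.
under eq_Rintegral do rewrite volt_derive2// -mulrA.
rewrite Rint_ind => E.
under eq_Rintegral do rewrite mul0r.
under [in RHS]eq_Rintegral do rewrite mulrC.
by rewrite E oppr0 /Rintegral integral0.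
Qed.

End SourceVanishes.

(** * Representatives of elements of Lebesgue spaces *)

Section LebesgueClasses.
Context d (T : measurableType d) (R : realType) (mu : {measure set T -> \bar R}).

(** On a set of finite measure |u| <= 1 + u^2 is integrable. *)
Lemma Lfun2_itg (u : T -> R) (A : set T) : measurable A -> (mu A < +oo)%E ->
  u \_ A \in Lfun mu 2%:E -> itg mu (u \_ A).
Proof.
move=> mA Afin uL.
have iu2 := Lfun2_integrable_sqr uL.
have mu_ : measurable_fun setT (u \_ A).
  by move: uL; rewrite inE => /andP[]; rewrite inE.
have iA : itg mu (\1_A : T -> R).
  apply/integrableP; split; first exact/measurable_EFinP/measurable_indic.
  rewrite (eq_integral (fun x => (\1_A x)%:E)); last first.
    by move=> x _ /=; rewrite ger0_norm// indicE.
  by rewrite integral_indic// setIT.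
apply: (itg_le mu_ _ (itgD iA iu2)) => x.
rewrite /patch indicE; case: ifPn => _; last by rewrite normr0 expr0n/= addr0.
rewrite -real_normK ?num_real//; have := sqr_ge0 (`|u x| - 1).
by have := normr_ge0 (u x); rewrite /=; move: (`|u x|) => v; nra.
Qed.

(** Truncating u at an essential bound yields a representative that is bounded at every point. *)
Lemma Lfunoo_bounded_ae (u : T -> R) : (0 < mu setT)%E -> u \in Lfun mu +oo%E ->
  exists2 v : T -> R, measurable_fun setT v /\ (exists M, forall x, `|v x| <= M) &
    {ae mu, forall x, u x = v x}.
Proof.
move=> mu0; rewrite inE => /andP[]; rewrite inE /= => mu_; rewrite inE /finite_norm => Nu.
have [M HM] : exists M : R, {ae mu, forall x, `|u x| <= M}.
  move: Nu; rewrite unlock/= mu0 => /ess_supr_bounded [M HM].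
  by exists M; exact: HM.
have M0 : exists2 M', 0 <= M' & {ae mu, forall x, `|u x| <= M'}.
  by exists `|M| => //; apply: ae_imp HM => x h; apply: le_trans h (ler_norm _).
case: M0 => M' M'0 HM'.
exists (fun x => Num.max (- M') (Num.min M' (u x))).
  split.
    apply: measurable_maxr; first exact: measurable_cst.
    by apply: measurable_minr; first exact: measurable_cst.
  exists M' => x; rewrite ler_norml le_max lexx/= ge_max ge_min lexx/= andbT.
  by rewrite lerNl (le_trans _ M'0)// oppr_le0.
apply: ae_imp HM' => x; rewrite ler_norml => /andP[h1 h2].
by rewrite (min_idPr h2) (max_idPr h1).
Qed.

End LebesgueClasses.

Section Representatives.
Context (R : realType).
Local Notation mu := (@lebesgue_measure R).

Lemma patch_ind (i : interval R) (u : R -> R) :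
  u \_ [set` i] = fun x => \1_[set` i] x * u x.
Proof.
by apply/funext => x; rewrite /patch indicE; case: (x \in _); rewrite ?mul1r ?mul0r.
Qed.

Lemma L2_itg (a b : R) (u : R -> R) : L2 a b u -> itg mu (fun x => \1_`]a, b[ x * u x).
Proof.
move=> uL; rewrite -patch_ind; apply: Lfun2_itg => //.
rewrite /= lebesgue_measure_itv/=; case: ifP => _; exact: ltry.
Qed.

Lemma Linfty_bddm (a b : R) (u : R -> R) : Linfty a b u ->
  exists2 v, bddm v & {ae mu, forall x, x \in `]a, b[ -> u x = v x}.
Proof.
move=> uL; have mu0 : (0 < mu setT)%E.
  apply: (@lt_le_trans _ _ (mu `]0%R, 1%R[%classic)).
    by rewrite lebesgue_measure_itv/= lte_fin ltr01 oppr0 adde0 lte_fin.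
  by apply: le_measure; rewrite ?inE//; exact: measurable_itv.
have [v bv E] := Lfunoo_bounded_ae mu0 uL.
exists v => //; apply: ae_imp E => x E xI.
by rewrite -E patch_ind ind_in// mul1r.
Qed.

Definition rect (T : R) (u : R * R -> R) (z : R * R) : R :=
  \1_`]0, 1[ z.1 * (\1_`]0, T[ z.2 * u z).

Lemma rectE T u x t : 0 < x < 1 -> 0 < t < T -> rect T u (x, t) = u (x, t).
Proof. by move=> xI tI; rewrite /rect/= !ind_in ?mul1r// in_itv. Qed.

Lemma rect_out1 T u x t : x \notin `]0, 1[ -> rect T u (x, t) = 0.
Proof. by move=> xI; rewrite /rect/= ind_notin// mul0r. Qed.

Lemma rect_out2 T u x t : t \notin `]0, T[ -> rect T u (x, t) = 0.
Proof. by move=> xI; rewrite /rect/= (@ind_notin _ `]0, T[)// mul0r mulr0. Qed.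

Lemma L2L2_itg (T : R) (u : R * R -> R) : L2L2 T u -> itg (mu \x mu)%E (rect T u).
Proof.
move=> uL.
have -> : rect T u = u \_ (`]0, 1[ `*` `]0, T[).
  apply/funext => -[x t]; rewrite /rect /patch/=; case: ifPn => [/set_mem|/negP] h.
    by case: h => /= h1 h2; rewrite !ind_in ?mul1r.
  have [h1|h1] := boolP (x \in `]0, 1[); last by rewrite ind_notin ?mul0r.
  have [h2|h2] := boolP (t \in `]0, T[); last by rewrite (ind_notin h2) mul0r mulr0.
  by exfalso; apply: h; apply: mem_set.
apply: Lfun2_itg => //.
  by apply: measurableX; exact: measurable_itv.
have := product_measure1E mu mu (measurable_itv `]0%R, 1%R[) (measurable_itv `]0%R, T[).
move=> /= ->; rewrite !lebesgue_measure_itv/= lte_fin ltr01 oppr0 adde0 mul1e.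
by case: ifP => _; exact: ltry.
Qed.

End Representatives.

(** * Duality between the Cauchy problems at the two ends of an interval *)

Section Adjoint.
Context (R : realType).
Local Notation mu := (@lebesgue_measure R).

Lemma vkernel1 (a b : R) : a < b -> vkernel a b (fun=> 1).
Proof. by move=> ab; apply: vkernel_continuous => // x; exact: cvg_cst. Qed.

(** The adjoint of the primitive from a is the primitive from b: Fubini on the triangle a < z < x <
    b. *)
Lemma volt_adjoint (a b : R) (H q g : R -> R) : a < b ->
  itg mu (fun x => \1_`]a, b[ x * q x) -> bddm g ->
  (forall x, x \in `]a, b[ -> H x = \int[mu]_z (\1_`]a, x[ z * q z)) ->
  \int[mu]_x (\1_`]a, b[ x * (H x * g x)) =
  \int[mu]_x (\1_`]a, b[ x * (q x * volt a b (fun=> 1) g x)).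
Proof.
move=> ab iq bg HE.
have ig := itg_ind_bddm a b bg.
have mJ : measurable_fun setT (fun z : measurableTypeR R * measurableTypeR R =>
    \1_`]0, b - a[ (z.2 - z.1) : R).
  by apply: (measurableT_comp (measurable_ind _)); exact: measurable_funB.
have iF := itg_mulb (itg2_tensor iq ig) mJ (fun z => ind_bound _ _).
have E := Rfubini iF.
transitivity (\int[mu]_y \int[mu]_x
   (\1_`]0, b - a[ (y - x) * (\1_`]a, b[ x * q x * (\1_`]a, b[ y * g y)))).
  apply: eq_Rintegral => x _; have [xI|xI] := boolP (x \in `]a, b[); last first.
    rewrite ind_notin// mul0r.
    under eq_Rintegral do rewrite mul0r !mulr0.
    by rewrite /Rintegral integral0.
  rewrite ind_in// !mul1r HE// mulrC.
  rewrite -RintegralZl//; last first.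
    have := itg_ind `]a, x[ iq; congr itg; apply/funext => z.
    have [zI|zI] := boolP (z \in `]a, x[); last by rewrite (ind_notin zI) !mul0r.
    rewrite (ind_in zI) !mul1r ind_in ?mul1r//.
    by move: xI zI; rewrite !in_itv/= => /andP[_ h1] /andP[-> h2]; exact: lt_trans h1.
  apply: eq_Rintegral => z _; move: xI; rewrite in_itv/= => /andP[ax xb].
  have [zI|zI] := boolP (z \in `]a, x[).
    move: (zI); rewrite in_itv/= => /andP[az zx].
    rewrite (ind_in zI) (@ind_in _ `]0, b - a[) ?(@ind_in _ `]a, b[) ?in_itv/=.
    - by ring.
    - by rewrite az (lt_trans zx).
    - by apply/andP; split; lra.
  rewrite (ind_notin zI) mul0r mulr0.
  have [za|az] := leP z a.
    by rewrite (@ind_notin _ `]a, b[) ?mul0r ?mulr0// in_itv/= ltNge za.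
  rewrite ind_notin ?mul0r// in_itv/= subr_gt0; apply/negP => /andP[zx _].
  by move: zI; rewrite in_itv/= az zx.
rewrite -E; apply: eq_Rintegral => x _; have [xI|xI] := boolP (x \in `]a, b[); last first.
  rewrite ind_notin// !mul0r.
  under eq_Rintegral do rewrite /= !mul0r mulr0.
  by rewrite /Rintegral integral0.
rewrite ind_in// mul1r volt_in// -RintegralZl//; last exact: itg_volt_in (vkernel1 ab) bg xI.
apply: eq_Rintegral => z _; move: (xI); rewrite in_itv/= => /andP[ax xb].
have [zI|zI] := boolP (z \in `]x, b[).
  move: (zI); rewrite in_itv/= => /andP[xz zb].
  rewrite (ind_in zI) (@ind_in _ `]0, b - a[) ?(@ind_in _ `]a, b[) ?in_itv/=.
  - by ring.
  - by rewrite zb (lt_trans ax).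
  - by apply/andP; split; lra.
rewrite (ind_notin zI) mul0r mulr0.
have [zx|xz] := leP z x.
  by rewrite ind_notin ?mul0r// in_itv/= subr_gt0 ltNge zx.
rewrite (@ind_notin _ `]a, b[ z) ?mul0r ?mulr0// in_itv/=; apply/negP => /andP[_ zb].
by move: zI; rewrite in_itv/= xz zb.
Qed.

(** This is [volt_adjoint] on (x, b) with q = 1, whose primitive from x is z - x. *)
Lemma volt_twice (a b : R) (g : R -> R) x : a < b -> bddm g ->
  volt a b (fun=> 1) (volt a b (fun=> 1) g) x = volt a b (fun r => r) g x.
Proof.
move=> ab bg; have [xI|xI] := boolP (x \in `]a, b[); last by rewrite !volt_out.
have [ax xb] : a < x /\ x < b by apply/andP; move: xI; rewrite in_itv.
rewrite !volt_in//.
have E : forall z, z \in `]x, b[ -> z - x = \int[mu]_w (\1_`]x, z[ w * 1).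
  move=> z; rewrite in_itv/= => /andP[xz _].
  have dF (y : R) : is_derive y 1 (fun y => y : R) 1 by exact: (is_derive1_id y).
  have cF : continuous (fun _ : R => 1 : R) by move=> y; exact: cvg_cst.
  by rewrite (Rint_ind_FTC (ltW xz) dF cF).
have := volt_adjoint xb (itg_ind_bddm x b (bddm_cst 1)) bg E => ->.
apply: eq_Rintegral => xi _; have [xiI|xiI] := boolP (xi \in `]x, b[); last first.
  by rewrite ind_notin// !mul0r.
congr (_ * (_ * _)); rewrite !volt_in//.
by move: xiI; rewrite !in_itv/= => /andP[h1 ->]; rewrite (lt_trans ax).
Qed.

(** Zero Cauchy data at a make Y the double primitive of Q from a; [volt_adjoint] is used once for
    each primitive. The continuous representatives h0 and h1 satisfy the integral formulas at every
    point, Y and v only almost everywhere. *)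
Lemma cauchy_adjoint (a b : R) (Y h0 v h1 Q g : R -> R) : a < b ->
  measurable_fun setT Y ->
  itg mu (fun x => \1_`]a, b[ x * v x) -> itg mu (fun x => \1_`]a, b[ x * Q x) ->
  measurable_fun setT (fun x => \1_`]a, b[ x * h0 x) ->
  measurable_fun setT (fun x => \1_`]a, b[ x * h1 x) ->
  {ae mu, forall x, x \in `]a, b[ -> Y x = h0 x} ->
  {ae mu, forall x, x \in `]a, b[ -> v x = h1 x} ->
  (forall x, x \in `]a, b[ -> h0 x = \int[mu]_z (\1_`]a, x[ z * v z)) ->
  (forall x, x \in `]a, b[ -> h1 x = \int[mu]_z (\1_`]a, x[ z * Q z)) ->
  bddm g ->
  \int[mu]_x (\1_`]a, b[ x * (Y x * g x)) =
  \int[mu]_x (Q x * volt a b (fun r => r) g x).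
Proof.
move=> ab mY iv iQ mh0 mh1 Yh vh h0E h1E bg.
have bV := bddm_volt ab (vkernel1 ab) bg.
transitivity (\int[mu]_x (\1_`]a, b[ x * (h0 x * g x))).
  apply: Rint_ae.
  - apply: measurable_funM; first exact: measurable_ind.
    by apply: measurable_funM => //; exact: bg.1.
  - under eq_fun do rewrite mulrA.
    by apply: measurable_funM => //; exact: bg.1.
  - apply: ae_imp Yh => x E; have [xI|xI] := boolP (x \in `]a, b[).
      by rewrite E.
    by rewrite !ind_notin ?mul0r.
rewrite (volt_adjoint ab iv bg h0E).
transitivity (\int[mu]_x (\1_`]a, b[ x * (h1 x * volt a b (fun=> 1) g x))).
  apply: Rint_ae.
  - under eq_fun do rewrite mulrA.
    by apply: measurable_funM; [exact: itg_measurable iv|exact: bV.1].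
  - under eq_fun do rewrite mulrA.
    by apply: measurable_funM => //; exact: bV.1.
  - apply: ae_imp vh => x E; have [xI|xI] := boolP (x \in `]a, b[).
      by rewrite E.
    by rewrite !ind_notin ?mul0r.
rewrite (volt_adjoint ab iQ bV h1E).
apply: eq_Rintegral => x _; rewrite volt_twice//.
have [xI|xI] := boolP (x \in `]a, b[); first by rewrite ind_in ?mul1r.
by rewrite volt_out// !mulr0.
Qed.

End Adjoint.

(** * Fractional integration in time of functions of space and time *)

Section TimeIntegral.
Context (R : realType) (alpha T : R).
Hypothesis alpha_gt0 : 0 < alpha.
Local Notation mu := (@lebesgue_measure R).
Local Notation nu := (mu \x mu)%E.
Local Notation rlk := (rlk alpha).
Local Notation rl_int := (rl_int alpha).
Implicit Types (h : R -> R) (u : R * R -> R).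

Definition slice_pair h u (tau : R) : R := \int[mu]_x (h x * u (x, tau)).

Definition time_int u (t x : R) : R := rl_int (fun tau => u (x, tau)) t.

(** Serves to apply Fubini's theorem on the product of the time line with the plane of the pairs (x,
    tau). *)
Lemma lebesgue2_sigma_finite : sigma_finite setT nu.
Proof.
have /sigma_finiteP[F [TF ndF Foo]] := @sigma_finiteT _ _ _ mu.
exists (fun n => F n `*` F n).
  rewrite -setXTT TF predeqE => -[x y]; split.
    move=> [/= [n _ Fnx] [k _ Gky]]; exists (maxn n k) => //; split.
    - by move: x Fnx; exact/subsetPset/ndF/leq_maxl.
    - by move: y Gky; exact/subsetPset/ndF/leq_maxr.
  by move=> [n _ []/= ? ?]; split; exists n.
move=> k; have [? ?] := Foo k.
split; first exact: measurableX.
by rewrite product_measure1E// lte_mul_pinfty// ge0_fin_numE.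
Qed.

(** Joint integrability in (x, tau) at a fixed time t is what permits every later exchange of
    pairing in x and J^alpha at that time; it comes from Fubini in (t, (x, tau)). *)
Lemma ae_itg_rl2 u : itg nu u -> (forall x t, ~ (0 < t < T) -> u (x, t) = 0) ->
  {ae mu, forall t, 0 < t < T -> itg nu (fun z => rlk (t - z.2) * u z)}.
Proof.
move=> iu uT.
pose sf := Measure_isSigmaFinite.Build _ _ _ nu lebesgue2_sigma_finite.
pose nu' : {sigma_finite_measure set _ -> \bar R} := HB.pack nu sf.
have iF : itg (mu \x nu')%E
    (fun z => \1_`]0, T[ (z.1 - z.2.2) * rlk (z.1 - z.2.2) * u z.2).
  apply: (@itg2_shear _ _ _ nu' _ u snd (itg_rlk_trunc alpha_gt0 T)).
    exact: iu.
  exact: measurable_snd.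
move: iF => /itg2_ae1.
apply: ae_imp => t /= + /andP[_ tT].
congr itg; apply/funext => -[x tau] /=.
by rewrite (@rl_trunc R alpha T (fun tau => u (x, tau)) _ _ _ tT)// => s; exact: uT.
Qed.

Lemma itg_slice_mul h u : bddm h -> itg nu u -> itg nu (fun z => h z.1 * u z).
Proof.
move=> [mh [M hM]] iu; apply: (itg_mulb iu (M := M)) => [|z]; last exact: hM.
exact: measurableT_comp mh measurable_fst.
Qed.

Lemma itg_slice_pair h u : bddm h -> itg nu u -> itg mu (slice_pair h u).
Proof. by move=> bh iu; exact: (itg2_int2 (itg_slice_mul bh iu)). Qed.

Lemma Rint_abs_slice_pair h u M : bddm h -> itg nu u -> (forall x, `|h x| <= M) ->
  \int[mu]_t `|slice_pair h u t| <= M * \int[nu]_z `|u z|.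
Proof.
move=> bh iu hM; have iau := itg_abs iu.
rewrite -(Rfubini1 iau) (Rfubini iau) -RintegralZl//; last exact: itg2_int2 iau.
apply: Rint_le_ae.
- exact/itg_abs/itg_slice_pair.
- apply: itgZ; exact: itg2_int2 iau.
apply: ae_imp2 (itg2_ae2 iu) (itg2_ae2 iau) => t it iat.
rewrite -RintegralZl//; apply: Rint_absle.
- exact: measurable_funM bh.1 (itg_measurable it).
- by move=> x; rewrite normrM ler_wpM2r.
- exact: itgZ.
Qed.

Section FixedTime.
Variables (t : R) (u : R * R -> R).
Hypothesis iut : itg nu (fun z => rlk (t - z.2) * u z).

Lemma itg_time_int : itg mu (time_int u t).
Proof. exact: itg2_int1 iut. Qed.

Lemma itg_rlk_slice_pair h : bddm h -> itg nu u ->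
  itg mu (fun tau => rlk (t - tau) * slice_pair h u tau).
Proof.
move=> bh iu; have iF := itg_slice_mul bh iut.
apply: itg_ae (itg2_int2 iF).
  apply: measurable_funM; last exact: itg_measurable (itg_slice_pair bh iu).
  by apply: (measurableT_comp (@measurable_rlk R alpha)); exact: measurable_funB.
apply: ae_imp (itg2_ae2 (itg_slice_mul bh iu)) => tau it /=.
rewrite /slice_pair -RintegralZl//.
by apply: eq_Rintegral => x _; ring.
Qed.

Lemma time_int_pair h : bddm h -> itg nu u ->
  \int[mu]_x (h x * time_int u t x) = rl_int (slice_pair h u) t.
Proof.
move=> bh iu; have iF := itg_slice_mul bh iut.
transitivity (\int[mu]_x \int[mu]_tau (h x * (rlk (t - tau) * u (x, tau)))).
  apply: Rint_ae.
  - exact: measurable_funM bh.1 (itg_measurable itg_time_int).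
  - exact: itg_measurable (itg2_int1 iF).
  - apply: ae_imp (itg2_ae1 iut) => x ix; by rewrite /time_int /rl_int -RintegralZl.
rewrite (Rfubini iF); apply: Rint_ae.
- exact: itg_measurable (itg2_int2 iF).
- exact: itg_measurable (itg_rlk_slice_pair bh iu).
apply: ae_imp (itg2_ae2 (itg_slice_mul bh iu)) => tau it.
rewrite /slice_pair -RintegralZl//.
by apply: eq_Rintegral => x _; ring.
Qed.

End FixedTime.

Lemma slice_pair_supp h u : (forall x t, ~ (0 < t < T) -> u (x, t) = 0) ->
  supp0T T (slice_pair h u).
Proof.
move=> uT t tT; rewrite /slice_pair; under eq_Rintegral do rewrite uT// mulr0.
by rewrite /Rintegral integral0.
Qed.

Lemma rect_supp u x t : ~ (0 < t < T) -> rect T u (x, t) = 0.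
Proof. by move=> tT; rewrite rect_out2// in_itv/=; exact/negP. Qed.

Lemma Jop_rect u x t : 0 < x < 1 -> 0 < t < T ->
  Jop alpha u (x, t) = (Gamma alpha)^-1 * time_int (rect T u) t x.
Proof.
move=> xI /andP[t0 tT]; rewrite /Jop /riemann_liouville /=; congr (_ * _).
rewrite -Rint_ind; apply: eq_Rintegral => tau _.
have [tI|tI] := boolP (tau \in `]0, t[).
  move: (tI); rewrite in_itv/= => /andP[h1 h2].
  rewrite (ind_in tI) mul1r rectE// ?h1 ?(lt_trans h2)//.
  by rewrite rlkE ?subr_gt0.
rewrite (ind_notin tI) mul0r; move: tI; rewrite in_itv/= negb_and -!leNgt => /orP[h|h].
  by rewrite rect_supp ?mulr0// => /andP[]; rewrite ltNge h.
by rewrite rlk_eq0 ?mul0r// subr_le0.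
Qed.

End TimeIntegral.

(** * Test functions as elements of H^1_0 and the equation tested against them *)

Section TestFunctions.
Context (R : realType) (a b : R).
Hypothesis ab : a < b.
Local Notation mu := (@lebesgue_measure R).

Lemma test_function_bddm phi : test_function a b phi -> bddm phi.
Proof.
move=> tphi; have := bddm_ind_continuous a b (smooth_continuous (test_smooth tphi)).
congr bddm; apply/funext => x; have [xI|xI] := boolP (x \in `]a, b[).
  by rewrite ind_in ?mul1r.
by rewrite ind_notin ?mul0r// (test_function_out tphi xI).1.
Qed.

Lemma test_function_derive1 phi : test_function a b phi -> test_function a b (derive1 phi).
Proof.
move=> tphi; split; first exact: smooth_derive1 (test_smooth tphi).
apply: subset_trans tphi.2; rewrite [X in _ `<=` X]((closure_id _).1 (@closed_closure _ _)).
apply: closure_subset => x /= dx; apply: contrapT => xS.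
have n0 : \near x, phi x = 0.
  have : nbhs x (~` closure [set x | phi x != 0]).
    by apply: open_nbhs_nbhs; split => //; exact/closed_openC/closed_closure.
  apply: filterS => y /= hy; apply/eqP/negP => /negP py.
  by apply: hy; exact: subset_closure.
move/eqP: dx; apply; apply: is_derive_derive1.
apply: (@near_eq_is_derive _ _ _ (fun=> 0 : R) _ x 1 0 _ (is_derive1_const 0 x)).
by apply: filterS n0.
Qed.

Lemma test_function_ibp phi psi : test_function a b phi -> test_function a b psi ->
  \int[mu]_(x in `]a, b[) (phi x * derive1 psi x) =
  - \int[mu]_(x in `]a, b[) (derive1 phi x * psi x).
Proof.
move=> tphi tpsi.
have sphi := test_smooth tphi; have spsi := test_smooth tpsi.
have i1 := itg_ind_bddm a b (bddmM (test_function_bddm tphi)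
  (test_function_bddm (test_function_derive1 tpsi))).
have i2 := itg_ind_bddm a b (bddmM (test_function_bddm (test_function_derive1 tphi))
  (test_function_bddm tpsi)).
rewrite -!Rint_ind; apply/eqP; rewrite -addr_eq0 -RintegralD//; apply/eqP.
have dF (z : R) : is_derive z 1 (fun z => phi z * psi z)
    (phi z * derive1 psi z + derive1 phi z * psi z).
  have := is_derive1_mul (smooth_is_derive z sphi) (smooth_is_derive z spsi).
  by move/is_derive1_eq; apply; ring.
have cF : continuous (fun z => phi z * derive1 psi z + derive1 phi z * psi z).
  move=> z; apply: cvgD; apply: cvgM; by apply: smooth_continuous => //; exact: smooth_derive1.
have aI : a \notin `]a, b[ by rewrite in_itv/= ltxx.
have bI : b \notin `]a, b[ by rewrite in_itv/= ltxx andbF.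
have := Rint_ind_FTC (ltW ab) dF cF.
rewrite (test_function_out tpsi aI).1 (test_function_out tpsi bI).1 !mulr0 subrr => <-.
by apply: eq_Rintegral => x _; rewrite mulrDr.
Qed.

Lemma L2_bddm (g : R -> R) : bddm g -> L2 a b g.
Proof.
move=> bg; have ig := itg_ind_bddm a b (bddmM bg bg).
rewrite /L2 patch_ind inE/=; apply/andP; split; rewrite inE/=.
  by apply: measurable_funM; [exact: measurable_ind|exact: bg.1].
rewrite /finite_norm unlock poweR_lty//.
rewrite (@eq_integral _ _ _ mu setT (fun x => (\1_`]a, b[ x * (g x * g x))%:E)).
  by apply/integrable_lty => //.
move=> x _; rewrite /= powR_mulrn// real_normK ?num_real// expr2.
by have [xI|xI] := boolP (x \in `]a, b[); rewrite ?(ind_in xI) ?(ind_notin xI) ?mul1r ?mul0r.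
Qed.

Lemma test_function_H1 phi : test_function a b phi -> H1_deriv a b phi (derive1 phi).
Proof.
move=> tphi; split.
- exact: L2_bddm (test_function_bddm tphi).
- exact: L2_bddm (test_function_bddm (test_function_derive1 tphi)).
- by move=> psi; exact: test_function_ibp.
Qed.

Lemma test_function_H10 phi : test_function a b phi -> H10 a b phi.
Proof.
move=> tphi; exists (derive1 phi); first exact: test_function_H1.
move=> e e0; exists phi => //; rewrite /H1_norm.
under eq_Rintegral do rewrite /= !subrr expr0n addr0.
by rewrite /Rintegral integral0 sqrtr0.
Qed.

End TestFunctions.

Section WeakEquation.
Context (R : realType) (alpha T : R).
Hypotheses (alpha_gt0 : 0 < alpha) (T_gt0 : 0 < T).
Local Notation mu := (@lebesgue_measure R).
Local Notation nu := (mu \x mu)%E.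
Local Notation rlk := (rlk alpha).
Local Notation rl_int := (rl_int alpha).
Variables (p po f rho : R -> R) (y w : R * R -> R).
Hypothesis mp : measurable_fun setT (fun x : R => \1_`]0, 1[ x * p x).
Hypothesis bpo : bddm po.
Hypothesis pE : {ae mu, forall x, x \in `]0, 1[ -> p x = po x}.
Hypothesis iy : itg nu (rect T y).
Hypothesis iw : itg nu (rect T w).
Local Notation fo := (fun x : R => \1_`]0, 1[ x * f x).
Local Notation rhoo := (fun t : R => \1_`]0, T[ t * rho t).
Hypothesis iF : itg mu fo.
Hypothesis irho : itg mu rhoo.
Hypothesis Heq : ae_in 0 T (fun t =>
  exists2 yxx, distr_deriv2 0 1 (fun x => y (x, t)) yxx &
    forall psi, H10 0 1 psi ->
      L2_Hm1 0 1 (fun x => w (x, t)) psi - yxx psi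
        + L2_Hm1 0 1 (fun x => p x * y (x, t)) psi =
      rho t * L2_Hm1 0 1 f psi).

Lemma slice_pairE (u : R * R -> R) (h : R -> R) t : t \in `]0, T[ ->
  slice_pair h (rect T u) t = \int[mu]_(x in `]0, 1[) (u (x, t) * h x).
Proof.
move=> tI; rewrite -Rint_ind; apply: eq_Rintegral => x _.
by rewrite /rect/= (ind_in tI) mul1r mulrCA (mulrC (h x)).
Qed.

(** For a test function the distributional y_xx is a pairing of y with the second derivative of phi.
    The null set of times is the same for all phi, and p is replaced by its bounded representative
    [po]. *)
Lemma weak_equation_slice : {ae mu, forall t, forall phi, test_function 0 1 phi ->
  slice_pair phi (rect T w) t - slice_pair (derive1n 2 phi) (rect T y) t
    + slice_pair (fun x => po x * phi x) (rect T y) t =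
  rhoo t * \int[mu]_x (fo x * phi x)}.
Proof.
apply: ae_imp Heq => t Ht phi tphi.
have [tI|tI] := boolP (t \in `]0, T[); last first.
  have tI' : ~ 0 < t < T by move=> h; move: tI; rewrite in_itv/= h.
  rewrite (ind_notin tI) mul0r !(slice_pair_supp (T := T))// => [|x s|x s|x s]; last 3 first.
  - exact: rect_supp.
  - exact: rect_supp.
  - exact: rect_supp.
  by ring.
have [yxx [_ yE] E] := Ht tI.
have := E _ (test_function_H10 ltr01 tphi); rewrite yE// (ind_in tI) mul1r => {}E.
rewrite !slice_pairE//.
have <- : L2_Hm1 0 1 f phi = \int[mu]_x (fo x * phi x).
  by rewrite /L2_Hm1 -Rint_ind; apply: eq_Rintegral => x _; rewrite mulrA.
rewrite -E.
have -> : \int[mu]_(x in `]0, 1[) (y (x, t) * (po x * phi x)) =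
    L2_Hm1 0 1 (fun x => p x * y (x, t)) phi.
  rewrite /L2_Hm1 -!Rint_ind; apply: Rint_ae.
  - have := measurable_funM (measurableT_comp (itg_measurable iy) (measurable_pair2 t))
      (measurable_funM bpo.1 (test_function_bddm tphi).1).
    congr measurable_fun; apply/funext => x.
    by rewrite /= /rect/= (ind_in tI) mul1r -mulrA.
  - have := measurable_funM (measurableT_comp (itg_measurable iy) (measurable_pair2 t))
      (measurable_funM mp (test_function_bddm tphi).1).
    congr measurable_fun; apply/funext => x; rewrite /= /rect/= (ind_in tI) mul1r.
    by have [xI|xI] := boolP (x \in `]0, 1[); rewrite ?(ind_in xI) ?(ind_notin xI); ring.
  - apply: ae_imp pE => x px; have [xI|xI] := boolP (x \in `]0, 1[).
      by rewrite (px xI); ring.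
    by rewrite (ind_notin xI) !mul0r.
by [].
Qed.

(** The tested equation is integrated against the kernel in time, where its validity for almost
    every tau is enough; [time_int_pair] lets the pairing in x commute with J^alpha. *)
Lemma weak_equation_time_int t phi :
  itg nu (fun z => rlk (t - z.2) * rect T y z) ->
  itg nu (fun z => rlk (t - z.2) * rect T w z) ->
  itg mu (fun tau => rlk (t - tau) * rhoo tau) ->
  test_function 0 1 phi ->
  \int[mu]_x (phi x * time_int alpha (rect T w) t x)
    - \int[mu]_x (derive1n 2 phi x * time_int alpha (rect T y) t x)
    + \int[mu]_x (po x * phi x * time_int alpha (rect T y) t x) =
  rl_int rhoo t * \int[mu]_x (fo x * phi x).
Proof.
move=> iyt iwt irt tphi.
have bphi := test_function_bddm tphi.
have bphi2 : bddm (derive1n 2 phi).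
  exact: test_function_bddm (test_function_derive1 (test_function_derive1 tphi)).
have bpphi := bddmM bpo bphi.
rewrite !time_int_pair// /rl_int.
have i1 := itg_rlk_slice_pair iwt bphi iw.
have i2 := itg_rlk_slice_pair iyt bphi2 iy.
have i3 := itg_rlk_slice_pair iyt bpphi iy.
rewrite -RintegralB// -RintegralD//; last exact: itgB.
rewrite -RintegralZr//; apply: Rint_ae.
- exact: itg_measurable (itgD (itgB i1 i2) i3).
- by have := itgZ (\int[mu]_x (fo x * phi x)) irt => /itg_measurable;
    congr measurable_fun; apply/funext => tau; rewrite mulrC.
apply: ae_imp weak_equation_slice => tau E.
by rewrite -mulrA -(E _ tphi); ring.
Qed.

End WeakEquation.

(** * Cauchy data at x0 and integration by parts on both sides *)

Section CauchyData.
Context (R : realType).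
Local Notation mu := (@lebesgue_measure R).

Lemma ind_oo_opp (u v z : R) : \1_`]u, v[ (- z) = \1_`](- v), (- u)[ z :> R.
Proof.
have E : (- z \in `]u, v[) = (z \in `](- v), (- u)[).
  by rewrite !in_itv/= ltrNr ltrNl andbC.
have [zI|zI] := boolP (z \in `](- v), (- u)[).
  by rewrite (ind_in zI) ind_in ?E.
by rewrite (ind_notin zI) ind_notin ?E.
Qed.

Lemma measurable_ind_within (a b : R) (h : R -> R) :
  {within `]a, b[, continuous h} -> measurable_fun setT (fun x => \1_`]a, b[ x * h x).
Proof.
move=> ch; have := subspace_continuous_measurable_fun (measurable_itv `]a, b[) ch.
by move/(measurable_restrictT h (measurable_itv `]a, b[)); rewrite patch_ind.
Qed.

Lemma measurable_ind_sub (a b c d : R) (h : R -> R) : a <= c -> d <= b ->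
  measurable_fun setT (fun x => \1_`]a, b[ x * h x) ->
  measurable_fun setT (fun x => \1_`]c, d[ x * h x).
Proof.
move=> ac db mh; have := measurable_funM (@measurable_ind R `]c, d[) mh.
congr measurable_fun; apply/funext => x /=.
have [xI|xI] := boolP (x \in `]c, d[); last by rewrite !(ind_notin xI) !mul0r.
rewrite !(ind_in xI) ind_in ?mul1r//; move: xI; rewrite !in_itv/= => /andP[h1 h2].
by rewrite (le_lt_trans ac h1) (lt_le_trans h2 db).
Qed.

Lemma itg_ind_sub (a b c d : R) (q : R -> R) : a <= c -> d <= b ->
  itg mu (fun x => \1_`]a, b[ x * q x) -> itg mu (fun x => \1_`]c, d[ x * q x).
Proof.
move=> ac db iq; have := itg_ind `]c, d[ iq.
congr itg; apply/funext => x.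
have [xI|xI] := boolP (x \in `]c, d[); last by rewrite !(ind_notin xI) !mul0r.
rewrite !(ind_in xI) ind_in ?mul1r//; move: xI; rewrite !in_itv/= => /andP[h1 h2].
by rewrite (le_lt_trans ac h1) (lt_le_trans h2 db).
Qed.

Section OneTime.
Variables (x0 : R) (Y U v h0 h1 Q : R -> R).
Hypothesis x0_in : x0 \in `]0, 1[.
Hypothesis mY : measurable_fun setT Y.
Hypothesis UY : forall x, x \in `]0, 1[ -> U x = Y x.
Hypothesis dU : H1_deriv 0 1 U v.
Hypothesis iQ : itg mu (fun x => \1_`]0, 1[ x * Q x).
Hypothesis YQ : forall phi, test_function 0 1 phi ->
  \int[mu]_(x in `]0, 1[) (Y x * derive1n 2 phi x) = \int[mu]_(x in `]0, 1[) (Q x * phi x).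
Hypothesis ch0 : {within `]0, 1[, continuous h0}.
Hypothesis ch1 : {within `]0, 1[, continuous h1}.
Hypothesis Uh : {ae mu, forall x, x \in `]0, 1[ -> U x = h0 x}.
Hypothesis vh : {ae mu, forall x, x \in `]0, 1[ -> v x = h1 x}.
Hypothesis h00 : h0 x0 = 0.
Hypothesis h10 : h1 x0 = 0.

Let iv : itg mu (fun x => \1_`]0, 1[ x * v x).
Proof. by case: dU => _ /L2_itg. Qed.

Let mh0 := measurable_ind_within ch0.
Let mh1 := measurable_ind_within ch1.

Let Rint_ae_mul (u h g : R -> R) : itg mu (fun x => \1_`]0, 1[ x * u x) ->
  measurable_fun setT (fun x : R => \1_`]0, 1[ x * h x) -> bddm g ->
  {ae mu, forall x, x \in `]0, 1[ -> u x = h x} ->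
  \int[mu]_(x in `]0, 1[) (h x * g x) = \int[mu]_(x in `]0, 1[) (u x * g x).
Proof.
move=> iu mh bg uh; rewrite -!Rint_ind.
under eq_Rintegral do rewrite mulrA.
under [in RHS]eq_Rintegral do rewrite mulrA.
apply: Rint_ae.
- exact: measurable_funM mh bg.1.
- exact: measurable_funM (itg_measurable iu) bg.1.
apply: ae_imp uh => x E; have [xI|xI] := boolP (x \in `]0, 1[).
  by rewrite E.
by rewrite (ind_notin xI) !mul0r.
Qed.

Lemma trace_increment c d : 0 < c -> c <= d -> d < 1 ->
  h0 d - h0 c = \int[mu]_x (\1_`]c, d[ x * v x).
Proof.
apply: dubois => // phi tphi.
rewrite (Rint_ae_mul _ mh0 _ Uh).
- by case: dU => _ _; apply.
- by case: dU => /L2_itg.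
- exact: test_function_bddm (test_function_derive1 tphi).
Qed.

(** Testing the weak derivative v of U on the derivative of phi shows that Q is the weak derivative
    of v; [dubois] applies to the continuous representative h1. *)
Lemma trace_x_increment c d : 0 < c -> c <= d -> d < 1 ->
  h1 d - h1 c = \int[mu]_x (\1_`]c, d[ x * Q x).
Proof.
apply: dubois => // phi tphi.
have tphi' := test_function_derive1 tphi.
rewrite (Rint_ae_mul iv mh1 (test_function_bddm tphi') vh).
case: dU => _ _ /(_ _ tphi') /(congr1 -%R); rewrite opprK => <-.
rewrite -(YQ tphi) -!Rint_ind; congr (- _).
apply: eq_Rintegral => x _; have [xI|xI] := boolP (x \in `]0, 1[).
  by rewrite (UY xI).
by rewrite (ind_notin xI) !mul0r.
Qed.

Lemma right_adjoint g : bddm g ->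
  \int[mu]_x (\1_`]x0, 1[ x * (Y x * g x)) =
  \int[mu]_x (Q x * volt x0 1 (fun r => r) g x).
Proof.
move: (x0_in); rewrite in_itv/= => /andP[x00 x01].
apply: (cauchy_adjoint (h0 := h0) (v := v) (h1 := h1)) => //.
- exact: itg_ind_sub (ltW x00) (lexx _) iv.
- exact: itg_ind_sub (ltW x00) (lexx _) iQ.
- exact: measurable_ind_sub (ltW x00) (lexx _) mh0.
- exact: measurable_ind_sub (ltW x00) (lexx _) mh1.
- apply: ae_imp Uh => x E; rewrite in_itv/= => /andP[h h'].
  by rewrite -E ?UY// in_itv/= (lt_trans x00 h).
- apply: ae_imp vh => x E; rewrite in_itv/= => /andP[h h'].
  by rewrite -E// in_itv/= (lt_trans x00 h).
- move=> x; rewrite in_itv/= => /andP[h h'].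
  by rewrite -(trace_increment x00 (ltW h) h') h00 subr0.
- move=> x; rewrite in_itv/= => /andP[h h'].
  by rewrite -(trace_x_increment x00 (ltW h) h') h10 subr0.
Qed.

Let ind_refl (q : R -> R) x :
  \1_`](- 1), 0[ x * q (- x) = \1_`]0, 1[ (- x) * q (- x).
Proof. by rewrite ind_oo_opp oppr0. Qed.

Let Rint_refl (q : R -> R) c d : itg mu (fun x => \1_`]c, d[ x * q x) ->
  \int[mu]_x (\1_`](- d), (- c)[ x * q (- x)) = \int[mu]_x (\1_`]c, d[ x * q x).
Proof.
move=> iq; rewrite -(Rint_opp iq); apply: eq_Rintegral => x _.
by rewrite ind_oo_opp.
Qed.

(** The situation to the right of x0, reflected by x -> - x. The first derivative changes sign, so v
    and h1 become - v(- x) and - h1(- x), while Y and Q keep their sign. *)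
Lemma left_adjoint g : bddm g ->
  \int[mu]_x (\1_`](- x0), 0[ x * (Y (- x) * g x)) =
  \int[mu]_x (Q (- x) * volt (- x0) 0 (fun r => r) g x).
Proof.
move: (x0_in); rewrite in_itv/= => /andP[x00 x01].
have lx : -1 <= - x0 by rewrite lerN2 ltW.
have itg_refl (q : R -> R) : itg mu (fun x => \1_`]0, 1[ x * q x) ->
    itg mu (fun x => \1_`](- x0), 0[ x * q (- x)).
  move=> iq; apply: (itg_ind_sub lx (lexx _)); have := itg_opp iq.
  by congr itg; apply/funext => x; rewrite ind_refl.
have mo : measurable_fun [set: R] (fun x : R => - x) by exact: oppr_measurable.
have m_refl (h : R -> R) : measurable_fun setT (fun x : R => \1_`]0, 1[ x * h x) ->
    measurable_fun setT (fun x => \1_`](- x0), 0[ x * h (- x)).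
  move=> mh; apply: (measurable_ind_sub lx (lexx _)).
  have := measurableT_comp mh mo.
  by congr measurable_fun; apply/funext => x; rewrite ind_refl.
have memN x : x \in `](- x0), 0[ -> [/\ 0 < - x, - x <= x0, - x < x0 & - x \in `]0, 1[].
  rewrite !in_itv/= => /andP[h h']; have -> : 0 < - x < 1 by apply/andP; split; lra.
  by split => //; lra.
apply: (cauchy_adjoint (h0 := fun x => h0 (- x)) (v := fun x => - v (- x))
  (h1 := fun x => - h1 (- x))) => //.
- by rewrite oppr_lt0.
- exact: measurableT_comp mY mo.
- have := itgN (itg_refl _ iv); congr itg; apply/funext => x; exact: esym (mulrN _ _).
- exact: itg_refl.
- exact: m_refl mh0.
- have := m_refl _ mh1 => /(measurableT_comp mo).
  by congr measurable_fun; apply/funext => x; exact: esym (mulrN _ _).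
- apply: ae_imp (ae_opp Uh) => x E xI; have [_ _ _ h] := memN x xI.
  by rewrite -E ?UY.
- apply: ae_imp (ae_opp vh) => x E xI; have [_ _ _ h] := memN x xI.
  by rewrite E.
- move=> x xI; have [nx0 nx1 nx2 nx3] := memN x xI.
  have := trace_increment nx0 nx1 x01; rewrite h00 sub0r => /(congr1 -%R); rewrite opprK => ->.
  have /Rint_refl <- := itg_ind_sub (ltW nx0) (ltW x01) iv.
  rewrite opprK -[LHS]mulN1r -RintegralZl//.
    by apply: eq_Rintegral => z _; ring.
  have := itg_opp (itg_ind_sub (ltW nx0) (ltW x01) iv).
  by congr itg; apply/funext => z; rewrite ind_oo_opp opprK.
- move=> x xI; have [nx0 nx1 nx2 nx3] := memN x xI.
  have := trace_x_increment nx0 nx1 x01; rewrite h10 sub0r => ->.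
  have /Rint_refl <- := itg_ind_sub (ltW nx0) (ltW x01) iQ.
  by rewrite opprK.
Qed.
End OneTime.
End CauchyData.

(** * The scalar fractional equation and the bound at high frequency *)

Section ScalarEquation.
Context (R : realType) (alpha T : R).
Hypotheses (alpha_gt0 : 0 < alpha) (T_gt0 : 0 < T).
Local Notation mu := (@lebesgue_measure R).
Local Notation nu := (mu \x mu)%E.
Local Notation rlk := (rlk alpha).
Local Notation rl_int := (rl_int alpha).
Local Notation Gam := (Gamma alpha).
Variables (po fo rhoo : R -> R) (y w : R * R -> R) (t : R).
Hypothesis bpo : bddm po.
Hypothesis iy : itg nu (rect T y).
Hypothesis iw : itg nu (rect T w).
Hypothesis iF : itg mu fo.
Hypothesis tI : 0 < t < T.
Hypothesis iyt : itg nu (fun z => rlk (t - z.2) * rect T y z).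
Hypothesis iwt : itg nu (fun z => rlk (t - z.2) * rect T w z).

Definition rl_slice (u : R * R -> R) (x : R) : R := Gam^-1 * time_int alpha (rect T u) t x.

(** The second space derivative of J^alpha y(., t), read off from the equation after applying
    J^alpha. *)
Definition rl_second_deriv (x : R) : R :=
  rl_slice w x + po x * rl_slice y x - Gam^-1 * rl_int rhoo t * fo x.

Lemma rl_slice_out u x : x \notin `]0, 1[ -> rl_slice u x = 0.
Proof.
move=> xI; rewrite /rl_slice /time_int /rl_int.
under eq_Rintegral do rewrite rect_out1// mulr0.
by rewrite /Rintegral integral0 mulr0.
Qed.

Lemma itg_rl_slice u : itg nu (fun z => rlk (t - z.2) * rect T u z) -> itg mu (rl_slice u).
Proof. by move=> iu; apply: itgZ; exact: itg_time_int. Qed.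

Lemma rl_slice_pair u h : itg nu (fun z => rlk (t - z.2) * rect T u z) ->
  itg nu (rect T u) -> bddm h ->
  \int[mu]_x (h x * rl_slice u x) = Gam^-1 * rl_int (slice_pair h (rect T u)) t.
Proof.
move=> iut iu bh; rewrite -(time_int_pair iut bh iu) -RintegralZl//; last first.
  exact: itg_bddm bh (itg_time_int iut).
by apply: eq_Rintegral => x _; rewrite /rl_slice; ring.
Qed.

Lemma itg_rl_second_deriv : itg mu rl_second_deriv.
Proof.
apply: itgB; last exact: itgZ.
apply: itgD; first exact: itg_rl_slice.
exact: itg_bddm bpo (itg_rl_slice iyt).
Qed.

Lemma rl_second_deriv_pair h : bddm h -> \int[mu]_x (h x * rl_second_deriv x) =
  \int[mu]_x (h x * rl_slice w x) + \int[mu]_x (po x * h x * rl_slice y x)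
  - Gam^-1 * rl_int rhoo t * \int[mu]_x (fo x * h x).
Proof.
move=> bh.
have i1 := itg_bddm bh (itg_rl_slice iwt).
have i2 := itg_bddm (bddmM bpo bh) (itg_rl_slice iyt).
have i3 := itg_bddm bh iF.
have {}i3 : itg mu (fun x => fo x * h x).
  by move: i3; congr itg; apply/funext => x; rewrite mulrC.
rewrite -RintegralZl// -RintegralD// -RintegralB//; first last.
- exact: itgZ.
- exact: itgD.
by apply: eq_Rintegral => x _; rewrite /rl_second_deriv; ring.
Qed.

(** Expanding both sides of the duality: J^alpha w = y turns the pairing of X with J^alpha w into
    the pairing with y itself, and the terms in [po] are the same on both sides. *)
Lemma scalar_identity (l c : R) (X chi : R -> R) : bddm X -> bddm chi ->
  {ae mu, forall x, x \in `]0, 1[ -> y (x, t) = Jop alpha w (x, t)} ->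
  c = \int[mu]_x (fo x * X x) ->
  \int[mu]_x ((l ^+ 2 * X x + (po x * X x + chi x)) * rl_slice y x) =
    \int[mu]_x (X x * rl_second_deriv x) ->
  slice_pair X (rect T y) t - l ^+ 2 / Gam * rl_int (slice_pair X (rect T y)) t =
    (rl_int (slice_pair chi (rect T y)) t + c * rl_int rhoo t) / Gam.
Proof.
move=> bX bchi yJ cE; rewrite rl_second_deriv_pair//.
have -> : \int[mu]_x (X x * rl_slice w x) = slice_pair X (rect T y) t.
  apply: Rint_ae.
  - exact: itg_measurable (itg_bddm bX (itg_rl_slice iwt)).
  - apply: measurable_funM; first exact: bX.1.
    exact: measurableT_comp (itg_measurable iy) (measurable_pair2 t).
  apply: ae_imp yJ => x E; congr (_ * _).
  have [xI|xI] := boolP (x \in `]0, 1[); last by rewrite rl_slice_out// rect_out1.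
  move: (xI) => /E; rewrite in_itv/= in xI.
  by rewrite rectE// (@Jop_rect R alpha T w _ _ xI tI).
have iX := itg_bddm bX (itg_rl_slice iyt).
have ichi := itg_bddm bchi (itg_rl_slice iyt).
have ipX := itg_bddm (bddmM bpo bX) (itg_rl_slice iyt).
have -> : \int[mu]_x ((l ^+ 2 * X x + (po x * X x + chi x)) * rl_slice y x) =
    l ^+ 2 * \int[mu]_x (X x * rl_slice y x) + (\int[mu]_x (po x * X x * rl_slice y x) +
      \int[mu]_x (chi x * rl_slice y x)).
  rewrite -RintegralZl// -RintegralD// -RintegralD//; first last.
  - exact: itgD.
  - exact: itgZ.
  by apply: eq_Rintegral => x _; ring.
have bpX := bddmM bpo bX.
rewrite !(rl_slice_pair iyt iy)// -cE.
set A := slice_pair X _ t; set B := rl_int (slice_pair X _) t.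
set D := rl_int (slice_pair chi _) t; set E := rl_int rhoo t; set P := rl_int _ t.
move: A B D E P (Gam^-1) => A B D E P G H.
have -> : A = l ^+ 2 * (G * B) + G * D + G * E * c.
  (* P is the term in [po], common to both sides, which is cancelled here. *)
  by apply: (addIr (G * P - G * E * c)); rewrite addrA -H; ring.
by ring.
Qed.

End ScalarEquation.

Section FrequencyBound.
Context (R : realType) (alpha T : R).
Hypotheses (alpha_gt0 : 0 < alpha) (alpha_lt1 : alpha < 1) (T_gt0 : 0 < T).
Local Notation mu := (@lebesgue_measure R).
Local Notation nu := (mu \x mu)%E.
Local Notation rl_int := (rl_int alpha).
Local Notation Gam := (Gamma alpha).

(** [lap_source_bound] at s = l^(2 / alpha), so that s^alpha = l^2. Since alpha < 1 and l >= 1, s >=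
    l^2, hence exp(- s T) <= exp(- T l^2); the norms of the two pairings are bounded by sup norms
    times the L^1 norm of y. *)
Lemma frequency_bound (rhoo : R -> R) (y : R * R -> R) (r0 delta : R) :
  itg mu rhoo -> supp0T T rhoo -> 0 < r0 -> 0 < delta ->
  {ae mu, forall t, 0 < t < delta -> r0 <= rhoo t} ->
  itg nu (rect T y) ->
  exists C K l0, 0 <= C /\ forall l X chi MX Mchi c, l0 <= l -> bddm X -> bddm chi ->
    (forall x, `|X x| <= MX) -> (forall x, `|chi x| <= Mchi) ->
    {ae mu, forall t, 0 < t < T ->
      slice_pair X (rect T y) t - l ^+ 2 / Gam * rl_int (slice_pair X (rect T y)) t =
        (rl_int (slice_pair chi (rect T y)) t + c * rl_int rhoo t) / Gam} ->
    `|c| <= C * l ^+ K * (expR (- (T * l ^+ 2)) * MX + Mchi).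
Proof.
move=> ir rT r00 d0 rge iy.
have [C [s0 [C0 s00 bound]]] := lap_source_bound alpha_gt0 alpha_lt1 T_gt0 ir rT r00 d0 rge.
pose Ny := \int[nu]_z `|rect T y z|.
have Ny0 : 0 <= Ny by apply: Rintegral_ge0 => z _.
have a2 : 2 <= 2 / alpha by rewrite ler_pdivlMr// ler_piMr ?ltW.
(* An integer exponent with s <= l^K; the two further powers in K + 2 come from the factor s^alpha =
   l^2. *)
pose K := Num.bound (2 / alpha).
have aK : 2 / alpha <= K%:R by apply: ltW; apply: archi_boundP; exact: le_trans a2.
exists (C * Ny), (K + 2)%N, (Num.max 1 s0); split; first exact: mulr_ge0.
move=> l X chi MX Mchi c; rewrite ge_max => /andP[l1 ls0] bX bchi XM chiM eqn.
have l0 : 0 < l by lra.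
have MX0 : 0 <= MX by apply: le_trans (XM 0).
have Mchi0 : 0 <= Mchi by apply: le_trans (chiM 0).
pose s := l `^ (2 / alpha).
have salpha : s `^ alpha = l ^+ 2.
  by rewrite /s -powRrM divfK ?gt_eqF// powR_mulrn// ltW.
have l2s : l ^+ 2 <= s by rewrite -powR_mulrn ?ler_powR// ltW.
have lls : l <= l ^+ 2 by rewrite expr2 ler_peMl// ltW.
have ss0 : s0 <= s by apply: le_trans ls0 _; exact: le_trans l2s.
have sK : s <= l ^+ K by rewrite -powR_mulrn ?ler_powR// ltW.
have s_ge0 : 0 <= s by exact: powR_ge0.
have ry x t : ~ 0 < t < T -> rect T y (x, t) = 0 by exact: rect_supp.
have := bound s _ _ c ss0 (itg_slice_pair bX iy) (itg_slice_pair bchi iy)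
  (slice_pair_supp X ry) (slice_pair_supp chi ry).
rewrite salpha => /(_ eqn) h; apply: le_trans h _.
have hX := Rint_abs_slice_pair bX iy XM; have hchi := Rint_abs_slice_pair bchi iy chiM.
apply: (@le_trans _ _ (C * s * (l ^+ 2 * (expR (- (T * l ^+ 2)) * MX * Ny) + l ^+ 2 * (Mchi * Ny)))).
  apply: ler_wpM2l; first exact: mulr_ge0.
  apply: lerD.
    rewrite -!(mulrA (l ^+ 2)) -(mulrA (expR _)).
    apply: ler_wpM2l; first by rewrite exprn_ge0// ltW.
    apply: ler_pM; rewrite ?expR_ge0//; first by apply: Rintegral_ge0.
    by rewrite ler_expR lerN2 mulrC ler_wpM2r// ltW.
  apply: le_trans hchi _; rewrite ler_peMl ?mulr_ge0//.
  exact: exprn_ege1.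
have -> : C * s * (l ^+ 2 * (expR (- (T * l ^+ 2)) * MX * Ny) + l ^+ 2 * (Mchi * Ny)) =
   (C * Ny * (expR (- (T * l ^+ 2)) * MX + Mchi) * l ^+ 2) * s by ring.
have -> : C * Ny * l ^+ (K + 2) * (expR (- (T * l ^+ 2)) * MX + Mchi) =
   (C * Ny * (expR (- (T * l ^+ 2)) * MX + Mchi) * l ^+ 2) * l ^+ K by rewrite exprD; ring.
apply: ler_wpM2l => //; rewrite mulr_ge0 ?exprn_ge0 ?(ltW l0)//.
by rewrite !mulr_ge0// addr_ge0// mulr_ge0// expR_ge0.
Qed.

End FrequencyBound.

(** * Assembling the duality, the source bounds and the conclusion *)

Section TraceAdjoint.
Context (R : realType) (alpha T : R).
Hypotheses (alpha_gt0 : 0 < alpha) (T_gt0 : 0 < T).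
Local Notation mu := (@lebesgue_measure R).
Local Notation nu := (mu \x mu)%E.
Local Notation rlk := (rlk alpha).
Local Notation rl_int := (rl_int alpha).
Local Notation Gam := (Gamma alpha).

Lemma bddm_opp (g : R -> R) : bddm g -> bddm (fun x => g (- x)).
Proof.
move=> [mg [M gM]]; split; last by exists M.
exact: measurableT_comp mg (@oppr_measurable _ _).
Qed.

(** The integrated equation says that Q is the second distributional derivative of Y; with the
    vanishing traces, [right_adjoint] and [left_adjoint] apply. *)
Lemma trace_adjoint (po fo rhoo : R -> R) (y w : R * R -> R) (x0 t : R) :
  bddm po -> itg nu (rect T y) -> itg nu (rect T w) -> itg mu fo ->
  x0 \in `]0, 1[ -> 0 < t < T ->
  itg nu (fun z => rlk (t - z.2) * rect T y z) ->
  itg nu (fun z => rlk (t - z.2) * rect T w z) ->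
  (forall phi, test_function 0 1 phi ->
    \int[mu]_x (phi x * time_int alpha (rect T w) t x)
      - \int[mu]_x (derive1n 2 phi x * time_int alpha (rect T y) t x)
      + \int[mu]_x (po x * phi x * time_int alpha (rect T y) t x) =
    rl_int rhoo t * \int[mu]_x (fo x * phi x)) ->
  continuous_value `]0, 1[ (fun x => Jop alpha y (x, t)) x0 0 ->
  (exists2 v, H1_deriv 0 1 (fun x => Jop alpha y (x, t)) v &
    continuous_value `]0, 1[ v x0 0) ->
  let Y := rl_slice alpha T t y in
  let Q := rl_second_deriv alpha T po fo rhoo y w t in
  (forall g, bddm g -> \int[mu]_x (\1_`]x0, 1[ x * (Y x * g x)) =
    \int[mu]_x (Q x * volt x0 1 (fun r => r) g x)) /\
  (forall g, bddm g -> \int[mu]_x (\1_`](- x0), 0[ x * (Y (- x) * g x)) =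
    \int[mu]_x (Q (- x) * volt (- x0) 0 (fun r => r) g x)).
Proof.
move=> bpo iy iw iF x0I tI iyt iwt weq [h0 [ch0 Uh h00]] [v dU [h1 [ch1 vh h10]]] Y Q.
have iY : itg mu Y by exact: itg_rl_slice.
have mY := itg_measurable iY.
have UY x : x \in `]0, 1[ -> Jop alpha y (x, t) = Y x.
  by rewrite in_itv/= => xI; rewrite (@Jop_rect R alpha T y _ _ xI tI).
have iQ : itg mu (fun x => \1_`]0, 1[ x * Q x).
  exact: itg_ind (itg_rl_second_deriv rhoo bpo iF iyt iwt).
have YQ phi : test_function 0 1 phi ->
    \int[mu]_(x in `]0, 1[) (Y x * derive1n 2 phi x) = \int[mu]_(x in `]0, 1[) (Q x * phi x).
  move=> tphi; have bphi := test_function_bddm tphi.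
  have bphi2 : bddm (derive1n 2 phi).
    exact: test_function_bddm (test_function_derive1 (test_function_derive1 tphi)).
  have sliceE u h : itg nu (fun z => rlk (t - z.2) * rect T u z) -> bddm h ->
      \int[mu]_x (h x * rl_slice alpha T t u x) =
      Gam^-1 * \int[mu]_x (h x * time_int alpha (rect T u) t x).
    move=> iu bh; rewrite -RintegralZl//; last exact: itg_bddm bh (itg_time_int iu).
    by apply: eq_Rintegral => x _; rewrite /rl_slice; ring.
  transitivity (\int[mu]_x (derive1n 2 phi x * Y x)).
    rewrite -Rint_ind; apply: eq_Rintegral => x _.
    have [xI|xI] := boolP (x \in `]0, 1[); first by rewrite ind_in// mul1r mulrC.
    by rewrite ind_notin// mul0r /Y rl_slice_out// mulr0.
  transitivity (\int[mu]_x (phi x * Q x)); last first.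
    rewrite -Rint_ind; apply: eq_Rintegral => x _.
    have [xI|xI] := boolP (x \in `]0, 1[); first by rewrite ind_in// mul1r mulrC.
    by rewrite ind_notin// mul0r (test_function_out tphi xI).1 mul0r.
  have bpphi := bddmM bpo bphi.
  rewrite (rl_second_deriv_pair rhoo bpo iF iyt iwt bphi) !sliceE//.
  rewrite -[Gam^-1 * rl_int _ _ * _]mulrA -weq//; ring.
split=> g bg.
- exact: (right_adjoint x0I mY UY dU iQ YQ ch0 ch1 Uh vh h00 h10 bg).
- exact: (left_adjoint x0I mY UY dU iQ YQ ch0 ch1 Uh vh h00 h10 bg).
Qed.

End TraceAdjoint.

Section SourceBounds.
Context (R : realType) (alpha T : R).
Hypotheses (alpha_gt0 : 0 < alpha) (alpha_lt1 : alpha < 1) (T_gt0 : 0 < T).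
Local Notation mu := (@lebesgue_measure R).
Local Notation nu := (mu \x mu)%E.
Local Notation rl_int := (rl_int alpha).
Local Notation Gam := (Gamma alpha).

(** Here e is the sign of rho(0), and by continuity e rho stays above half of |rho(0)| near 0. *)
Lemma continuous_value_sign (rho : R -> R) (c : R) :
  continuous_value `[0, T] rho 0 c -> c != 0 ->
  exists2 e : R, e * e = 1 & exists2 delta, 0 < delta &
    {ae mu, forall t, 0 < t < delta -> `|c| / 2 <= e * (\1_`]0, T[ t * rho t)}.
Proof.
move=> [h [ch rh h0]] c0.
have Nc0 : 0 < `|c| by rewrite normr_gt0.
have [e e1 ec] : exists2 e : R, e * e = 1 & e * c = `|c|.
  have [cp|cn] := leP 0 c; first by exists 1; rewrite ?mul1r// ger0_norm.
  by exists (-1); rewrite ?mulN1r ?opprK// ltr0_norm.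
have [_ c0h _] := (continuous_within_itvP h T_gt0).1 ch.
have Nc2 : 0 < `|c| / 2 by rewrite divr_gt0.
have /cvgrPdist_le/(_ _ Nc2) := c0h.
rewrite h0 => /nbhs_ballP[d /= d0 hd].
exists e => //; exists (Num.min d T); first by rewrite lt_min d0.
apply: ae_imp rh => t rh /andP[t0]; rewrite lt_min => /andP[td tT].
rewrite ind_in ?in_itv/= ?t0// mul1r rh; last by rewrite /= in_itv/= !ltW.
have H : `|c - h t| <= `|c| / 2.
  by apply: hd => //; rewrite /ball/= sub0r normrN gtr0_norm.
have : `|e * (c - h t)| <= `|c| / 2.
  rewrite normrM (_ : `|e| = 1) ?mul1r//; apply/eqP.
  by rewrite -sqr_norm_eq1 expr2 e1.
rewrite mulrBr ec ler_norml => /andP[_]; lra.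
Qed.

(** Replacing rho and c by e rho and e c leaves c rho unchanged, as e^2 = 1, and makes the source
    positive near t = 0. *)
Lemma frequency_bound_trace (rho : R -> R) (c0 : R) (y : R * R -> R) :
  itg mu (fun t => \1_`]0, T[ t * rho t) ->
  continuous_value `[0, T] rho 0 c0 -> c0 != 0 -> itg nu (rect T y) ->
  exists C K l0, 0 <= C /\ forall l X chi MX Mchi c, l0 <= l -> bddm X -> bddm chi ->
    (forall x, `|X x| <= MX) -> (forall x, `|chi x| <= Mchi) ->
    {ae mu, forall t, 0 < t < T ->
      slice_pair X (rect T y) t - l ^+ 2 / Gam * rl_int (slice_pair X (rect T y)) t =
        (rl_int (slice_pair chi (rect T y)) t +
          c * rl_int (fun t => \1_`]0, T[ t * rho t) t) / Gam} ->
    `|c| <= C * l ^+ K * (expR (- (T * l ^+ 2)) * MX + Mchi).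
Proof.
move=> ir rho0 c0_neq0 iy.
have [e e1 [delta d0 lo]] := continuous_value_sign rho0 c0_neq0.
have rS : supp0T T (fun t => \1_`]0, T[ t * rho t).
  by move=> t tT; rewrite ind_notin ?mul0r// in_itv/=; exact/negP.
have eS : supp0T T (fun t => e * (\1_`]0, T[ t * rho t)).
  by move=> t tT; rewrite rS// mulr0.
have r00 : 0 < `|c0| / 2 by rewrite divr_gt0// normr_gt0.
have [C [K [l0 [C0 bound]]]] :=
  frequency_bound alpha_gt0 alpha_lt1 T_gt0 (itgZ e ir) eS r00 d0 lo iy.
exists C, K, l0; split => // l X chi MX Mchi c ll bX bchi XM chiM eqn.
have Ne : `|e| = 1 by apply/eqP; rewrite -sqr_norm_eq1 expr2 e1.
rewrite -[`|c|]mul1r -Ne -normrM.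
apply: (bound l X chi MX Mchi (e * c) ll bX bchi XM chiM).
apply: ae_imp2 eqn (ae_itg_rl alpha_gt0 ir rS) => t eqn it tI.
rewrite eqn//; congr ((_ + _) / _).
have -> : rl_int (fun t => e * (\1_`]0, T[ t * rho t)) t =
    e * rl_int (fun t => \1_`]0, T[ t * rho t) t.
  rewrite /rl_int -RintegralZl//; last exact: it.
  by apply: eq_Rintegral => s _; ring.
by rewrite mulrACA e1 mul1r.
Qed.

Section Sides.
Variables (po fo rhoo : R -> R) (y w : R * R -> R) (x0 C l0 : R) (K : nat).
Hypothesis bpo : bddm po.
Hypothesis iy : itg nu (rect T y).
Hypothesis iF : itg mu fo.
Hypothesis bound : forall l X chi MX Mchi c, l0 <= l -> bddm X -> bddm chi ->
  (forall x, `|X x| <= MX) -> (forall x, `|chi x| <= Mchi) ->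
  {ae mu, forall t, 0 < t < T ->
    slice_pair X (rect T y) t - l ^+ 2 / Gam * rl_int (slice_pair X (rect T y)) t =
      (rl_int (slice_pair chi (rect T y)) t + c * rl_int rhoo t) / Gam} ->
  `|c| <= C * l ^+ K * (expR (- (T * l ^+ 2)) * MX + Mchi).
Let Y t := rl_slice alpha T t y.
Let Q t := rl_second_deriv alpha T po fo rhoo y w t.
Hypothesis scal : {ae mu, forall t, 0 < t < T -> forall l c X chi, bddm X -> bddm chi ->
  c = \int[mu]_x (fo x * X x) ->
  \int[mu]_x ((l ^+ 2 * X x + (po x * X x + chi x)) * Y t x) = \int[mu]_x (X x * Q t x) ->
  slice_pair X (rect T y) t - l ^+ 2 / Gam * rl_int (slice_pair X (rect T y)) t =
    (rl_int (slice_pair chi (rect T y)) t + c * rl_int rhoo t) / Gam}.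

Lemma ind_mul_le (i : interval R) (chi : R -> R) M x : (forall x, `|chi x| <= M) ->
  `|\1_[set` i] x * chi x| <= M.
Proof.
move=> chiM; rewrite normrM; apply: le_trans (chiM x).
by rewrite ler_piMl//; exact: ind_bound.
Qed.

Lemma right_source_bound :
  {ae mu, forall t, 0 < t < T -> forall g, bddm g ->
    \int[mu]_x (\1_`]x0, 1[ x * (Y t x * g x)) =
    \int[mu]_x (Q t x * volt x0 1 (fun r => r) g x)} ->
  source_bound x0 1 po fo C K T l0.
Proof.
move=> adj l X chi MX Mchi ll bX bchi XM chiM XE.
(* Outside ]x0, 1[ the function X vanishes but chi need not; once chi is cut off, integrals over the
   line are integrals over ]x0, 1[. *)
have bchi' : bddm (fun x => \1_`]x0, 1[ x * chi x) by exact: bddmM (bddm_ind _) bchi.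
under eq_Rintegral do rewrite mulrC.
apply: (bound ll bX bchi' XM) => [x|]; first exact: ind_mul_le.
apply: ae_imp2 adj scal => t adj sc tI.
apply: (sc tI) => //.
have bg : bddm (fun z => l ^+ 2 * X z + (po z * X z + chi z)).
  by apply: bddmD (bddmD (bddmM bpo bX) bchi); exact: bddmM (bddm_cst _) bX.
transitivity (\int[mu]_x (Q t x * X x)); last by apply: eq_Rintegral => x _; exact: mulrC.
transitivity (\int[mu]_x (Q t x *
    volt x0 1 (fun r => r) (fun z => l ^+ 2 * X z + (po z * X z + chi z)) x)); last first.
  by apply: eq_Rintegral => x _; rewrite [in RHS]XE.
rewrite -(adj tI _ bg); apply: eq_Rintegral => x _.
have [xI|xI] := boolP (x \in `]x0, 1[); first by rewrite !(ind_in xI); ring.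
by rewrite !(ind_notin xI) XE volt_out//; ring.
Qed.

Lemma left_source_bound :
  {ae mu, forall t, 0 < t < T -> [/\ itg mu (Y t), itg mu (Q t) & forall g, bddm g ->
    \int[mu]_x (\1_`](- x0), 0[ x * (Y t (- x) * g x)) =
    \int[mu]_x (Q t (- x) * volt (- x0) 0 (fun r => r) g x)]} ->
  source_bound (- x0) 0 (fun x => po (- x)) (fun x => fo (- x)) C K T l0.
Proof.
move=> adj l X chi MX Mchi ll bX bchi XM chiM XE.
pose chi1 x := \1_`](- x0), 0[ x * chi x.
have bchi1 : bddm chi1 by exact: bddmM (bddm_ind _) bchi.
have bX' := bddm_opp bX; have bchi' := bddm_opp bchi1.
have refl (u v : R -> R) : bddm u -> itg mu v ->
    \int[mu]_x (u (- x) * v x) = \int[mu]_x (u x * v (- x)).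
  move=> bu iv; rewrite -(Rint_opp (itg_bddm (bddm_opp bu) iv)).
  by apply: eq_Rintegral => x _; rewrite opprK.
rewrite -refl//.
under eq_Rintegral do rewrite mulrC.
apply: (bound ll bX' bchi') => [x|x|]; [exact: XM|exact: ind_mul_le|].
apply: ae_imp2 adj scal => t adj sc tI; have [iY iQt adjt] := adj tI.
apply: (sc tI) => //.
have bg : bddm (fun z => l ^+ 2 * X z + (po (- z) * X z + chi z)).
  by apply: bddmD (bddmD (bddmM (bddm_opp bpo) bX) bchi); exact: bddmM (bddm_cst _) bX.
have bg1 : bddm (fun z => l ^+ 2 * X z + (po (- z) * X z + chi1 z)).
  by apply: bddmD (bddmD (bddmM (bddm_opp bpo) bX) bchi1); exact: bddmM (bddm_cst _) bX.
rewrite (refl _ _ bX iQt).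
transitivity (\int[mu]_x (Q t (- x) * X x)); last by apply: eq_Rintegral => x _; exact: mulrC.
transitivity (\int[mu]_x (Q t (- x) * volt (- x0) 0 (fun r => r)
    (fun z => l ^+ 2 * X z + (po (- z) * X z + chi z)) x)); last first.
  by apply: eq_Rintegral => x _; rewrite [in RHS]XE.
rewrite -(adjt _ bg).
transitivity (\int[mu]_x ((l ^+ 2 * X x + (po (- x) * X x + chi1 x)) * Y t (- x))).
  rewrite -(refl _ _ bg1 iY); apply: eq_Rintegral => x _; by rewrite opprK.
apply: eq_Rintegral => x _; rewrite /chi1.
have [xI|xI] := boolP (x \in `](- x0), 0[); first by rewrite !(ind_in xI); ring.
by rewrite !(ind_notin xI) XE volt_out//; ring.
Qed.

End Sides.

End SourceBounds.

Section GoodTimes.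
Context (R : realType) (alpha T x0 : R).
Hypotheses (alpha_gt0 : 0 < alpha) (T_gt0 : 0 < T) (x0_in : x0 \in `]0, 1[).
Local Notation mu := (@lebesgue_measure R).
Local Notation nu := (mu \x mu)%E.
Local Notation rlk := (rlk alpha).
Local Notation rl_int := (rl_int alpha).
Variables (p po f rho : R -> R) (y w : R * R -> R).
Local Notation fo := (fun x : R => \1_`]0, 1[ x * f x).
Local Notation rhoo := (fun t : R => \1_`]0, T[ t * rho t).
Local Notation Y t := (rl_slice alpha T t y).
Local Notation Q t := (rl_second_deriv alpha T po fo rhoo y w t).
Hypothesis mp : measurable_fun setT (fun x : R => \1_`]0, 1[ x * p x).
Hypothesis bpo : bddm po.
Hypothesis pE : {ae mu, forall x, x \in `]0, 1[ -> p x = po x}.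
Hypothesis iy : itg nu (rect T y).
Hypothesis iw : itg nu (rect T w).
Hypothesis iF : itg mu fo.
Hypothesis irho : itg mu rhoo.
Hypothesis yJ : ae_in 0 T (fun t => ae_in 0 1 (fun x => y (x, t) = Jop alpha w (x, t))).
Hypothesis Heq : ae_in 0 T (fun t =>
  exists2 yxx, distr_deriv2 0 1 (fun x => y (x, t)) yxx &
    forall psi, H10 0 1 psi ->
      L2_Hm1 0 1 (fun x => w (x, t)) psi - yxx psi
        + L2_Hm1 0 1 (fun x => p x * y (x, t)) psi =
      rho t * L2_Hm1 0 1 f psi).
Hypothesis tr : trace T (Jop alpha y) x0 (cst 0).
Hypothesis trx : trace_x T (Jop alpha y) x0 (cst 0).

Lemma supp0T_ind (h : R -> R) : supp0T T (fun t => \1_`]0, T[ t * h t).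
Proof. by move=> t tT; rewrite ind_notin ?mul0r// in_itv/=; exact/negP. Qed.

(** One null set of times serves for all g, hence for all frequencies l and all X and chi at
    once. *)
Lemma good_times : {ae mu, forall t, 0 < t < T ->
  [/\ itg nu (fun z => rlk (t - z.2) * rect T y z),
      itg nu (fun z => rlk (t - z.2) * rect T w z),
      {ae mu, forall x, x \in `]0, 1[ -> y (x, t) = Jop alpha w (x, t)},
      forall g, bddm g -> \int[mu]_x (\1_`]x0, 1[ x * (Y t x * g x)) =
        \int[mu]_x (Q t x * volt x0 1 (fun r => r) g x) &
      forall g, bddm g -> \int[mu]_x (\1_`](- x0), 0[ x * (Y t (- x) * g x)) =
        \int[mu]_x (Q t (- x) * volt (- x0) 0 (fun r => r) g x)]}.
Proof.
have ae_itv (P : R -> Prop) : ae_in 0 T P -> {ae mu, forall t, 0 < t < T -> P t}.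
  by apply: ae_imp => t h tI; apply: h; rewrite in_itv.
have supp u := @rect_supp R T u.
have ae_and (P P' : R -> Prop) : {ae mu, forall t, P t} -> {ae mu, forall t, P' t} ->
  {ae mu, forall t, P t /\ P' t} by exact: ae_imp2.
have ae1 := ae_and _ _ (ae_itg_rl2 alpha_gt0 iy (supp y)) (ae_itg_rl2 alpha_gt0 iw (supp w)).
have ae2 := ae_and _ _ (ae_itg_rl alpha_gt0 irho (supp0T_ind rho)) (ae_itv _ yJ).
have ae3 := ae_and _ _ (ae_itv _ tr) (ae_itv _ trx).
apply: ae_imp2 ae1 (ae_and _ _ ae2 ae3).
move=> t [iyt iwt] [[irt yJt] [trt trxt]] tI.
have [right left] := trace_adjoint bpo iy iw iF x0_in tI (iyt tI) (iwt tI)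
  (fun phi => weak_equation_time_int mp bpo pE iy iw Heq (iyt tI) (iwt tI) (irt tI))
  (trt tI) (trxt tI).
by split; [exact: iyt|exact: iwt|exact: yJt|exact: right|exact: left].
Qed.

Lemma source_bounds (c0 : R) : alpha < 1 -> continuous_value `[0, T] rho 0 c0 -> c0 != 0 ->
  exists C K l0, [/\ 0 <= C, source_bound x0 1 po fo C K T l0 &
    source_bound (- x0) 0 (fun x => po (- x)) (fun x => fo (- x)) C K T l0].
Proof.
move=> alpha_lt1 rho0 c0_neq0.
have [C [K [l0 [C0 bound]]]] :=
  frequency_bound_trace alpha_gt0 alpha_lt1 T_gt0 irho rho0 c0_neq0 iy.
have scal : {ae mu, forall t, 0 < t < T -> forall l c X chi, bddm X -> bddm chi ->
    c = \int[mu]_x (fo x * X x) ->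
    \int[mu]_x ((l ^+ 2 * X x + (po x * X x + chi x)) * Y t x) = \int[mu]_x (X x * Q t x) ->
    slice_pair X (rect T y) t - l ^+ 2 / Gamma alpha * rl_int (slice_pair X (rect T y)) t =
      (rl_int (slice_pair chi (rect T y)) t + c * rl_int rhoo t) / Gamma alpha}.
  apply: ae_imp good_times => t good tI l c X chi bX bchi.
  have [iyt iwt yJt _ _] := good tI.
  exact: (scalar_identity bpo iy iF tI iyt iwt bX bchi yJt).
exists C, K, l0; split => //.
- apply: right_source_bound scal _ => //.
  by apply: ae_imp good_times => t good tI; have [_ _ _ + _] := good tI.
- apply: left_source_bound scal _ => //.
  apply: ae_imp good_times => t good tI; have [iyt iwt _ _ adj] := good tI.
  split => //; first exact: itg_rl_slice.
  exact: itg_rl_second_deriv bpo iF iyt iwt.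
Qed.

End GoodTimes.

Theorem theorem1p1 (R : realType) (alpha T x0 : R)
  (alpha_gt0 : 0 < alpha) (alpha_lt1 : alpha < 1) (T_gt0 : 0 < T)
  (x0_in : x0 \in `]0, 1[)
  (p f rho : R -> R) (y : R * R -> R)
  (p_Linfty : Linfty 0 1 p) (f_L2 : L2 0 1 f)
  (rho_H1 : H1 0 T rho)
  (rho0 : exists2 c : R, continuous_value `[0, T] rho 0 c & c != 0)
  (y_Halpha : HalphaH1 alpha T y)
  (y_eq : equation alpha T p f rho y)
  (trace_y : trace T (Jop alpha y) x0 (cst 0))
  (trace_yx : trace_x T (Jop alpha y) x0 (cst 0)) :
  ae_in 0 1 (fun x => f x = 0).
Proof.
case: y_eq => w [[? [/L2L2_itg iy _ _]] [? [/L2L2_itg iw _ _]] yJ] y_eq.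
have [po bpo pE] := Linfty_bddm p_Linfty.
have mp : measurable_fun setT (fun x : R => \1_`]0, 1[ x * p x).
  by move: p_Linfty; rewrite /Linfty patch_ind inE => /andP[]; rewrite inE.
have iF := L2_itg f_L2.
have irho : itg (@lebesgue_measure R) (fun t : R => \1_`]0, T[ t * rho t).
  by case: rho_H1 => ? [/L2_itg].
case: rho0 => c0 rho0 c0_neq0.
have [C [K [l0 [C0 right left]]]] := source_bounds alpha_gt0 T_gt0 x0_in mp bpo pE iy iw iF
  irho yJ y_eq trace_y trace_yx alpha_lt1 rho0 c0_neq0.
have [x00 x01] : 0 < x0 /\ x0 < 1 by apply/andP; move: x0_in; rewrite in_itv.
have f_right := source_zero x01 bpo iF C0 T_gt0 right.
have f_left : {ae @lebesgue_measure R, forall x, x \in `](- x0), 0[ ->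
    \1_`]0, 1[ (- x) * f (- x) = 0}.
  apply: source_zero C0 T_gt0 left; first by rewrite oppr_lt0.
  - exact: bddm_opp bpo.
  - exact: itg_opp iF.
(* Reflecting back, f vanishes almost everywhere on both sides of x0, and the point x0 is
   negligible. *)
apply: ae_imp2 (ae_neq x0) (ae_imp2 (fun t => @conj _ _) f_right (ae_opp f_left)).
move=> x xx0 [fr fl] x_in; move: (x_in); rewrite in_itv/= => /andP[x_gt0 x_lt1].
case: (ltgtP x x0) xx0 => // h _.
  have := fl; rewrite opprK in_itv/= ltrN2 oppr_lt0 h x_gt0 => /(_ isT).
  by rewrite (ind_in x_in) mul1r.
have := fr; rewrite in_itv/= h x_lt1 => /(_ isT).
by rewrite (ind_in x_in) mul1r.
Qed.
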